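(* Let $X=\{X(t), t\in\mathbb{R}_+,\mathbb{P}^x\}$ be a time-homogeneous Markov process in $\mathbb{R}^d$ that satisfies Condition (A1) with some constant $H>0$. Assume that, with the same constant $H$, either (i) $1<Hd$ and Condition (A2) holds; or (ii) $1=Hd$ and Condition (A3) holds (Conditions (A1), (A2), (A3) are stated in the context). Then for all $x\in\mathbb{R}^d$, $$\mathbb{P}^x\Big\{\dim_{\mathrm H} X(E)=\frac1H\dim_{\mathrm H}E\ \text{ for all Borel sets } E\subseteq[0,\infty)\Big\}=1$$ and $$\mathbb{P}^x\Big\{\dim_{\mathrm P} X(E)=\frac1H\dim_{\mathrm P}E\ \text{ for all Borel sets } E\subseteq[0,\infty)\Big\}=1.$$
   Context: Standing assumptions: $X=\{X(t),t\in\mathbb{R}_+,\mathbb{P}^x\}$ is a time-homogeneous Markov process with state space $\mathbb{R}^d$ ($\mathbb{R}_+=[0,\infty)$; $\mathbb{P}^x$ is the law of $X$ started at $x$). It has the strong Markov property, is separable, and its sample paths are almost surely right continuous with left limits. The transition probability is $P(t,x,A)=\mathbb{P}^x(X(t)\in A)$ for Borel $A\subseteq\mathbb{R}^d$. $B(x,r)$ is the ball of radius $r$ centered at $x$, and $B(x,r)^c=\{y\in\mathbb{R}^d:|y-x|\ge r\}$. $X(E)=\{X(t):t\in E\}$. $\dim_{\mathrm H}$ and $\dim_{\mathrm P}$ denote Hausdorff and packing dimension. Condition (A1): There is a constant $H>0$ such that for any $\gamma\in(0,H)$ there exist constants $C>0$, $\eta>0$ and $t_0\in(0,1)$ such that for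 all $x\in\mathbb{R}^d$ and $0<t\le t_0$, $$\mathbb{P}^x\Big\{\sup_{0\le s\le t}|X(s)-x|\ge t^\gamma\Big\}\le C t^\eta.$$ Condition (A2): There is a sequence $J=\{(\varepsilon_n,\zeta_n),n\ge1\}$ of pairs of non-negative numbers, with $\varepsilon_n\to0$ and $\zeta_n\to0$ as $n\to\infty$, having the following property. For any $(\varepsilon,\zeta)\in J$ and any constant $T>0$ there exist positive constants $C_1$, $C_2$ and $r_0\le1$ such that for all $0<r\le r_0$, all $x,y\in\mathbb{R}^d$ with $|y-x|\le r$, and all $0<t\le T$, $$P(t,y,B(x,r))\ge C_1\min\Big\{1,\Big(\frac{r}{t^{H-\zeta}}\Big)^{d+\varepsilon}\Big\}\qquad(\ast)$$ and $$P(t,x,B(x,r))\le C_2\min\Big\{1,\Big(\frac{r}{t^{H+\zeta}}\Big)^{d-\varepsilon}\Big\}.\qquad(\ast\ast)$$ Condition (A3): Condition (A2) holds and, moreover, inequality $(\ast\ast)$ holds for all $t>0$ (while $(\ast)$ is required for $0<t\le T$). *)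

(* Defs.v *)
From mathcomp Require Import all_boot all_order all_algebra.
From mathcomp Require Import all_classical all_reals all_analysis.
From mathcomp Require Import measurable_realfun.

Set Implicit Arguments.
Unset Strict Implicit.
Unset Printing Implicit Defensive.

Import Order.TTheory GRing.Theory Num.Theory.
Import numFieldNormedType.Exports.

Local Open Scope classical_set_scope.
Local Open Scope ring_scope.

(* The library norm on 'rV[R]_d is the sup norm, so the Euclidean norm of R^d
   is written out here.  Both induce the library topology of 'rV[R]_d, which is
   the one used below for Borel sets and one-sided limits. *)
Definition euclid_norm {R : realType} {d : nat} (x : 'rV[R]_d) : R :=
  Num.sqrt (\sum_(i < d) x ord0 i ^+ 2).

Definition euclid_dist {R : realType} {d : nat} (x y : 'rV[R]_d) : R :=
  euclid_norm (x - y).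

Definition real_dist {R : realType} (x y : R) : R := `|x - y|.

Definition euclid_ball {R : realType} {d : nat} (x : 'rV[R]_d) (r : R) :
  set 'rV[R]_d := [set y | euclid_dist y x < r].

(* R^d with its Borel sigma-algebra; convertible to 'rV[R]_d. *)
Definition borelRd (R : realType) (d : nat) :=
  g_sigma_algebraType (@open ('rV[R]_d : topologicalType)).

Definition borel {R : realType} {d : nat} (B : set 'rV[R]_d) : Prop :=
  <<s @open ('rV[R]_d : topologicalType) >> B.

(* Hausdorff and packing dimension in a space T with distance dist. *)
Section Dimensions.
Context {R : realType} {T : Type} (dist : T -> T -> R).
Local Open Scope ereal_scope.

Definition diam (U : set T) : \bar R :=
  ereal_sup [set z | exists x y, [/\ U x, U y & z = (dist x y)%:E]].

(* diam(U)^s, with value 0 at the empty set also when s = 0 (while 0^0 = 1 for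
   a nonempty set of diameter 0). *)
Definition diam_pow (s : R) (U : set T) : \bar R :=
  if `[< U = set0 >] then 0 else poweR (diam U) s.

Definition hausdorff_premeasure (s delta : R) (A : set T) : \bar R :=
  ereal_inf [set z | exists U : (set T)^nat,
    [/\ A `<=` \bigcup_n U n, (forall n, diam (U n) <= delta%:E) &
        z = \sum_(0 <= n <oo) diam_pow s (U n)]].

(* The premeasure increases as delta decreases to 0, so that its limit is the
   supremum; likewise the limit defining packing_premeasure is an infimum. *)
Definition hausdorff_measure (s : R) (A : set T) : \bar R :=
  ereal_sup [set z | exists2 delta : R,
    (0 < delta)%R & z = hausdorff_premeasure s delta A].

Definition hausdorff_dim (A : set T) : \bar R :=
  ereal_inf [set s%:E | s in [set s : R | (0 <= s)%R /\
                                          hausdorff_measure s A = 0]].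

(* A delta-packing of A: finitely or countably many (indices in I) pairwise
   disjoint closed balls with centres in A and radii less than delta. *)
Definition packing (delta : R) (A : set T) (I : set nat) (c : nat -> T)
    (r : nat -> R) : Prop :=
  (forall n, I n -> [/\ A (c n), (0 < r n)%R & (r n < delta)%R]) /\
  trivIset I (fun n => [set y | (dist y (c n) <= r n)%R]).

Definition packing_premeasure (s : R) (A : set T) : \bar R :=
  ereal_inf [set z | exists2 delta : R, (0 < delta)%R &
    z = ereal_sup [set u | exists I c r, packing delta A I c r /\
          u = \esum_(n in I) ((2 * r n) `^ s)%:E]].

Definition packing_measure (s : R) (A : set T) : \bar R :=
  ereal_inf [set z | exists2 F : (set T)^nat, A `<=` \bigcup_n F n &
    z = \sum_(0 <= n <oo) packing_premeasure s (F n)].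

Definition packing_dim (A : set T) : \bar R :=
  ereal_inf [set s%:E | s in [set s : R | (0 <= s)%R /\
                                          packing_measure s A = 0]].

End Dimensions.

Section Markov.
Context {R : realType} {d : nat} {disp : measure_display}
  {Omega : measurableType disp}.
(* Time is R, and only nonnegative times are ever used; P x is the law
   started at x. *)
Variables (F : R -> set_system Omega) (X : R -> Omega -> 'rV[R]_d)
  (P : 'rV[R]_d -> probability Omega R).

Definition filtration : Prop :=
  [/\ forall t : R, 0 <= t -> sigma_algebra setT (F t),
      forall t : R, 0 <= t -> F t `<=` measurable &
      forall s t : R, 0 <= s -> s <= t -> F s `<=` F t].

Definition adapted : Prop :=
  forall (t : R) B, 0 <= t -> borel B -> F t (X t @^-1` B).

Definition transition (t : R) (x : 'rV[R]_d) (B : set 'rV[R]_d) : \bar R :=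
  P x (X t @^-1` B).

Definition markov_property : Prop :=
  forall x (s t : R) A B, 0 <= s -> 0 <= t -> F s A -> borel B ->
    P x (A `&` X (s + t) @^-1` B) =
    (\int[P x]_(w in A) transition t (X s w) B)%E.

(* F_{t+} *)
Definition right_filtration (t : R) : set_system Omega :=
  [set A | forall u, t < u -> F u A].

Definition optional_time (S : Omega -> \bar R) : Prop :=
  (forall w, (0 <= S w)%E) /\
  (forall t : R, 0 <= t -> F t [set w | (S w < t%:E)%E]).

(* F_{S+} *)
Definition optional_sigma_algebra (S : Omega -> \bar R) : set_system Omega :=
  [set A | measurable A /\
    forall t : R, 0 <= t ->
      right_filtration t (A `&` [set w | (S w <= t%:E)%E])].

Definition at_time (S : Omega -> \bar R) (t : R) (w : Omega) : 'rV[R]_d :=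
  X (fine (S w) + t) w.

(* For every optional time S, X_S is F_{S+}-measurable on {S < oo} and, there,
   P^x(X_{S+t} \in B | F_{S+}) = P(t, X_S, B). *)
Definition strong_markov_property : Prop :=
  forall S, optional_time S ->
    (forall B, borel B ->
       optional_sigma_algebra S
         ([set w | (S w < +oo)%E] `&` at_time S 0 @^-1` B)) /\
    (forall x (t : R) A B, 0 <= t -> optional_sigma_algebra S A -> borel B ->
       P x (A `&` [set w | (S w < +oo)%E] `&` at_time S t @^-1` B) =
       (\int[P x]_(w in A `&` [set w | (S w < +oo)%E])
          transition t (at_time S 0 w) B)%E).

(* Doob separability, relative to closed sets. *)
Definition separable : Prop :=
  forall x, exists D : set R,
    [/\ countable D, D `<=` `[0, +oo[ &
      {ae P x, forall w, forall (a b : R) (K : set 'rV[R]_d), closed K ->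
        (forall t : R, D t -> a < t < b -> K (X t w)) ->
        (forall t : R, 0 <= t -> a < t < b -> K (X t w))}].

Definition cadlag (f : R -> 'rV[R]_d) : Prop :=
  (forall t : R, 0 <= t -> f @ t^'+ --> f t) /\
  (forall t : R, 0 < t -> exists l : 'rV[R]_d, f @ t^'- --> l).

Record markov_process : Prop := MarkovProcess {
  mp_filtration : filtration;
  mp_adapted : adapted;
  mp_start : forall x, P x (X 0 @^-1` [set x]) = 1%E;
  mp_measurable : forall (t : R) B, 0 <= t -> borel B ->
    measurable_fun setT (fun x : borelRd R d => transition t x B);
  mp_markov : markov_property;
  mp_strong : strong_markov_property;
  mp_separable : separable;
  mp_cadlag : forall x, {ae P x, forall w, cadlag (X^~ w)}
}.

(* The event involves uncountably many times and is measurable only up to null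
   sets; the outer measure (P x)^* is the value of the completion of P x. *)
Definition conditionA1 (H : R) : Prop :=
  0 < H /\
  forall gamma : R, 0 < gamma -> gamma < H ->
    exists C eta t0 : R, [/\ 0 < C, 0 < eta, 0 < t0 < 1 &
      forall x (t : R), 0 < t -> t <= t0 ->
        (((P x)^*)%mu
           [set w | (t `^ gamma)%:E <=
              ereal_sup [set (euclid_norm (X s w - x))%:E | s in `[0%R, t]]]
         <= (C * t `^ eta)%:E)%E].

Definition lower_bound (H eps zeta C1 r0 : R) (I : set R) : Prop :=
  forall (r : R) x y (t : R), 0 < r -> r <= r0 -> euclid_dist y x <= r -> I t ->
    ((C1 * Num.min 1 ((r / t `^ (H - zeta)) `^ (d%:R + eps)))%:E
     <= transition t y (euclid_ball x r))%E.

Definition upper_bound (H eps zeta C2 r0 : R) (I : set R) : Prop :=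
  forall (r : R) x (t : R), 0 < r -> r <= r0 -> I t ->
    (transition t x (euclid_ball x r)
     <= (C2 * Num.min 1 ((r / t `^ (H + zeta)) `^ (d%:R - eps)))%:E)%E.

Definition vanishing_pairs (eps zeta : R^nat) : Prop :=
  [/\ forall n, 0 <= eps n /\ 0 <= zeta n,
      eps @ \oo --> (0 : R) & zeta @ \oo --> (0 : R)].

Definition conditionA2 (H : R) : Prop :=
  exists eps zeta : R^nat, vanishing_pairs eps zeta /\
  forall n (T : R), 0 < T ->
    exists C1 C2 r0 : R,
      [/\ 0 < C1, 0 < C2, 0 < r0 <= 1,
          lower_bound H (eps n) (zeta n) C1 r0 `]0, T] &
          upper_bound H (eps n) (zeta n) C2 r0 `]0, T]].

Definition conditionA3 (H : R) : Prop :=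
  exists eps zeta : R^nat, vanishing_pairs eps zeta /\
  forall n (T : R), 0 < T ->
    exists C1 C2 r0 : R,
      [/\ 0 < C1, 0 < C2, 0 < r0 <= 1,
          lower_bound H (eps n) (zeta n) C1 r0 `]0, T] &
          upper_bound H (eps n) (zeta n) C2 r0 `]0, +oo[].

End Markov.

(* Main.v *)
(* Fix gamma < H close to H, and put delta = 2^-n, r = delta^gamma.  Almost
   surely, for all large n and simultaneously for all dyadic intervals I of
   length delta in a bounded time span:
   - X(I) is covered by N balls of radius 9 r, with N fixed.  Otherwise X(I)
     has N + 1 points at mutual distance 8 r, which forces N successive exits
     from balls of radius 4 r within time delta; by (A1) and Ottaviani's
     inequality this has probability O(delta^(eta N)), and N eta >= 2 makes
     Borel-Cantelli applicable;
   - every ball of radius r meets X(I) for at most O(delta^-tau) intervals I.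
     By (A1), a ball hit during I is likely to contain X (up to a factor of its
     radius) at the end of I, so the upper bound of (A2) and H d >= 1 bound the
     expected number of further hits by O(n delta^(-tau/2)); by iterating
     Markov's inequality the tail decays faster than the polynomial number of
     balls of a grid.
   Covers of E therefore give covers of X(E) and conversely, with diameters
   raised to the power gamma, respectively 1/gamma, and only delta^-tau more
   sets.  This transfers Hausdorff nullity and upper box bounds, and hence both
   dimensions, for all sets E at once.

   All probabilities are estimated on finite dyadic grids of times, where the
   Markov property at deterministic times suffices; right continuity of the
   paths then reaches all times. *)
Require Import Defs.
From mathcomp Require Import all_boot all_order all_algebra.
From mathcomp Require Import all_classical all_reals all_analysis.
From mathcomp Require Import measurable_realfun.
From mathcomp Require Import ring lra.

Set Implicit Arguments.
Unset Strict Implicit.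
Unset Printing Implicit Defensive.

Import Order.TTheory GRing.Theory Num.Theory.
Import numFieldNormedType.Exports.

Local Open Scope classical_set_scope.
Local Open Scope ring_scope.

(** The exceptional null set may not depend on E, so everything random is stated about dyadic
    intervals and grid balls, and E enters only once a path is fixed. The upper bound for dim X(E)
    cannot rest on Hölder continuity, since paths may jump; it is enough that X(I) splits into
    boundedly many pieces of size r, because a constant number of sets per set of a cover does not
    change its exponent. The factor n in the expected number of further hits is a harmonic sum: at
    lag l delta the kernel is at most about delta^(-tau/2) / l when H d >= 1, and l runs up to a
    constant times 2^n. The loss tau/2 is shared in thirds between H - gamma, zeta and eps; another
    tau/4 absorbs n, and blocks of about delta^-tau hits leave a ratio delta^(tau/4), a high power
    of which beats the grid. Both dimensions are infima, so each passage between measures and covers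
    may enlarge the exponent a little. For packing, nullity is replaced by a countable union of
    pieces with O(r^-s) boxes: a maximal packing is a cover at a comparable scale. *)

(** * Finite sums and small powers *)

Lemma ler_sum_uniq_sub (R : numDomainType) (I : eqType) (s t : seq I)
    (F : I -> R) :
  (forall i, 0 <= F i) -> uniq s -> uniq t -> {subset s <= t} ->
  \sum_(i <- s) F i <= \sum_(i <- t) F i.
Proof.
move=> F0 us ut st.
have /(perm_big _) -> : perm_eq t (s ++ [seq x <- t | x \notin s]).
  apply: uniq_perm => //.
    rewrite cat_uniq us filter_uniq // andbT; apply/hasPn => x.
    by rewrite mem_filter => /andP[].
  move=> x; rewrite mem_cat mem_filter.
  by case: (boolP (x \in s)) => //= /st.
by rewrite big_cat /= lerDl sumr_ge0.
Qed.

Lemma sum_half_pow_le1 (R : realFieldType) n :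
  \sum_(0 <= i < n) 2^-1 ^+ i.+1 <= 1 :> R.
Proof.
suff -> : \sum_(0 <= i < n) 2^-1 ^+ i.+1 = 1 - 2^-1 ^+ n :> R.
  by rewrite gerBl exprn_ge0 // invr_ge0.
elim: n => [|n IH]; first by rewrite big_nil expr0 subrr.
by rewrite big_nat_recr //= IH exprS; lra.
Qed.

Lemma powR_small (R : realType) (s e eta : R) : 0 < s -> 0 < e -> 0 < eta ->
  exists t, [/\ 0 < t, t <= e & t `^ s <= eta].
Proof.
move=> s0 e0 eta0; exists (Num.min e (eta `^ s^-1)).
have m0 : 0 < Num.min e (eta `^ s^-1) by rewrite lt_min e0 powR_gt0.
split => //; first by rewrite ge_min lexx.
apply: le_trans (_ : (eta `^ s^-1) `^ s <= _).
  apply: ge0_ler_powR; rewrite ?nnegrE ?powR_ge0 //; try exact: ltW.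
  by rewrite ge_min lexx orbT.
by rewrite -powRrM mulVf ?gt_eqF// powRr1 // ltW.
Qed.

(** * Covers and Hausdorff measure *)

Section Covers.
Context {R : realType}.

Definition is_dist {T : Type} (dist : T -> T -> R) : Prop :=
  [/\ forall x, dist x x = 0, forall x y, dist x y = dist y x &
      forall x y z, dist x z <= dist x y + dist y z].

Definition small {T : Type} (dist : T -> T -> R) (U : set T) (r : R) : Prop :=
  forall x y, U x -> U y -> dist x y <= r.

(* Nullity for the s-dimensional Hausdorff measure, with the diameters replaced
   by positive upper bounds and the index set by any countable type. *)
Definition cover_null {T : Type} (dist : T -> T -> R) (s : R) (A : set T) :
    Prop :=
  forall e : R, 0 < e -> exists (I : countType) (U : I -> set T) (rho : I -> R),
    [/\ forall x, A x -> exists i, U i x,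
        forall i, 0 < rho i <= e,
        forall i, small dist (U i) (rho i) &
        forall t : seq I, uniq t -> \sum_(i <- t) rho i `^ s <= e].

(** Upper box dimension at most s, in the strong form that O(r^-s) sets of diameter r suffice at
    every small scale. *)
Definition box_bounded {T : Type} (dist : T -> T -> R) (s : R) (A : set T) :
    Prop :=
  exists C r0 : R, [/\ 0 < C, 0 < r0 & forall r : R, 0 < r -> r <= r0 ->
    exists (J : finType) (V : J -> set T),
      [/\ #|J|%:R <= C * r `^ (- s), forall j, small dist (V j) r &
          forall x, A x -> exists j, V j x]].

(** Packing dimension is the upper box dimension made countably stable. Accordingly this property
    stands for nullity of the packing measure, up to an arbitrarily small change of s. *)
Definition sigma_box_bounded {T : Type} (dist : T -> T -> R) (s : R)
    (A : set T) : Prop :=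
  exists (I : countType) (F : I -> set T),
    (forall x, A x -> exists i, F i x) /\ forall i, box_bounded dist s (F i).

Section Space.
Context {T : Type} (dist : T -> T -> R).
Hypothesis Hdist : is_dist dist.

Lemma is_dist_ge0 x y : 0 <= dist x y.
Proof.
have [d0 dC dT] := Hdist; have := dT x y x; rewrite d0 (dC y x).
by rewrite -mulr2n pmulrn_lge0.
Qed.

Lemma smallW (U : set T) (r r' : R) : r <= r' -> small dist U r -> small dist U r'.
Proof. by move=> rr h x y Ux Uy; apply: le_trans rr; apply: h. Qed.

Lemma diam_le (U : set T) r : small dist U r -> (diam dist U <= r%:E)%E.
Proof.
by move=> h; apply: ge_ereal_sup => _ [x [y [Ux Uy ->]]]; rewrite lee_fin h.
Qed.

Lemma diam_ge (U : set T) x y : U x -> U y -> ((dist x y)%:E <= diam dist U)%E.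
Proof. by move=> Ux Uy; apply: ereal_sup_ubound; exists x, y. Qed.

Lemma diam_ge0 (U : set T) : U !=set0 -> (0 <= diam dist U)%E.
Proof.
by move=> [x Ux]; apply: le_trans (diam_ge Ux Ux); rewrite lee_fin is_dist_ge0.
Qed.

Lemma diam_pow_ge0 s (U : set T) : (0 <= diam_pow dist s U)%E.
Proof. by rewrite /diam_pow; case: asboolP => // _; exact: poweR_ge0. Qed.

Lemma diam_pow_le (s : R) (U : set T) (r : R) : 0 <= s -> 0 <= r -> small dist U r ->
  (diam_pow dist s U <= (r `^ s)%:E)%E.
Proof.
move=> s0 r0 h; rewrite /diam_pow; case: asboolP => [_|/eqP/set0P U0].
  by rewrite lee_fin powR_ge0.
rewrite -poweR_EFin; apply: gt0_ler_poweR => //.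
- by rewrite in_itv /= diam_ge0 //= leey.
- by rewrite in_itv /= lee_fin r0 /= leey.
- exact: diam_le.
Qed.

Lemma hausdorff_measure0_of_cover_null (s : R) A : 0 <= s ->
  cover_null dist s A -> hausdorff_measure dist s A = 0%E.
Proof.
move=> s0 hA; apply/eqP; rewrite eq_le; apply/andP; split; last first.
  apply: le_trans (ereal_sup_ubound _); last by exists 1.
  apply: le_ereal_inf_tmp => _ [U [_ _ ->]].
  by apply: nneseries_ge0 => n _ _; exact: diam_pow_ge0.
apply: ge_ereal_sup => _ [delta d0 ->].
apply/lee_addgt0Pr => e e0; rewrite add0e.
have [|I [U [rho [AU rho_e Us sumle]]]] := hA (Num.min e delta).
  by rewrite lt_min e0.
(* Numbers that code no index give the empty set, whose [diam_pow] is 0 even for s = 0. *)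
pose U' n := if pickle_inv n is Some i then U i else set0.
apply: le_trans (ereal_inf_lbound _) _.
  exists U'; split; last by [].
  - move=> x /AU[i Ux]; exists (pickle i) => //.
    by rewrite /U' pickleK_inv.
  - move=> n; apply: diam_le; rewrite /U'; case: pickle_inv => [i|//].
    apply: smallW (Us i); have /andP[_] := rho_e i.
    by rewrite le_min => /andP[].
apply: lime_le; first by apply: is_cvg_nneseries => n _ _; exact: diam_pow_ge0.
apply: nearW => n.
pose t := pmap (@pickle_inv I) (iota 0 n).
apply: le_trans (_ : ((\sum_(i <- t) rho i `^ s)%:E <= _)%E); last first.
  rewrite lee_fin; apply: le_trans (sumle _ _) _.
    apply: pmap_uniq (iota_uniq _ _); exact: pickle_invK.
  by rewrite ge_min lexx.
rewrite /t /index_iota subn0; elim: (iota 0 n) => [|a l IH].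
  by rewrite !big_nil.
rewrite big_cons /= /U' /oapp; case E : (pickle_inv a) => [i|] /=.
  rewrite big_cons EFinD; apply: leeD IH.
  by apply: diam_pow_le => //; have /andP[/ltW] := rho_e i.
by rewrite {1}/diam_pow asboolT // add0e.
Qed.

(** A set of positive diameter keeps its diameter as radius, and since this is at most 1, passing
    from s to s' does not enlarge the sum. A set of diameter 0 needs a positive radius; as s' > 0,
    one can be chosen whose s'-th power is at most a summable error. *)
Lemma cover_null_of_hausdorff_measure0 (s s' : R) A : 0 <= s -> s < s' ->
  hausdorff_measure dist s A = 0%E -> cover_null dist s' A.
Proof.
move=> s0 ss' hA e e0.
have s'0 : 0 < s' by exact: (le_lt_trans s0 ss').
(* One half of e pays for the powers of the diameters, the other for the radii given to sets of
   diameter 0; the cap keeps all radii at most 1. *)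
pose e1 := Num.min e 1 / 2.
have e10 : 0 < e1 by rewrite divr_gt0 // lt_min e0 ltr01.
have e1e : e1 + e1 <= e by rewrite -splitr ge_min lexx.
have e11 : e1 <= 1.
  by rewrite ler_pdivrMr // mul1r ge_min (_ : 1 <= 2) ?orbT // ler1n.
have : (hausdorff_premeasure dist s e1 A < e1%:E)%E.
  apply: le_lt_trans (_ : (0 < _)%E); last by rewrite lte_fin.
  by rewrite -hA; apply: ereal_sup_ubound; exists e1.
move=> /ereal_inf_lt [_ [U [AU Ud ->]] sumU].
pose a n := diam_pow dist s (U n).
have a0 n : (0 <= a n)%E by exact: diam_pow_ge0.
have sma n : small dist (U n) e1.
  by move=> x y Ux Uy; rewrite -lee_fin; apply: le_trans (Ud n); apply: diam_ge.
have afin n : a n \is a fin_num.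
  rewrite ge0_fin_numE //; apply: le_lt_trans (ltry (e1 `^ s)).
  by apply: diam_pow_le => //; apply: ltW.
have /choice[rho hrho] : forall n : nat, exists r : R, [/\ 0 < r <= e1,
    small dist (U n) r & r `^ s' <= fine (a n) + e1 * 2^-1 ^+ n.+1].
  move=> n.
  have c0 : 0 < e1 * 2^-1 ^+ n.+1 by rewrite mulr_gt0 // exprn_gt0.
  have fa : 0 <= fine (a n) by rewrite fine_ge0.
  have [h|/existsNP[x /existsNP[y /not_implyP[Ux /not_implyP[Uy /negP h]]]]] :=
    pselect (small dist (U n) 0).
    have [t [t0 te tc]] := powR_small s'0 e10 c0.
    exists t; rewrite t0 te; split => //; first by apply: smallW h; exact: ltW.
    by apply: le_trans tc _; rewrite lerDr.
  rewrite -ltNge in h.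
  have Un0 : U n <> set0 by move=> U0; move: Ux; rewrite U0.
  have dpos : (0 < diam dist (U n))%E.
    by apply: lt_le_trans (diam_ge Ux Uy); rewrite lte_fin.
  have dfin : diam dist (U n) \is a fin_num.
    rewrite ge0_fin_numE ?ltW //; exact: le_lt_trans (Ud n) (ltry _).
  exists (fine (diam dist (U n))).
  have fd : 0 < fine (diam dist (U n)).
    by rewrite fine_gt0 // dpos -ge0_fin_numE ?ltW.
  have fd1 : fine (diam dist (U n)) <= e1 by rewrite -lee_fin fineK.
  split; first by rewrite fd fd1.
    by move=> u v Uu Uv; rewrite -lee_fin fineK //; exact: diam_ge.
  apply: le_trans (_ : fine (a n) <= _); last by rewrite lerDl ltW.
  rewrite /a /diam_pow asboolF // -{2}(fineK dfin) poweR_EFin /=.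
  apply: ger_powR; last exact: ltW.
  by rewrite fd (le_trans fd1).
exists nat, U, rho; split.
- by move=> x /AU[n _ Ux]; exists n.
- move=> n; have [/andP[-> h] _ _] := hrho n; apply: le_trans h _.
  by apply: le_trans e1e; rewrite lerDl ltW.
- by move=> n; have [] := hrho n.
move=> t ut; pose N := (\max_(i <- t) i).+1.
have tN : {subset t <= iota 0 N}.
  by move=> i it; rewrite mem_iota add0n ltnS leq_bigmax_seq.
apply: le_trans (ler_sum_uniq_sub _ ut (iota_uniq _ _) tN) _.
  by move=> i; exact: powR_ge0.
have rle i : true -> rho i `^ s' <= fine (a i) + e1 * 2^-1 ^+ i.+1.
  by have [] := hrho i.
apply: le_trans (ler_sum _ (fun i => rle i)) _.
rewrite big_split /=; apply: le_trans e1e; apply: lerD.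
  rewrite -lee_fin; apply: le_trans (ltW sumU).
  rewrite -sumEFin; have -> : (\sum_(i <- iota 0 N) (fine (a i))%:E =
      \sum_(0 <= i < N) a i)%E.
    by rewrite /index_iota subn0; apply: eq_bigr => i _; rewrite fineK.
  exact: (@nneseries_lim_ge _ _ xpredT).
rewrite -mulr_sumr; apply: ler_piMr; first exact: ltW.
by have := sum_half_pow_le1 R N; rewrite /index_iota subn0.
Qed.

End Space.
End Covers.

(** * Geometric scales and maximal separated families *)

Lemma expr_small (R : realType) (b e : R) : 0 <= b < 1 -> 0 < e ->
  exists n, b ^+ n <= e.
Proof.
move=> /andP[b0 b1] e0.
have /cvgr0_norm_lt /(_ e e0) [n _ h] : b ^+ n @[n --> \oo] --> (0 : R).
  by apply: cvg_expr; rewrite ger0_norm.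
exists n; have := h n (leqnn n).
by rewrite /= ger0_norm ?exprn_ge0 // => /ltW.
Qed.

Lemma powR_lt1 (R : realType) (b x : R) : 0 <= b < 1 -> 0 < x -> b `^ x < 1.
Proof.
move=> /andP[b0 b1] x0; have : b `^ x < 1 `^ x.
  by apply: gt0_ltr_powR; rewrite ?nnegrE.
by rewrite powR1.
Qed.

Lemma powRDp (R : realType) (b x y : R) : 0 < b ->
  b `^ (x + y) = b `^ x * b `^ y.
Proof. by move=> b0; rewrite powRD //; apply/implyP => _; rewrite gt_eqF. Qed.

Lemma expr_scale (R : realType) (b rho : R) : 0 < b < 1 -> 0 < rho < 1 ->
  exists n, b ^+ n.+1 <= rho < b ^+ n.
Proof.
move=> /andP[b0 b1] /andP[r0 r1].
have [k hk] : exists n, b ^+ n <= rho by apply: expr_small => //; rewrite ltW.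
have ex : exists n, b ^+ n <= rho by exists k.
case: (ex_minnP ex) => -[|n] hn hmin; first by move: hn; rewrite expr0 leNgt r1.
exists n; rewrite hn /= ltNge; apply/negP => /hmin.
by rewrite ltnn.
Qed.

Lemma sum_geometric_le (R : realFieldType) (q : R) m n : 0 <= q < 1 ->
  \sum_(k <- iota m n) q ^+ k <= q ^+ m / (1 - q).
Proof.
move=> /andP[q0 q1]; have q1' : 0 < 1 - q by rewrite subr_gt0.
suff -> : \sum_(k <- iota m n) q ^+ k = (q ^+ m - q ^+ (m + n)) / (1 - q).
  by rewrite ler_pM2r ?invr_gt0 // gerBl exprn_ge0.
elim: n m => [|n IH] m; first by rewrite big_nil addn0 subrr mul0r.
rewrite /= big_cons IH addSnnS exprS; field; lra.
Qed.

(** Otherwise every separated list in A could be extended by a further point, up to length N + 1. *)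
Lemma max_far (T : Type) (A : set T) (far : T -> T -> Prop) (N : nat) :
  (forall s : seq T, all (fun x => `[< A x >]) s ->
     pairwise (fun x y => `[< far x y >]) s -> (size s <= N)%N) ->
  exists s : seq T, [/\ all (fun x => `[< A x >]) s,
    pairwise (fun x y => `[< far x y >]) s &
    forall x, A x -> exists i : 'I_(size s), ~ far x (nth x s i)].
Proof.
move=> h; apply: contrapT => /forallNP nex.
suff [s [sA sf sz]] : exists s : seq T, [/\ all (fun x => `[< A x >]) s,
    pairwise (fun x y => `[< far x y >]) s & size s = N.+1].
  by have := h s sA sf; rewrite sz ltnn.
elim: N.+1 => [|k [s [sA sf sz]]]; first by exists [::].
have /existsNP[x /not_implyP[Ax /forallNP nx]] :
    ~ (forall x, A x -> exists i : 'I_(size s), ~ far x (nth x s i)).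
  by move=> H; apply: (nex s).
exists (x :: s); split => /=; last by rewrite sz.
  by rewrite sA andbT; apply/asboolP.
rewrite sf andbT; apply/(all_nthP x) => i si; apply/asboolP.
by apply: contrapT; exact: (nx (Ordinal si)).
Qed.

Lemma sum_le_count (R : numDomainType) (I : eqType) (t : seq I) (m : I -> nat)
    (G N : nat -> R) :
  (forall k, 0 <= G k) ->
  (forall k, (count (fun i => m i == k) t)%:R <= N k) ->
  \sum_(i <- t) G (m i) <= \sum_(k <- undup (map m t)) N k * G k.
Proof.
move=> G0 hN; rewrite -(big_map m xpredT G) -big_undup_iterop_count.
apply: ler_sum => k _; rewrite count_map.
rewrite (_ : iterop _ _ _ _ = G k *+ count (fun i => m i == k) t) //.
by rewrite -mulr_natl; apply: ler_wpM2r.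
Qed.

(** * Packing measure and box counting *)

Section Packing.
Context {R : realType} {T : Type} (dist : T -> T -> R) (t0 : T).
Hypothesis Hdist : is_dist dist.

Lemma packing_premeasure_ge0 (s : R) A : (0 <= packing_premeasure dist s A)%E.
Proof.
apply: le_ereal_inf_tmp => _ [delta _ ->].
apply: ereal_sup_ubound; exists set0, (fun=> t0), (fun=> 0); split.
  by split => // i j [].
by rewrite esum_set0.
Qed.

Lemma esum_card (k : nat) (a : R) : 0 <= a ->
  (\esum_(n in `I_k) a%:E)%E = (k%:R * a)%:E.
Proof.
move=> a0; rewrite esum_fset; [|exact: finite_II|by move=> *; rewrite lee_fin].
rewrite -fsbig_ord sumEFin sumr_const card_ord mulr_natl //.
Qed.

(** Take a maximal list of points of A whose closed balls of radius r / 4 are disjoint. As a packing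
    it has at most a constant times r^-s members; by maximality the ball around any point of A meets
    one of these balls, so the balls of radius r / 2 with the same centres cover A. *)
Lemma box_bounded_of_packing_premeasure (s : R) A : 0 <= s ->
  (packing_premeasure dist s A < +oo)%E -> box_bounded dist s A.
Proof.
have [d0 dC dT] := Hdist.
move=> s0 /ereal_inf_lt[_ [delta dl0 ->]].
set S := ereal_sup _ => Soo.
have Sge (n : nat) (a : R) : 0 <= a -> ((n%:R * a)%:E <= S)%E ->
    n%:R * a <= fine S.
  move=> a0 h; rewrite -lee_fin fineK // ge0_fin_numE //.
  by apply: le_trans h; rewrite lee_fin mulr_ge0.
have pack (r' : R) (l : seq T) : 0 < r' -> r' < delta ->
    all (fun x => `[< A x >]) l ->
    pairwise (fun x y => `[< ~ exists z, dist z x <= r' /\ dist z y <= r' >]) l ->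
    (size l)%:R <= fine S * (2 * r') `^ (- s).
  move=> r0 rd lA lf.
  have p0 : 0 < (2 * r') `^ s by rewrite powR_gt0 // mulr_gt0.
  rewrite powRN ler_pdivlMr //; apply: Sge; first exact: ltW.
  apply: ereal_sup_ubound; exists `I_(size l), (nth t0 l), (fun=> r').
  split; last by rewrite esum_card // ltW.
  split.
    move=> n nl; split => //.
    by have /(all_nthP t0) /(_ n nl) /asboolP := lA.
  have fn i j : (i < j)%N -> (j < size l)%N ->
      ~ ([set y | dist y (nth t0 l i) <= r'] `&`
         [set y | dist y (nth t0 l j) <= r'] !=set0).
    move=> ij jl [z [zi zj]].
    have /(pairwiseP t0) /(_ i j (ltn_trans ij jl) jl ij) /asboolP := lf.
    by apply; exists z.
  move=> i j /= il jl ne; case: (ltngtP i j) => // ij.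
    by case: (fn i j ij jl).
  by case: (fn j i ij il); rewrite setIC.
have S0 : 0 <= fine S.
  rewrite fine_ge0 //; apply: ereal_sup_ubound.
  exists set0, (fun=> t0), (fun=> 0); rewrite esum_set0; split => //.
  by split => // i j [].
(* The summand 1 keeps the constant positive when S = 0. *)
exists (fine S * (2^-1) `^ (- s) + 1), delta; split => //.
  by rewrite ltr_wpDl // mulr_ge0 // powR_ge0.
move=> r r0 rd.
have r40 : 0 < r / 4 by rewrite divr_gt0.
have r4d : r / 4 < delta by lra.
have [|l [lA lf lmax]] := @max_far _ A
    (fun x y => ~ exists z, dist z x <= r / 4 /\ dist z y <= r / 4)
    (Num.truncn (fine S * (2 * (r / 4)) `^ (- s))).
  move=> l lA lf; rewrite truncn_ge_nat ?mulr_ge0 ?powR_ge0 //.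
  exact: (pack (r / 4)).
exists 'I_(size l), (fun i : 'I_(size l) => [set x | dist x (nth t0 l i) <= r / 2]); split.
- rewrite card_ord; apply: le_trans (pack _ _ r40 r4d lA lf) _.
  have -> : 2 * (r / 4) = 2^-1 * r by lra.
  rewrite powRM //; last exact: ltW.
  rewrite mulrA; apply: ler_wpM2r; first exact: powR_ge0.
  by rewrite lerDl.
- move=> i x y /= xi yi; have := dT x (nth t0 l i) y.
  by rewrite (dC (nth t0 l i) y); lra.
- move=> x /lmax[i /contrapT[z [zx zi]]]; exists i => /=.
  have xt : nth x l i = nth t0 l i by exact: set_nth_default.
  by rewrite xt in zi; have := dT x z (nth t0 l i); rewrite (dC x z); lra.
Qed.

(** A decomposition of total premeasure below 1 has pieces of finite premeasure. *)
Lemma sigma_box_bounded_of_packing_measure0 (s : R) A : 0 <= s ->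
  packing_measure dist s A = 0%E -> sigma_box_bounded dist s A.
Proof.
move=> s0 A0.
have /ereal_inf_lt[_ [F AF ->] Foo] : (packing_measure dist s A < 1)%E.
  by rewrite A0 lte_fin.
exists nat, F; split; first by move=> x /AF[n _ Fx]; exists n.
move=> n; apply: box_bounded_of_packing_premeasure => //.
apply: le_lt_trans (lt_trans Foo (ltry 1)).
apply: le_trans (nneseries_lim_ge n.+1 _); last first.
  by move=> i _ _; exact: packing_premeasure_ge0.
rewrite big_nat_recr //= leeDr // sume_ge0 // => i _.
exact: packing_premeasure_ge0.
Qed.

(** Balls are grouped by the level k with 2^-(k+1) <= r < 2^-k. Two disjoint balls of a level cannot
    have their centres in a common set of diameter 2^-(k+1), so the box bound limits their number,
    and the level contributes at most a constant times q^k. Radii below [b ^+ m0] leave only the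
    tail of this geometric series. *)
Lemma packing_sum_le (s s' C r0 e : R) (A : set T) : 0 <= s -> s < s' -> 0 < e ->
  0 < C -> 0 < r0 ->
  (forall r : R, 0 < r -> r <= r0 -> exists (J : finType) (V : J -> set T),
      [/\ #|J|%:R <= C * r `^ (- s), forall j, small dist (V j) r &
          forall x, A x -> exists j, V j x]) ->
  exists2 delta : R, 0 < delta & forall I c r (t : seq nat),
    packing dist delta A I c r -> uniq t -> (forall i, i \in t -> I i) ->
    \sum_(i <- t) (2 * r i) `^ s' <= e.
Proof.
have [d0 dC dT] := Hdist.
move=> s0 ss' e0 C0 r00 box; have s'0 := le_lt_trans s0 ss'.
pose b : R := 2^-1.
have b0 : 0 < b by rewrite invr_gt0.
have b1 : b < 1 by rewrite invf_lt1 // ltr1n.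
pose q := b `^ (s' - s).
have q0 : 0 < q by rewrite powR_gt0.
have q1 : q < 1.
  by rewrite /q powR_lt1 ?subr_gt0 // b1 ltW.
have D0 : 0 < C * 4 `^ s' by rewrite mulr_gt0 // powR_gt0.
(* With this m0 the geometric tail C 4^s' q^m0 / (1 - q) is at most e. *)
have [m0 hm0] : exists m, q ^+ m <= e * (1 - q) / (C * 4 `^ s').
  apply: expr_small; first by rewrite ltW.
  by rewrite divr_gt0 // mulr_gt0 // subr_gt0.
pose d1 := Num.min r0 1.
have d10 : 0 < d1 by rewrite lt_min r00 ltr01.
exists (Num.min d1 (b ^+ m0)); first by rewrite lt_min d10 exprn_gt0.
move=> I c r t [pI pD] ut tI.
have hr (i : nat) : i \in t -> [/\ A (c i), 0 < r i & r i < Num.min d1 (b ^+ m0)].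
  by move=> /tI; exact: pI.
have /choice[m hm] : forall i : nat, exists k : nat, i \in t ->
    [/\ b ^+ k.+1 <= r i, r i < b ^+ k & (m0 <= k)%N].
  move=> i; case: (boolP (i \in t)) => [it|]; last by exists 0%N.
  have [_ ri0] := hr i it; rewrite !lt_min => /andP[/andP[_ ri1] rim].
  have [k /andP[k1 k2]] := @expr_scale _ b (r i) (introT andP (conj b0 b1))
    (introT andP (conj ri0 ri1)).
  exists k => _; split => //; rewrite leqNgt; apply/negP => km.
  have : b ^+ m0 <= b ^+ k.+1 by rewrite ler_wiXn2l // ltW.
  by lra.
(* As b = 1/2, this base is 2 b^k, which exceeds the diameter bound 2 r of every ball on level k. *)
pose G k := (4 * b ^+ k.+1) `^ s'.
have FG : \sum_(i <- t) (2 * r i) `^ s' <= \sum_(i <- t) G (m i).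
  rewrite big_seq [leRHS]big_seq; apply: ler_sum => i it.
  have [h1 h2 _] := hm i it; have [_ ri0 _] := hr i it.
  apply: ge0_ler_powR; rewrite ?nnegrE; first exact: ltW.
  - by rewrite mulr_ge0 // ltW.
  - by rewrite mulr_ge0 // exprn_ge0 // ltW.
  - by rewrite exprS /b in h2 *; lra.
apply: le_trans FG _.
have cnt k : k \in map m t ->
    (count (fun i => m i == k) t)%:R <= C * (b ^+ k.+1) `^ (- s).
  move=> /mapP[i0 i0t ki0].
  have [h1 h2 _] := hm i0 i0t; have [_ _] := hr i0 i0t.
  rewrite !lt_min => /andP[/andP[rr0 _] _].
  have [|J [V [JC Vs cov]]] := box (b ^+ k.+1) (exprn_gt0 _ b0).
    by rewrite ki0; apply: le_trans h1 (ltW rr0).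
  apply: le_trans JC; rewrite ler_nat -size_filter.
  set tk := seq.filter _ t.
  have tkP (i : nat) : i \in tk -> i \in t /\ m i = k.
    by rewrite mem_filter => /andP[/eqP].
  (* The choice goes to [option J] because it must also be defined at indices outside [tk], while J
     may be empty. *)
  have /choice[v hv] : forall i : nat, exists j : option J, i \in tk ->
      if j is Some j then V j (c i) else False.
    move=> i; case: (boolP (i \in tk)) => [/tkP[it _]|]; last by exists None.
    by have [/cov[j Vj] _ _] := hr i it; exists (Some j).
  (* If two centres share a set of the cover, the centre [c j] lies in both balls, which are
     disjoint. *)
  have vinj : {in tk &, injective v}.
    move=> i j itk jtk vij; have [it mi] := tkP i itk; have [jt mj] := tkP j jtk.
    apply: (pD i j (tI i it) (tI j jt)); exists (c j); split => /=; last first.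
      by rewrite d0; have [_ /ltW] := hr j jt.
    have := hv i itk; have := hv j jtk; rewrite -vij; case: (v i) => // a Vj Vi.
    have [h _ _] := hm i it; apply: le_trans h; rewrite mi; exact: (Vs a (c j) (c i)).
  have sub : {subset map v tk <= map Some (enum J)}.
    move=> _ /mapP[i itk ->]; have := hv i itk; case: (v i) => // a _.
    by rewrite map_f // mem_enum.
  rewrite cardE -(size_map v tk) -(size_map Some (enum J)).
  apply: uniq_leq_size sub.
  by rewrite map_inj_in_uniq // filter_uniq.
pose N k : R := if k \in map m t then C * (b ^+ k.+1) `^ (- s) else 0.
apply: le_trans (@sum_le_count _ _ t m G N _ _) _.
- by move=> k; exact: powR_ge0.
- move=> k; rewrite /N; case: ifPn => [/cnt //|kt].
  rewrite (_ : count _ _ = 0%N) //; apply/eqP; rewrite -leqn0 leqNgt -has_count.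
  apply/hasPn => i it; apply: contraNneq kt => <-; exact: map_f.
have NG k : k \in undup (map m t) -> N k * G k <= C * 4 `^ s' * q ^+ k.
  rewrite mem_undup /N => ->; rewrite /G powRM //; last first.
    by rewrite exprn_ge0 // ltW.
  have bk : b ^+ k.+1 = b `^ k.+1%:R by rewrite powR_mulrn // ltW.
  rewrite bk -!powRrM mulrACA -powRDp //.
  rewrite (_ : k.+1%:R * - s + k.+1%:R * s' = (s' - s) * k.+1%:R); last by ring.
  rewrite (powRrM b) -/q powR_mulrn; last exact: ltW.
  apply: ler_wpM2l; first exact: ltW.
  by apply: ler_wiXn2l => //; exact: ltW.
pose L := \max_(k <- map m t) k.
have subL : {subset undup (map m t) <= iota m0 L.+1}.
  move=> k; rewrite mem_undup mem_iota => kt; apply/andP; split.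
    by have /mapP[i it ->] := kt; have [] := hm i it.
  by rewrite addnS ltnS; apply: leq_trans (leq_addl _ _); exact: leq_bigmax_seq.
rewrite big_seq; apply: le_trans (ler_sum _ NG) _.
rewrite -big_seq -mulr_sumr.
apply: le_trans (_ : C * 4 `^ s' * (q ^+ m0 / (1 - q)) <= _).
  rewrite ler_wpM2l ?(ltW D0) //.
  apply: le_trans (sum_geometric_le _ _ _); last by rewrite q1 ltW.
  apply: ler_sum_uniq_sub (undup_uniq _) (iota_uniq _ _) subL => k.
  by rewrite exprn_ge0 // ltW.
have q1' : 0 < 1 - q by rewrite subr_gt0.
by move: hm0; rewrite ler_pdivlMr // mulrA ler_pdivrMr // mulrC.
Qed.

Lemma packing_measure0_of_sigma_box_bounded (s s' : R) A : 0 <= s -> s < s' ->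
  sigma_box_bounded dist s A -> packing_measure dist s' A = 0%E.
Proof.
move=> s0 ss' [I [F [AF Fb]]].
have pre0 B : box_bounded dist s B -> packing_premeasure dist s' B = 0%E.
  move=> [C [r0 [C0 r00 box]]]; apply/eqP.
  rewrite eq_le packing_premeasure_ge0 andbT.
  apply/lee_addgt0Pr => e e0; rewrite add0e.
  have [delta d0 hd] := packing_sum_le s0 ss' e0 C0 r00 box.
  apply: le_trans (ereal_inf_lbound _) _; first by exists delta.
  apply: ge_ereal_sup => _ [K [c [r [pk ->]]]].
  apply: ge_ereal_sup => _ [X [Xf XK] <-].
  rewrite fsbig_finite //= sumEFin lee_fin; apply: hd pk _ _.
    exact: finmap.fset_uniq.
  by move=> i; rewrite in_fset_set // inE => /XK.
apply/eqP; rewrite eq_le; apply/andP; split; last first.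
  apply: le_ereal_inf_tmp => _ [G _ ->].
  by apply: nneseries_ge0 => n _ _; exact: packing_premeasure_ge0.
apply: ereal_inf_lbound.
exists (fun n => if pickle_inv n is Some i then F i else set0).
  by move=> x /AF[i Fx]; exists (pickle i) => //=; rewrite pickleK_inv.
rewrite eseries0 // => n _ _; apply: pre0; case: pickle_inv => // .
(* The empty set, placed at numbers that code no index, is covered by no sets at all. *)
exists 1, 1; split => // r r0 _; exists 'I_0, (fun=> set0); split.
- by rewrite card_ord mul1r powR_ge0.
- by move=> _ x y [].
- by [].
Qed.
End Packing.

(** * Transfer of covers along a relation *)

(** Covers carry their own index types; once these are chosen, the families of sets live in types
    that depend on the choice. *)
Lemma dependent_choice (K : Type) (B : K -> Type) (P : forall k, B k -> Prop) :
  (forall k, exists b, P k b) -> exists f : forall k, B k, forall k, P k (f k).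
Proof.
by move=> h; exists (fun k => projT1 (cid (h k))) => k; exact: projT2 (cid (h k)).
Qed.

Lemma sum_tagged_le (R : numDomainType) (I : eqType) (J : I -> eqType)
    (F : {i : I & J i} -> R) (b : I -> R) (t : seq {i : I & J i}) :
  (forall i (u : seq (J i)), uniq u -> \sum_(j <- u) F (Tagged J j) <= b i) ->
  uniq t -> \sum_(p <- t) F p <= \sum_(i <- undup (map tag t)) b i.
Proof.
move=> hb ut.
have -> : \sum_(p <- t) F p =
    \sum_(i <- undup (map tag t)) \sum_(p <- t | tag p == i) F p.
  under [RHS]eq_bigr do rewrite big_mkcond.
  rewrite exchange_big big_seq [RHS]big_seq; apply: eq_bigr => p pt.
  rewrite (bigD1_seq (tag p)) ?undup_uniq ?mem_undup ?map_f //= eqxx.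
  by rewrite big1 ?addr0 // => i; rewrite eq_sym => /negbTE ->.
apply: ler_sum => i _; rewrite -big_filter.
(* The pairs over i are the tagged copies of a list in [J i], to which the hypothesis applies. *)
have [u eu] : exists u : seq (J i),
    [seq p <- t | tag p == i] = map (fun j => Tagged J j) u.
  have : all (fun p : {i : I & J i} => tag p == i) [seq p <- t | tag p == i].
    exact: filter_all.
  elim: [seq p <- t | tag p == i] => [|[k j] l IH] /=; first by exists [::].
  move=> /andP[/eqP /= ki]; move: IH; case: _ / ki => IH /IH[u ->].
  by exists (j :: u).
rewrite eu big_map; apply: hb.
have := filter_uniq (fun p : {i : I & J i} => tag p == i) ut.
by rewrite eu => /map_uniq.
Qed.

Lemma sum_fin_const_le (R : numDomainType) (J : finType) (u : seq J) (c : R) :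
  0 <= c -> uniq u -> \sum_(j <- u) c <= #|J|%:R * c.
Proof.
move=> c0 uu; rewrite big_const_seq count_predT iter_addr_0 mulr_natl.
by apply: ler_wpMn2l => //; rewrite cardE uniq_leq_size // => j; rewrite mem_enum.
Qed.

Definition rel_image {T1 T2 : Type} (rel : T1 -> T2 -> Prop) (A : set T1) :
  set T2 := [set y | exists2 x, A x & rel x y].

(** For the graph of a function and kappa = 0 this takes the place of Hölder continuity of order
    alpha: the image of a small set may fall into several small pieces, so jumps are allowed. A
    positive kappa lets the number of pieces grow. *)
Definition spreads {R : realType} {T1 T2 : Type} (d1 : T1 -> T1 -> R)
    (d2 : T2 -> T2 -> R) (rel : T1 -> T2 -> Prop) (alpha kappa : R) : Prop :=
  exists C r0 : R, [/\ 0 < C, 0 < r0 & forall (rho : R) U, 0 < rho ->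
    rho <= r0 -> small d1 U rho -> exists (J : finType) (V : J -> set T2),
      [/\ #|J|%:R <= C * rho `^ (- kappa),
          forall j, small d2 (V j) (C * rho `^ alpha) &
          forall x y, U x -> rel x y -> exists j, V j y]].

Section Closure.
Context {R : realType} {T : Type} (dist : T -> T -> R).

Lemma cover_null_subset (s : R) (A B : set T) : B `<=` A ->
  cover_null dist s A -> cover_null dist s B.
Proof.
move=> BA hA e /hA[I [U [rho [AU h1 h2 h3]]]].
by exists I, U, rho; split => // x /BA /AU.
Qed.

Lemma cover_nullW (s s' : R) A : s <= s' ->
  cover_null dist s A -> cover_null dist s' A.
Proof.
move=> ss' hA e e0; have [|I [U [rho [AU h1 h2 h3]]]] := hA (Num.min e 1).
  by rewrite lt_min e0 ltr01.
exists I, U, rho; split => //.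
  by move=> i; have /andP[-> /=] := h1 i; rewrite le_min => /andP[].
move=> t /h3 h; apply: le_trans (le_trans h _); last by rewrite ge_min lexx.
apply: ler_sum => i _; apply: ger_powR ss'.
by have /andP[-> /=] := h1 i; rewrite le_min => /andP[].
Qed.

Lemma cover_null_bigcup (s : R) (A : nat -> set T) :
  (forall k, cover_null dist s (A k)) -> cover_null dist s (\bigcup_k A k).
Proof.
move=> hA e e0.
have c0 k : 0 < e * 2^-1 ^+ k.+1 by rewrite mulr_gt0 // exprn_gt0.
have ce k : e * 2^-1 ^+ k.+1 <= e.
  by rewrite ger_pMr // exprn_ile1 // invf_le1 // ler1n.
have /dependent_choice[I /dependent_choice[U /dependent_choice[rho h]]] :=
  fun k => hA k _ (c0 k).
exists {k : nat & I k}, (fun i => U (tag i) (tagged i)),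
  (fun i => rho (tag i) (tagged i)); split.
- move=> x [k _ Akx]; have [/(_ x Akx) [i Ui] _ _ _] := h k.
  by exists (Tagged I i).
- move=> [k i] /=; have [_ /(_ i)/andP[-> hk] _ _] := h k.
  exact: le_trans hk (ce k).
- by move=> [k i] /=; have [_ _ hk _] := h k; exact: hk.
- move=> t ut.
  have hs k (u : seq (I k)) : uniq u ->
      \sum_(j <- u) rho k j `^ s <= e * 2^-1 ^+ k.+1.
    by have [_ _ _] := h k; apply.
  apply: le_trans (sum_tagged_le hs ut) _; rewrite -mulr_sumr ger_pMr //.
  pose N := (\max_(i <- map tag t) i).+1.
  apply: le_trans (sum_half_pow_le1 R N).
  rewrite /index_iota subn0.
  apply: ler_sum_uniq_sub (undup_uniq _) (iota_uniq _ _) _.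
    by move=> i; rewrite exprn_ge0.
  by move=> i; rewrite mem_undup mem_iota add0n ltnS => it; apply: leq_bigmax_seq.
Qed.

Lemma box_boundedW (s s' : R) A : s <= s' ->
  box_bounded dist s A -> box_bounded dist s' A.
Proof.
move=> ss' [C [r0 [C0 r00 box]]]; exists C, (Num.min r0 1); split => //.
  by rewrite lt_min r00 ltr01.
move=> r rp; rewrite le_min => /andP[rr0 r1].
have [J [V [h1 h2 h3]]] := box r rp rr0; exists J, V; split => //.
apply: le_trans h1 _; rewrite ler_wpM2l ?(ltW C0) //.
by apply: ger_powR; rewrite ?rp // lerN2.
Qed.

Lemma sigma_box_boundedW (s s' : R) A : s <= s' ->
  sigma_box_bounded dist s A -> sigma_box_bounded dist s' A.
Proof.
move=> ss' [I [F [AF Fb]]]; exists I, F; split => // i.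
exact: box_boundedW (Fb i).
Qed.

Lemma sigma_box_bounded_subset (s : R) (A B : set T) : B `<=` A ->
  sigma_box_bounded dist s A -> sigma_box_bounded dist s B.
Proof. by move=> BA [I [F [AF Fb]]]; exists I, F; split => // x /BA /AF. Qed.

Lemma sigma_box_bounded_bigcup (s : R) (A : nat -> set T) :
  (forall k, sigma_box_bounded dist s (A k)) ->
  sigma_box_bounded dist s (\bigcup_k A k).
Proof.
move=> hA; have /dependent_choice[I /dependent_choice[F h]] := hA.
exists {k : nat & I k}, (fun i => F (tag i) (tagged i)).
split => [x [k _ Akx]|[k i] /=]; last by have [_] := h k; apply.
by have [/(_ x Akx) [i Ui] _] := h k; exists (Tagged I i).
Qed.
End Closure.

Section Transfer.
Context {R : realType} {T1 T2 : Type} (d1 : T1 -> T1 -> R) (d2 : T2 -> T2 -> R)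
  (rel : T1 -> T2 -> Prop) (alpha kappa : R).
Hypotheses (a0 : 0 < alpha) (hrel : spreads d1 d2 rel alpha kappa).

(** A set of radius rho becomes C rho^-kappa sets of radius C rho^alpha; with the new exponent s'
    the sum of their powers is C C^s' rho^(alpha s' - kappa) = C C^s' rho^s. *)
Lemma cover_null_transfer (s : R) A : cover_null d1 s A ->
  cover_null d2 ((s + kappa) / alpha) (rel_image rel A).
Proof.
have [C [r0 [C0 r00 hC]]] := hrel.
move=> hA e e0; set s' := (s + kappa) / alpha.
have D0 : 0 < C * C `^ s' by rewrite mulr_gt0 // powR_gt0.
have [t [t0 _ tC]] := powR_small a0 e0 (divr_gt0 e0 C0).
(* The bounds serve, in this order, the range of [spreads], the size of the new radii and the size
   of the new sum. *)
pose e1 := Num.min (Num.min r0 t) (e / (C * C `^ s')).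
have e10 : 0 < e1 by rewrite !lt_min r00 t0 divr_gt0.
have [I [U [rho [AU h1 h2 h3]]]] := hA e1 e10.
have hi i : exists (J : finType) (V : J -> set T2),
      [/\ #|J|%:R <= C * rho i `^ (- kappa),
          forall j, small d2 (V j) (C * rho i `^ alpha) &
          forall x y, U i x -> rel x y -> exists j, V j y].
  have /andP[ri0] := h1 i; rewrite !le_min => /andP[/andP[rr0 _] _].
  exact: hC.
have /dependent_choice[J /dependent_choice[V hV]] := hi.
exists {i : I & J i},
  (fun k => V (tag k) (tagged k)), (fun k => C * rho (tag k) `^ alpha).
split.
- move=> y [x /AU[i Ui] xy]; have [_ _ h] := hV i.
  by have [j Vj] := h x y Ui xy; exists (Tagged J j).
- move=> [i j] /=; have /andP[ri0] := h1 i.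
  rewrite !le_min => /andP[/andP[_ rt] _].
  rewrite mulr_gt0 ?powR_gt0 //= -ler_pdivlMl // mulrC.
  apply: le_trans tC; apply: ge0_ler_powR; rewrite ?nnegrE //; exact: ltW.
- by move=> [i j] /=; have [_ h _] := hV i; exact: h.
- move=> u uu.
  have h i (v : seq (J i)) : uniq v ->
      \sum_(j <- v) (C * rho i `^ alpha) `^ s' <= C * C `^ s' * rho i `^ s.
    move=> uv; apply: le_trans (sum_fin_const_le (powR_ge0 _ _) uv) _.
    have [h _ _] := hV i; have /andP[ri0 _] := h1 i.
    apply: le_trans (ler_wpM2r (powR_ge0 _ _) h) _.
    rewrite powRM ?powR_ge0 ?(ltW C0) // mulrACA -powRrM -powRDp //.
    rewrite (_ : - kappa + alpha * s' = s) // /s'; field; exact: lt0r_neq0.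
  apply: le_trans (sum_tagged_le h uu) _; rewrite -mulr_sumr mulrC.
  rewrite -ler_pdivlMr //; apply: le_trans (h3 _ (undup_uniq _)) _.
  by rewrite /e1 ge_min lexx orbT.
Qed.

Lemma box_bounded_transfer (s : R) A : box_bounded d1 s A ->
  box_bounded d2 ((s + kappa) / alpha) (rel_image rel A).
Proof.
have [C [r0 [C0 r00 hC]]] := hrel.
move=> [C1 [r1 [C10 r10 box]]]; set s' := (s + kappa) / alpha.
have m0 : 0 < Num.min r0 r1 by rewrite lt_min r00.
exists (C1 * C * C `^ s'), (C * Num.min r0 r1 `^ alpha); split.
- by rewrite !mulr_gt0 // powR_gt0.
- by rewrite mulr_gt0 // powR_gt0.
(* The solution of C rho^alpha = r. *)
move=> r rp rle; pose rho := (r / C) `^ alpha^-1.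
have rC : 0 < r / C by rewrite divr_gt0.
have rho0 : 0 < rho by rewrite powR_gt0.
have rhoa : C * rho `^ alpha = r.
  rewrite /rho -powRrM mulVf ?gt_eqF // powRr1 ?(ltW rC) //.
  by rewrite mulrCA divff ?gt_eqF // mulr1.
have : rho <= Num.min r0 r1.
  rewrite -[leRHS]powRr1 ?(ltW m0) // -(mulfV (lt0r_neq0 a0)) powRrM.
  apply: ge0_ler_powR; rewrite ?nnegrE ?powR_ge0 ?invr_ge0 ?(ltW a0) ?(ltW rC) //.
  by rewrite ler_pdivrMr // mulrC.
rewrite le_min => /andP[rho_r0 rho_r1].
have [J [V [JC Vs cov]]] := box rho rho0 rho_r1.
have /dependent_choice[W /dependent_choice[Y hY]] :=
  fun j => hC rho (V j) rho0 rho_r0 (Vs j).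
exists {j : J & W j}, (fun k => Y (tag k) (tagged k)).
split.
- rewrite card_tagged sumnE big_map big_enum /= natr_sum.
  apply: le_trans (_ : \sum_(j : J) C * rho `^ (- kappa) <= _).
    by apply: ler_sum => j _; have [] := hY j.
  rewrite sumr_const -mulr_natl.
  apply: le_trans (ler_wpM2r (mulr_ge0 (ltW C0) (powR_ge0 _ _)) JC) _.
  rewrite mulrACA -powRDp // -opprD /rho -powRrM.
  rewrite (_ : alpha^-1 * - (s + kappa) = - s'); last by rewrite /s' mulrN mulrC.
  rewrite powRM ?invr_ge0 ?(ltW C0) ?(ltW rp) // -(powR_inv1 (ltW C0)) -powRrM.
  by rewrite mulN1r opprK mulrA mulrAC.
- by move=> [j k] /=; have [_ h _] := hY j; rewrite -rhoa; exact: h.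
- move=> y [x /cov[j Vj] xy]; have [_ _ h] := hY j.
  by have [k Wk] := h x y Vj xy; exists (Tagged W k).
Qed.

Lemma sigma_box_bounded_transfer (s : R) A : sigma_box_bounded d1 s A ->
  sigma_box_bounded d2 ((s + kappa) / alpha) (rel_image rel A).
Proof.
move=> [I [F [AF Fb]]]; exists I, (fun i => rel_image rel (F i)); split.
  by move=> y [x /AF[i Fx] xy]; exists i, x.
by move=> i; exact: box_bounded_transfer.
Qed.

End Transfer.

(** * The dimension of an image, from spreading in both directions *)

(** Both [hausdorff_dim] and [packing_dim] are of this form by conversion. *)
Definition dim_inf {R : realType} (Q : R -> Prop) : \bar R :=
  ereal_inf [set s%:E | s in [set s : R | 0 <= s /\ Q s]].

Lemma dim_inf_le (R : realType) (Q1 Q2 : R -> Prop) (c : R) : 0 < c ->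
  (forall s s' : R, 0 <= s -> Q1 s -> c * s < s' -> Q2 s') ->
  (dim_inf Q2 <= c%:E * dim_inf Q1)%E.
Proof.
move=> c0 h; rewrite -lee_pdivrMl //; apply: le_ereal_inf_tmp.
move=> _ [s [s0 Qs] <-]; rewrite lee_pdivrMl // -EFinM.
apply/lee_addgt0Pr => e e0; apply: ereal_inf_lbound; exists (c * s + e) => //.
split; first by rewrite addr_ge0 ?mulr_ge0 // ltW.
by apply: h Qs _ => //; rewrite ltrDl.
Qed.

Lemma real_dist_is_dist (R : realType) : is_dist (@real_dist R).
Proof.
split => [x|x y|x y z]; rewrite /real_dist; first by rewrite subrr normr0.
  by rewrite distrC.
exact: ler_distD.
Qed.

Section Dimension_of_image.
Context {R : realType} {T : Type} (dist : T -> T -> R) (x0 : T) (f : R -> T)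
  (H : R) (rel1 : nat -> R -> T -> Prop) (rel2 : nat -> T -> R -> Prop).
Hypotheses (Hdist : is_dist dist) (H0 : 0 < H).
Hypothesis rel1P : forall t, 0 <= t -> exists k, rel1 k t (f t).
Hypothesis rel2P : forall t, 0 <= t -> exists k, rel2 k (f t) t.
Hypothesis Hspread : forall tau, 0 < tau -> exists gamma theta : R,
  [/\ 0 < gamma, H - tau < gamma < H, theta <= tau,
      forall k, spreads (@real_dist R) dist (rel1 k) gamma 0 &
      forall k, spreads dist (@real_dist R) (rel2 k) gamma^-1 (theta / gamma)].

Section Transfer_property.
(** Q stands for [cover_null] or [sigma_box_bounded], so that one argument serves both
    dimensions. *)
Variable Q : forall T' : Type, (T' -> T' -> R) -> R -> set T' -> Prop.
Hypothesis QW : forall T' (d : T' -> T' -> R) (s s' : R) A, s <= s' ->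
  Q d s A -> Q d s' A.
Hypothesis Qsub : forall T' (d : T' -> T' -> R) (s : R) (A B : set T'),
  B `<=` A -> Q d s A -> Q d s B.
Hypothesis Qbigcup : forall T' (d : T' -> T' -> R) (s : R) (A : nat -> set T'),
  (forall k, Q d s (A k)) -> Q d s (\bigcup_k A k).
Hypothesis Qtransfer : forall T1 T2 (d1 : T1 -> T1 -> R) (d2 : T2 -> T2 -> R)
  (rel : T1 -> T2 -> Prop) (alpha kappa : R), 0 < alpha ->
  spreads d1 d2 rel alpha kappa -> forall (s : R) A, Q d1 s A ->
  Q d2 ((s + kappa) / alpha) (rel_image rel A).

Lemma image_property (E : set R) (s s' : R) : E `<=` `[0, +oo[ -> 0 <= s ->
  Q (@real_dist R) s E -> H^-1 * s < s' -> Q dist s' (f @` E).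
Proof.
move=> E0 s0 QE; rewrite mulrC ltr_pdivrMr // => ss'.
have s'0 : 0 < s' by rewrite -(pmulr_lgt0 _ H0); apply: le_lt_trans ss'.
(* This tolerance forces gamma > s / s', hence s / gamma < s'. *)
have [|g [th [g0 /andP[Hg _] _ h1 _]]] := @Hspread (H - s / s').
  by rewrite subr_gt0 ltr_pdivrMr // mulrC.
apply: (@QW _ _ (s / g)).
  rewrite ler_pdivrMr //.
  move: Hg; rewrite opprB addrC subrK ltr_pdivrMr // => /ltW.
  by rewrite mulrC.
apply: (@Qsub _ _ _ (\bigcup_k rel_image (rel1 k) E)).
  move=> _ [t Et <-]; have /= := E0 t Et; rewrite in_itv /= andbT.
  by move=> /rel1P[k hk]; exists k => //; exists t.
by apply: Qbigcup => k; rewrite -[s]addr0; exact: Qtransfer.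
Qed.

Lemma preimage_property (E : set R) (s s' : R) : E `<=` `[0, +oo[ -> 0 <= s ->
  Q dist s (f @` E) -> H * s < s' -> Q (@real_dist R) s' E.
Proof.
move=> E0 s0 QE ss'.
(* The transferred exponent is gamma s + theta, and the tolerance s' - H s bounds theta, so that it
   is at most s'. *)
have [|g [th [g0 /andP[_ gH] thle _ h2]]] := @Hspread (s' - H * s).
  by rewrite subr_gt0.
apply: (@QW _ _ ((s + th / g) / g^-1)).
  rewrite invrK mulrDl divfK ?gt_eqF // -lerBrDr; apply: le_trans (_ : H * s <= _).
    by rewrite mulrC ler_wpM2r // ltW.
  by rewrite lerBrDr -lerBrDl.
apply: (@Qsub _ _ _ (\bigcup_k rel_image (rel2 k) (f @` E))).
  move=> t Et; have /= := E0 t Et; rewrite in_itv /= andbT.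
  by move=> /rel2P[k hk]; exists k => //; exists (f t) => //; exists t.
by apply: Qbigcup => k; apply: Qtransfer => //; rewrite invr_gt0.
Qed.
End Transfer_property.

Lemma dim_eq (Q1 Q2 : R -> Prop) :
  (forall s s' : R, 0 <= s -> Q1 s -> H^-1 * s < s' -> Q2 s') ->
  (forall s s' : R, 0 <= s -> Q2 s -> H * s < s' -> Q1 s') ->
  dim_inf Q2 = (H^-1%:E * dim_inf Q1)%E.
Proof.
move=> h1 h2; apply/eqP; rewrite eq_le dim_inf_le ?invr_gt0 //=.
by rewrite lee_pdivrMl // dim_inf_le.
Qed.

(** Room for losses on both sides of the transfer: Hausdorff measure pays on the way in, from s to
    s1, packing measure on the way out, from s2 to s'. *)
Lemma between (c s s' : R) : 0 < c -> 0 <= s -> c * s < s' ->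
  exists s1 s2 : R, [/\ s < s1, c * s1 < s2 & s2 < s'].
Proof.
move=> c0 s0 h; pose e := (s' - c * s) / (3 * c).
have e0 : 0 < e by rewrite divr_gt0 ?subr_gt0 // mulr_gt0.
have ce : c * e = (s' - c * s) / 3 by rewrite /e; field; exact: lt0r_neq0.
by exists (s + e), (s' - c * e); rewrite mulrDr ce; split; lra.
Qed.

Lemma hausdorff_dim_image (E : set R) : E `<=` `[0, +oo[ ->
  hausdorff_dim dist (f @` E) = (H^-1%:E * hausdorff_dim (@real_dist R) E)%E.
Proof.
move=> E0; have Hi0 : 0 < H^-1 by rewrite invr_gt0.
have Dr := real_dist_is_dist R.
apply: dim_eq => s s' s0 Q1 ss'.
  have [s1 [s2 [h1 h2 h3]]] := between Hi0 s0 ss'.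
  have s10 : 0 <= s1 by apply: ltW; exact: le_lt_trans h1.
  have s'0 : 0 <= s' by apply/ltW/(le_lt_trans _ (lt_trans h2 h3)); exact: mulr_ge0 (ltW Hi0) s10.
  apply: hausdorff_measure0_of_cover_null => //.
  apply: (@image_property (fun T' d s A => cover_null d s A) _ _ _ _ E s1) => //.
  - by move=> T' d; exact: cover_nullW.
  - by move=> T' d; exact: cover_null_subset.
  - by move=> T' d; exact: cover_null_bigcup.
  - by move=> T1 T2 d1 d2; exact: cover_null_transfer.
  - exact: cover_null_of_hausdorff_measure0 h1 Q1.
  - exact: lt_trans h3.
have [s1 [s2 [h1 h2 h3]]] := between H0 s0 ss'.
have s10 : 0 <= s1 by apply: ltW; exact: le_lt_trans h1.
have s'0 : 0 <= s' by apply/ltW/(le_lt_trans _ (lt_trans h2 h3)); exact: mulr_ge0 (ltW H0) s10.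
apply: hausdorff_measure0_of_cover_null => //.
apply: (@preimage_property (fun T' d s A => cover_null d s A) _ _ _ _ E s1) => //.
- by move=> T' d; exact: cover_nullW.
- by move=> T' d; exact: cover_null_subset.
- by move=> T' d; exact: cover_null_bigcup.
- by move=> T1 T2 d1 d2; exact: cover_null_transfer.
- exact: cover_null_of_hausdorff_measure0 h1 Q1.
- exact: lt_trans h3.
Qed.

Lemma packing_dim_image (E : set R) : E `<=` `[0, +oo[ ->
  packing_dim dist (f @` E) = (H^-1%:E * packing_dim (@real_dist R) E)%E.
Proof.
move=> E0; have Hi0 : 0 < H^-1 by rewrite invr_gt0.
have Dr := real_dist_is_dist R.
apply: dim_eq => s s' s0 Q1 ss'.
  have [s1 [s2 [h1 h2 h3]]] := between Hi0 s0 ss'.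
  have s20 : 0 <= s2.
    by apply/ltW/(le_lt_trans _ h2); rewrite mulr_ge0 ?(ltW Hi0) // ltW // (le_lt_trans s0).
  apply: (packing_measure0_of_sigma_box_bounded x0 Hdist s20 h3).
  apply: (@image_property (fun T' d s A => sigma_box_bounded d s A) _ _ _ _ E s) => //.
  - by move=> T' d; exact: sigma_box_boundedW.
  - by move=> T' d; exact: sigma_box_bounded_subset.
  - by move=> T' d; exact: sigma_box_bounded_bigcup.
  - by move=> T1 T2 d1 d2; exact: sigma_box_bounded_transfer.
  - exact: sigma_box_bounded_of_packing_measure0 Q1.
  - by apply: lt_trans h2; rewrite ltr_pM2l.
have [s1 [s2 [h1 h2 h3]]] := between H0 s0 ss'.
have s20 : 0 <= s2.
  by apply/ltW/(le_lt_trans _ h2); rewrite mulr_ge0 ?(ltW H0) // ltW // (le_lt_trans s0).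
apply: (packing_measure0_of_sigma_box_bounded 0 Dr s20 h3).
apply: (@preimage_property (fun T' d s A => sigma_box_bounded d s A) _ _ _ _ E s) => //.
- by move=> T' d; exact: sigma_box_boundedW.
- by move=> T' d; exact: sigma_box_bounded_subset.
- by move=> T' d; exact: sigma_box_bounded_bigcup.
- by move=> T1 T2 d1 d2; exact: sigma_box_bounded_transfer.
- exact: sigma_box_bounded_of_packing_measure0 Q1.
- by apply: lt_trans h2; rewrite ltr_pM2l.
Qed.
End Dimension_of_image.

(** * Euclidean distance *)

Section Euclidean.
Context {R : realType} {d : nat}.
Implicit Types x y z : 'rV[R]_d.

(** If B > 0, the sum of the squares of B a_i - C b_i equals B (A B - C^2); if B = 0, all b_i
    vanish. *)
Lemma sum_cauchy_schwarz (a b : 'I_d -> R) :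
  (\sum_i a i * b i) ^+ 2 <= (\sum_i a i ^+ 2) * (\sum_i b i ^+ 2).
Proof.
set A := \sum_i a i ^+ 2; set B := \sum_i b i ^+ 2; set C := \sum_i a i * b i.
have B0 : 0 <= B by apply: sumr_ge0 => i _; exact: sqr_ge0.
move: (B0); rewrite le_eqVlt => /predU1P[Bz|Bp].
  have bz i : b i = 0.
    apply/eqP; rewrite -sqrf_eq0 eq_le sqr_ge0 andbT Bz /B.
    by rewrite (bigD1 i) //= lerDl; apply: sumr_ge0 => j _; exact: sqr_ge0.
  by rewrite /C big1 ?expr0n -?Bz ?mulr0 // => i _; rewrite bz mulr0.
have : 0 <= \sum_i (B * a i - C * b i) ^+ 2.
  by apply: sumr_ge0 => i _; exact: sqr_ge0.
rewrite (_ : \sum_i _ = B * (A * B - C ^+ 2)).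
  by rewrite pmulr_rge0 // subr_ge0.
transitivity (\sum_i (B ^+ 2 * a i ^+ 2 - 2 * B * C * (a i * b i)
    + C ^+ 2 * b i ^+ 2)); first by apply: eq_bigr => i _; ring.
rewrite big_split /= sumrB -!mulr_sumr -/A -/B -/C; ring.
Qed.

Lemma euclid_norm_triangle x y :
  euclid_norm (x + y) <= euclid_norm x + euclid_norm y.
Proof.
rewrite /euclid_norm; set A := \sum_i x _ _ ^+ 2; set B := \sum_i y _ _ ^+ 2.
have A0 : 0 <= A by apply: sumr_ge0 => i _; exact: sqr_ge0.
have B0 : 0 <= B by apply: sumr_ge0 => i _; exact: sqr_ge0.
have sAB : 0 <= Num.sqrt A + Num.sqrt B by rewrite addr_ge0 // sqrtr_ge0.
rewrite -[leRHS]ger0_norm // -sqrtr_sqr; apply: ler_wsqrtr.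
rewrite sqrrD !sqr_sqrtr // -sqrtrM //.
under eq_bigr => i _ do rewrite mxE sqrrD.
rewrite !big_split /= -/A -/B lerD2r lerD2l mulr2n.
set C := \sum_i _; suff : C <= Num.sqrt (A * B) by move=> h; exact: lerD.
apply: le_trans (ler_norm C) _.
rewrite -sqrtr_sqr; apply: ler_wsqrtr; exact: sum_cauchy_schwarz.
Qed.

Lemma euclid_dist_is_dist : is_dist (@euclid_dist R d).
Proof.
split => [x|x y|x y z]; rewrite /euclid_dist.
- rewrite subrr /euclid_norm big1 ?sqrtr0 // => i _.
  by rewrite mxE expr0n.
- rewrite /euclid_norm; congr Num.sqrt; apply: eq_bigr => i _.
  by rewrite !mxE -sqrrN opprB.
- by rewrite -(subrKA y) ; exact: euclid_norm_triangle.
Qed.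

Lemma euclid_norm_le x (M : R) : 0 <= M -> (forall i, `|x ord0 i| <= M) ->
  euclid_norm x <= d%:R * M.
Proof.
move=> M0 hM; rewrite -[leRHS]ger0_norm ?mulr_ge0 // -sqrtr_sqr.
apply: ler_wsqrtr; apply: le_trans (_ : d%:R * M ^+ 2 <= _).
  rewrite -[d in d%:R]card_ord mulr_natl -sumr_const; apply: ler_sum => i _.
  by rewrite -real_normK ?num_real // ler_pXn2r ?nnegrE.
rewrite exprMn ler_wpM2r ?sqr_ge0 // -natrX ler_nat.
by case: (d) => // n; rewrite expnS expn1 leq_pmulr.
Qed.

Lemma open_euclid_ball x (r : R) : open (euclid_ball x r).
Proof.
have [d0 dC dT] := euclid_dist_is_dist.
rewrite openE => y /= yr; apply/nbhs_ballP.
(* Dividing by d + 1 makes d e strictly smaller than the gap, also for d = 0. *)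
pose e := (r - euclid_dist y x) / d.+1%:R.
have e0 : 0 < e by rewrite divr_gt0 // subr_gt0.
exists e => //= z yz; rewrite /euclid_ball /=.
have h1 : euclid_dist y z <= d%:R * e.
  apply: euclid_norm_le; first exact: ltW.
  by move=> i; rewrite !mxE; apply: ltW; have [_] := yz; exact.
have h2 : d%:R * e < r - euclid_dist y x.
  by rewrite /e mulrA ltr_pdivrMr // mulrC ltr_pM2l ?subr_gt0 // ltr_nat.
by have := dT z y x; rewrite (dC z y); lra.
Qed.

Lemma euclid_dense : exists c : nat -> 'rV[R]_d,
  forall x (e : R), 0 < e -> exists n, euclid_dist x (c n) < e.
Proof.
exists (fun n => if unpickle n is Some q
  then map_mx (fun a : rat => ratr a : R) (q : 'rV[rat]_d) else 0).
move=> x e e0; pose h := e / d.+1%:R.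
have h0 : 0 < h by rewrite divr_gt0.
have /choice[q hq] i : exists a : rat, `|x ord0 i - ratr a| <= h.
  have [a] : exists a : rat, ratr a \in `]x ord0 i - h, x ord0 i + h[.
    by have [a ha] := @rat_in_itvoo R (x ord0 i - h) (x ord0 i + h)
      (ltac:(lra)); exists a.
  by rewrite in_itv /= => ha; exists a; rewrite ler_distl; lra.
exists (pickle (\row_i q i)); rewrite pickleK.
apply: le_lt_trans (_ : d%:R * h < _).
  by apply: euclid_norm_le => [|i]; [exact: ltW | rewrite !mxE].
by rewrite /h mulrA ltr_pdivrMr // mulrC ltr_pM2l // ltr_nat.
Qed.

(** The index type displays the number of grid points, (2 K M + 1)^d, which the union bound over the
    grid needs. *)
Lemma euclid_grid (K M : nat) : (0 < M)%N ->
  exists g : {ffun 'I_d -> 'I_(2 * K * M).+1} -> 'rV[R]_d,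
  forall x, (forall i, `|x ord0 i| <= K%:R) ->
    exists a, euclid_dist x (g a) <= d%:R / M%:R.
Proof.
move=> M0; have M0' : 0 < M%:R :> R by rewrite ltr0n.
exists (fun a : {ffun 'I_d -> 'I_(2 * K * M).+1} =>
  \row_i ((a i)%:R / M%:R - K%:R)) => x hx.
have y0 i : 0 <= (x ord0 i + K%:R) * M%:R.
  by have := hx i; rewrite ler_norml => h; rewrite mulr_ge0 //; lra.
have tb i : (Num.truncn ((x ord0 i + K%:R) * M%:R) < (2 * K * M).+1)%N.
  rewrite ltnS -(ler_nat R); apply: le_trans (_ : _ <= (x ord0 i + K%:R) * M%:R) _.
    by rewrite truncn_le.
  rewrite natrM ler_pM2r // natrM.
  by have := hx i; rewrite ler_norml => h; lra.
exists [ffun i => Ordinal (tb i)].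
apply: euclid_norm_le; first by rewrite invr_ge0 ltW.
move=> i; rewrite !mxE ffunE /= opprB addrA.
rewrite -(ler_pM2r M0') mulVf ?gt_eqF // -[X in _ * X <= _]gtr0_norm // -normrM.
rewrite mulrBl divfK ?gt_eqF //.
have /andP[h1 h2] := truncn_itv (y0 i).
by rewrite ger0_norm ?subr_ge0 // lerBlDl -natr1 in h2 *; apply: ltW.
Qed.

Lemma right_continuous_dist (f : R -> 'rV[R]_d) (t e : R) :
  f @ t^'+ --> f t -> 0 < e ->
  exists2 h : R, 0 < h & forall s, t < s < t + h -> euclid_dist (f s) (f t) < e.
Proof.
move=> ft e0; have : nbhs (f t) (euclid_ball (f t) e).
  apply: open_nbhs_nbhs; split; first exact: open_euclid_ball.
  by rewrite /euclid_ball /=; have [-> _ _] := euclid_dist_is_dist.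
move=> /ft; rewrite nbhs_simpl /= => -[h /= h0 hb].
exists h => // s /andP[ts sh]; have [_ dC _] := euclid_dist_is_dist.
by apply: (hb s) => //=; rewrite distrC ltr_distl; lra.
Qed.

End Euclidean.

(** * Events, probabilities and counting *)

Section Sigma_algebra.
Context {T : Type} (G : set_system T).
Hypothesis HG : sigma_algebra setT G.

Lemma sigma_algebra_setC (A : set T) : G A -> G (~` A).
Proof. by have [_ h _] := HG => /h; rewrite setTD. Qed.

Lemma sigma_algebra_setT : G setT.
Proof. by have [h _ _] := HG; rewrite -setC0; exact: sigma_algebra_setC. Qed.

(** Events are written as logical formulas in w; this lemma and the next ones prove measurability by
    following the connectives. *)
Lemma sigma_algebra_exists (I : countType) (A : I -> set T) :
  (forall i, G (A i)) -> G [set w | exists i, A i w].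
Proof.
move=> hA; have [h0 _ hU] := HG.
rewrite (_ : [set w | _] =
    \bigcup_n (if pickle_inv n is Some i then A i else set0)).
  by apply: hU => n; case: pickle_inv.
apply/seteqP; split => [w [i Ai]|w [n _]].
  by exists (pickle i) => //; rewrite pickleK_inv.
by case: pickle_inv => // i Ai; exists i.
Qed.

Lemma sigma_algebra_forall (I : countType) (A : I -> set T) :
  (forall i, G (A i)) -> G [set w | forall i, A i w].
Proof.
move=> hA; rewrite (_ : [set w | _] = ~` [set w | exists i, (~` A i) w]).
  apply: sigma_algebra_setC; apply: sigma_algebra_exists => i.
  exact: sigma_algebra_setC.
apply/seteqP; split => [w h [i]|w h i]; first exact.
by apply: contrapT => n; apply: h; exists i.
Qed.

Lemma sigma_algebra_setI (A B : set T) : G A -> G B -> G (A `&` B).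
Proof.
move=> hA hB; have := @sigma_algebra_forall bool (fun b => if b then A else B).
rewrite (_ : [set w | _] = A `&` B); first by apply; case.
by apply/seteqP; split => [w h|w [Aw Bw] []//]; split; [exact: (h true) | exact: (h false)].
Qed.

Lemma sigma_algebra_prop (p : Prop) (A : set T) : (p -> G A) ->
  G [set w | p /\ A w].
Proof.
have [hp|np] := pselect p => hA.
  rewrite (_ : [set w | _] = A); first exact: hA.
  by apply/seteqP; split => [w []|w].
rewrite (_ : [set w | _] = set0); first by have [] := HG.
by apply/seteqP; split => [w []|w].
Qed.

Lemma sigma_algebra_imply (p : Prop) (A : set T) : (p -> G A) ->
  G [set w | p -> A w].
Proof.
have [hp|np] := pselect p => hA.
  rewrite (_ : [set w | _] = A); first exact: hA.
  by apply/seteqP; split => [w /(_ hp)|w Aw _].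
rewrite (_ : [set w | _] = setT); first exact: sigma_algebra_setT.
by apply/seteqP; split => // w _ /np.
Qed.

Definition hit_count (h : nat -> set T) (s : seq nat) (w : T) : nat :=
  count (fun k => `[< h k w >]) s.

(** The predicate Q is arbitrary so that the induction can shift it by one when the first event
    occurs. *)
Lemma sigma_algebra_hit_count (h : nat -> set T) (s : seq nat) (Q : nat -> Prop) :
  (forall k, k \in s -> G (h k)) -> G [set w | Q (hit_count h s w)].
Proof.
elim: s Q => [|a s IH] Q hG.
  rewrite (_ : [set w | _] = [set w | Q 0%N /\ setT w]).
    by apply: sigma_algebra_prop => _; exact: sigma_algebra_setT.
  by apply/seteqP; split => [w|w []].
have Ga : G (h a) by apply: hG; rewrite inE eqxx.
have Gs Q' : G [set w | Q' (hit_count h s w)].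
  by apply: IH => k ks; apply: hG; rewrite inE ks orbT.
have := @sigma_algebra_exists bool (fun b =>
  if b then h a `&` [set w | Q (hit_count h s w).+1]
  else ~` h a `&` [set w | Q (hit_count h s w)]).
rewrite (_ : [set w | exists i, _] = [set w | Q (hit_count h (a :: s) w)]).
  apply; case; apply: sigma_algebra_setI => //.
    exact: (Gs (fun n => Q n.+1)).
  exact: sigma_algebra_setC.
apply/seteqP; split => w; rewrite /hit_count /=.
  by case=> -[[ha hQ]|[ha hQ]]; rewrite ?(asboolT ha) ?(asboolF ha).
by case: asboolP => ha hQ; [exists true | exists false].
Qed.

End Sigma_algebra.

Lemma hit_count_cat (T : Type) (h : nat -> set T) s1 s2 w :
  hit_count h (s1 ++ s2) w = (hit_count h s1 w + hit_count h s2 w)%N.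
Proof. exact: count_cat. Qed.

Lemma hit_count_split (T : Type) (h : nat -> set T) n k w : (k < n)%N ->
  hit_count h (iota 0 n) w = (hit_count h (iota 0 k) w +
    (`[< h k w >] + hit_count h (iota k.+1 (n - k.+1)) w))%N.
Proof.
move=> kn; rewrite -{1}(subnKC (ltnW kn)) iotaD hit_count_cat add0n.
by rewrite -(subnSK kn).
Qed.

(** The witness k is the time of hit number a + 1. *)
Lemma hit_count_next (T : Type) (h : nat -> set T) n a w :
  (a < hit_count h (iota 0 n) w)%N ->
  exists k, [/\ (k < n)%N, hit_count h (iota 0 k) w = a & h k w].
Proof.
elim: n => // n IH; rewrite -[n.+1]addn1 iotaD hit_count_cat add0n.
rewrite {2}/hit_count /= addn0; case: asboolP => hn /=; last first.
  by rewrite addn0 => /IH[k [kn h1 h2]]; exists k; split => //; rewrite addn1 ltnW.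
rewrite addn1 ltnS leq_eqVlt => /predU1P[e|/IH[k [kn h1 h2]]].
  by exists n; rewrite addn1.
by exists k; split => //; rewrite addn1 ltnW.
Qed.

Section Real_probability.
Context {R : realType} {disp : measure_display} {Omega : measurableType disp}
  (mu : probability Omega R).
Implicit Types A B : set Omega.

Definition pr A : R := fine (mu A).

Lemma prE A : measurable A -> mu A = (pr A)%:E.
Proof. by move=> mA; rewrite /pr fineK // fin_num_measure. Qed.

Lemma pr_ge0 A : 0 <= pr A.
Proof. exact: fine_ge0. Qed.

Lemma pr_le A B : measurable A -> measurable B -> A `<=` B -> pr A <= pr B.
Proof.
by move=> mA mB AB; rewrite -lee_fin -!prE // le_measure ?inE.
Qed.

Lemma pr_le1 A : measurable A -> pr A <= 1.
Proof. by move=> mA; rewrite -lee_fin -prE // probability_le1. Qed.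

Lemma prU A B : measurable A -> measurable B -> A `&` B = set0 ->
  pr (A `|` B) = pr A + pr B.
Proof.
move=> mA mB AB; apply: EFin_inj; rewrite EFinD -!prE //; last exact: measurableU.
by rewrite measureU.
Qed.

Lemma pr_cover (I : eqType) (s : seq I) (A : I -> set Omega) B :
  measurable B -> (forall i, i \in s -> measurable (A i)) ->
  (forall w, B w -> exists2 i, i \in s & A i w) ->
  pr B <= \sum_(i <- s) pr (A i).
Proof.
elim: s B => [|a s IH] B mB mA h.
  rewrite big_nil (_ : B = set0) ?/pr ?measure0 //.
  by apply/seteqP; split => // w /h[].
have mAa : measurable (A a) by apply: mA; rewrite inE eqxx.
rewrite big_cons (_ : B = (B `&` A a) `|` (B `\` A a)); last by rewrite setUIDK.
rewrite prU; [| exact: measurableI | exact: measurableD |]; last first.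
  by apply/seteqP; split => // w [[_ h1] [_ h2]].
apply: lerD; first by apply: pr_le => //; exact: measurableI.
apply: IH; first exact: measurableD.
  by move=> i si; apply: mA; rewrite inE si orbT.
move=> w [/h[i]]; rewrite inE => /orP[/eqP ->//|si Ai _]; by exists i.
Qed.

Lemma pr_disjoint (I : eqType) (s : seq I) (A : I -> set Omega) B :
  uniq s -> measurable B -> (forall i, i \in s -> measurable (A i)) ->
  (forall i, i \in s -> A i `<=` B) ->
  (forall i j w, i \in s -> j \in s -> A i w -> A j w -> i = j) ->
  \sum_(i <- s) pr (A i) <= pr B.
Proof.
elim: s B => [|a s IH] B /=; first by rewrite big_nil pr_ge0.
move=> /andP[as_ us] mB mA AB dis.
have ina : a \in a :: s by rewrite inE eqxx.
have ins i : i \in s -> i \in a :: s by rewrite inE => ->; rewrite orbT.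
have mAa : measurable (A a) by exact: mA.
rewrite big_cons (_ : B = A a `|` (B `\` A a)); last first.
  by rewrite setDUK //; exact: AB.
rewrite prU //; [| exact: measurableD | by apply/seteqP; split => // w [h1 [_ h2]]].
rewrite lerD2l; apply: IH => //; first exact: measurableD.
- by move=> i /ins; exact: mA.
- move=> i si w Aw; split; first by apply: (AB i) => //; exact: ins.
  by move=> Aa; have e := dis i a w (ins _ si) ina Aw Aa; rewrite -e si in as_.
- by move=> i j w si sj; apply: dis; exact: ins.
Qed.

(** Continuity from below; it carries bounds that are uniform over finite dyadic grids to all dyadic
    times. *)
Lemma pr_limit (A : nat -> set Omega) (c : R) :
  (forall n, measurable (A n)) -> (forall n w, A n w -> A n.+1 w) ->
  (forall n, pr (A n) <= c) -> pr [set w | exists n, A n w] <= c.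
Proof.
move=> mA hA hc.
rewrite (_ : [set w | _] = \bigcup_n A n); last first.
  by apply/seteqP; split => [w [n h]|w [n _ h]]; exists n.
have mU : measurable (\bigcup_n A n) by exact: bigcup_measurable.
rewrite -lee_fin -prE //.
have : mu \o A @ \oo --> mu (\bigcup_n A n).
  apply: nondecreasing_cvg_mu => //; apply/nondecreasing_seqP => n.
  by apply/subsetPset => w; exact: hA.
move=> /cvg_lim <- //; apply: lime_le.
  apply: ereal_nondecreasing_is_cvgn; apply/nondecreasing_seqP => n /=.
  by apply: le_measure; rewrite ?inE // => w; exact: hA.
by apply: nearW => n /=; rewrite prE // lee_fin.
Qed.

Lemma pr_borel_cantelli (B : nat -> set Omega) (C b : R) n0 :
  0 <= C -> 0 <= b < 1 -> (forall n, measurable (B n)) ->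
  (forall n, (n0 <= n)%N -> pr (B n) <= C * b ^+ n) ->
  {ae mu, forall w, exists m, forall n, (m <= n)%N -> ~ B n w}.
Proof.
(* After the shift by n0 the bound holds for every term of the series. *)
move=> C0 b01 mB hB; pose B' n := B (n0 + n)%N.
have /andP[b0 b1] := b01.
exists (lim_sup_set B'); split.
- apply: bigcap_measurable; first by exists 0%N.
  by move=> n _; apply: bigcup_measurable => k _; exact: mB.
- apply: lim_sup_set_cvg0; first by move=> k; exact: mB.
  apply: le_lt_trans (ltry (C * (b ^+ 0 / (1 - b)))).
  apply: lime_le; first by apply: is_cvg_nneseries.
  apply: nearW => N.
  rewrite (eq_bigr (fun i => (pr (B' i))%:E)); last first.
    by move=> i _; rewrite /= -prE //; exact: mB.
  rewrite sumEFin lee_fin.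
  apply: le_trans (ler_sum _ (fun i _ => hB (n0 + i)%N (leq_addr _ _))) _.
  rewrite -mulr_sumr ler_wpM2l //.
  apply: le_trans (sum_geometric_le 0 N b01); rewrite /index_iota subn0.
  apply: ler_sum => i _; rewrite exprD ler_piMl ?exprn_ge0 //.
  by rewrite exprn_ile1 // ltW.
- move=> w /= /forallNP h n _.
  have /existsNP[m /not_implyP[nm /contrapT Bm]] := h (n0 + n)%N.
  exists (m - n0)%N; first by rewrite /= leq_subRL // (leq_trans (leq_addr _ _) nm).
  by rewrite /B' subnKC // (leq_trans (leq_addr _ _) nm).
Qed.

(** * Tail bounds for the number of hits *)

Section Counting.
Variables (h : nat -> set Omega).
Hypothesis mh : forall k, measurable (h k).
Local Notation cnt := (hit_count h).

Lemma measurable_hit_count s (Q : nat -> Prop) :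
  measurable [set w | Q (cnt s w)].
Proof.
apply: (@sigma_algebra_hit_count _ _ _ h s Q) => [|k _]; last exact: mh.
split; [exact: measurable0 | move=> A; exact: measurableD |].
by move=> A mA; exact: bigcup_measurable.
Qed.

(** Markov's inequality for the number of hits on A, by induction over s: on [h a] one hit fewer has
    to come from the rest of the list. *)
Lemma hit_count_markov (s : seq nat) A (L : nat) : measurable A ->
  L%:R * pr (A `&` [set w | (L <= cnt s w)%N]) <=
  \sum_(k <- s) pr (A `&` h k).
Proof.
elim: s A L => [|a s IH] A L mA.
  case: L => [|L]; first by rewrite mul0r big_nil.
  rewrite big_nil (_ : _ `&` _ = set0) ?/pr ?measure0 ?mulr0 //.
  by apply/seteqP; split => // w [].
case: L => [|L]; first by rewrite mul0r sumr_ge0 // => i _; exact: pr_ge0.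
have mAh : measurable (A `&` h a) by exact: measurableI.
have mAh' : measurable (A `\` h a) by exact: measurableD.
have mc l := measurable_hit_count s (fun n => l <= n)%N.
have split2 B : measurable B ->
    pr (A `&` B) = pr (A `&` h a `&` B) + pr ((A `\` h a) `&` B).
  move=> mB; rewrite -prU; last 3 first.
  - exact: measurableI.
  - exact: measurableI.
  - by apply/seteqP; split => // w [[[_ h1] _] [[_ h2] _]].
  by rewrite -setIUl setUIDK.
rewrite split2; last exact: (measurable_hit_count (a :: s) (fun n => L.+1 <= n)%N).
rewrite (_ : A `&` h a `&` _ = A `&` h a `&` [set w | (L <= cnt s w)%N]); last first.
  apply/seteqP; split => w [[Aw ha]]; rewrite /hit_count /= (asboolT ha);
    by [].
rewrite (_ : (A `\` h a) `&` _ = (A `\` h a) `&` [set w | (L.+1 <= cnt s w)%N]);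
    last first.
  apply/seteqP; split => w [[Aw ha]]; rewrite /hit_count /= (asboolF ha);
    by [].
have IH1 := IH _ L mAh; have IH2 := IH _ L.+1 mAh'.
have le1 : pr (A `&` h a `&` [set w | (L <= cnt s w)%N]) <= pr (A `&` h a).
  by apply: pr_le => //; exact: measurableI.
rewrite big_cons mulrDr -[X in X * _ + _]natr1 mulrDl mul1r.
have -> : \sum_(k <- s) pr (A `&` h k) = \sum_(k <- s) pr (A `&` h a `&` h k)
    + \sum_(k <- s) pr ((A `\` h a) `&` h k).
  by rewrite -big_split; apply: eq_bigr => k _; exact: split2.
by rewrite -natr1 in IH2 *; lra.
Qed.

(* Split the hits into blocks of L: given a hit, another L of them have
   probability at most Mv / L by Markov's inequality. *)
Lemma hit_count_tail (n L : nat) (v : nat -> R) (Mv : R) :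
  (0 < L)%N -> (forall l, 0 <= v l) -> \sum_(l <- iota 1 n) v l <= Mv ->
  (forall k k' a, (k < k')%N -> (k' < n)%N ->
     pr ([set w | cnt (iota 0 k) w = a] `&` h k `&` h k') <=
     v (k' - k)%N * pr ([set w | cnt (iota 0 k) w = a] `&` h k)) ->
  forall i, pr [set w | (i * L < cnt (iota 0 n) w)%N] <= (Mv / L%:R) ^+ i.
Proof.
move=> L0 v0 hMv star; have L0' : 0 < L%:R :> R by rewrite ltr0n.
have Mv0 : 0 <= Mv by apply: le_trans hMv; exact: sumr_ge0.
have mT i : measurable [set w | (i * L < cnt (iota 0 n) w)%N].
  exact: (measurable_hit_count _ (fun m => i * L < m)%N).
elim=> [|i IH]; first by rewrite expr0; exact: pr_le1.
(* [A k] says that hit number i * L + 1 happens at k. On the event to be bounded some [A k] occurs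
   and at least L hits follow it. *)
pose A k := [set w | cnt (iota 0 k) w = (i * L)%N] `&` h k.
have mA k : measurable (A k).
  by apply: measurableI => //; exact: (measurable_hit_count _ (fun m => m = i * L)%N).
pose rest k := iota k.+1 (n - k.+1).
have mR k : measurable [set w | (L <= cnt (rest k) w)%N].
  exact: (measurable_hit_count _ (fun m => L <= m)%N).
apply: le_trans (_ : \sum_(k <- iota 0 n)
    pr (A k `&` [set w | (L <= cnt (rest k) w)%N]) <= _).
  apply: pr_cover => // [k _|w /= hw]; first exact: measurableI.
  have [|k [kn ck hk]] := @hit_count_next _ h n (i * L) w.
    by apply: leq_ltn_trans hw; rewrite leq_mul2r leqnSn orbT.
  exists k; first by rewrite mem_iota.
  split => //=; move: hw; rewrite (hit_count_split h w kn) ck (asboolT hk) mulSn addnC.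
  by rewrite ltn_add2l add1n ltnS.
apply: le_trans (_ : \sum_(k <- iota 0 n) Mv / L%:R * pr (A k) <= _).
  rewrite big_seq [leRHS]big_seq; apply: ler_sum => k.
  rewrite mem_iota add0n /= => kn.
  rewrite mulrAC ler_pdivlMr // mulrC.
  apply: le_trans (hit_count_markov _ _ (mA k)) _.
  apply: le_trans (_ : \sum_(k' <- rest k) v (k' - k)%N * pr (A k) <= _).
    rewrite big_seq [leRHS]big_seq; apply: ler_sum => k'.
    rewrite mem_iota (subnKC kn) => /andP[kk' k'n]; exact: star.
  rewrite -mulr_suml ler_wpM2r ?pr_ge0 //; apply: le_trans hMv.
  rewrite -(big_map (fun k' => (k' - k)%N) xpredT v).
  apply: ler_sum_uniq_sub => //; last 2 first.
  - exact: iota_uniq.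
  - move=> l /mapP[k']; rewrite !mem_iota (subnKC kn) => /andP[kk' k'n] ->.
    by rewrite subn_gt0 kk' add1n ltnS (leq_trans (leq_subr _ _)) // ltnW.
  rewrite map_inj_in_uniq ?iota_uniq // => l l'.
  rewrite !mem_iota => /andP[/ltnW kl _] /andP[/ltnW kl' _] e.
  by rewrite -(subnK kl) e subnK.
(* One factor Mv / L is split off; the [A k] are disjoint and lie in the event of more than i * L
   hits. *)
rewrite -mulr_sumr exprS ler_wpM2l ?divr_ge0 //; apply: le_trans IH.
apply: pr_disjoint => //; first exact: iota_uniq.
  move=> k; rewrite mem_iota add0n /= => kn w [/= ck hk].
  by rewrite (hit_count_split h w kn) ck (asboolT hk) addnA addn1 ltn_addr.
have lt k l w : (k < l)%N -> A k w -> A l w -> False.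
  move=> kl [/= ck hk] [/= cl hl]; move: cl.
  rewrite (hit_count_split h w kl) ck (asboolT hk) -[RHS]addn0 => /addnI.
  by rewrite add1n.
by move=> k l w _ _ Ak Al; case: (ltngtP k l) => // [/lt|/lt] /(_ w); case.
Qed.
End Counting.

End Real_probability.

(** * Estimates for the Markov process *)

Section Markov_estimates.
Context {R : realType} {d : nat} {disp : measure_display}
  {Omega : measurableType disp} {F : R -> set_system Omega}
  {X : R -> Omega -> 'rV[R]_d} {P : 'rV[R]_d -> probability Omega R}.
Hypothesis HX : markov_process F X P.
Local Notation dist := (@euclid_dist R d).

Lemma filtration_sigma (t : R) : 0 <= t -> sigma_algebra setT (F t).
Proof. by have [h _ _] := mp_filtration HX; exact: h. Qed.

Lemma filtration_measurable (t : R) A : 0 <= t -> F t A -> measurable A.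
Proof. by move=> t0; have [_ h _] := mp_filtration HX; exact: h. Qed.

Lemma filtration_le (s t : R) A : 0 <= s -> s <= t -> F s A -> F t A.
Proof. by move=> s0 st; have [_ _ h] := mp_filtration HX; exact: h. Qed.

Lemma borel_euclid_ball (z : 'rV[R]_d) (r : R) :
  borel [set y | dist y z < r].
Proof. by apply: sub_gen_smallest; exact: open_euclid_ball. Qed.

Lemma borel_euclid_ballC (z : 'rV[R]_d) (r : R) :
  borel [set y | r <= dist y z].
Proof.
rewrite (_ : [set y | _] = ~` [set y | dist y z < r]).
  have := borel_euclid_ball z r; rewrite /borel.
  by apply: sigma_algebra_setC; exact: smallest_sigma_algebra.
by apply/seteqP; split => y /=; rewrite leNgt => /negP.
Qed.

Lemma filtration_ball (s t : R) z (r : R) : 0 <= s -> s <= t ->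
  F t [set w | dist (X s w) z < r].
Proof.
move=> s0 st; apply: (@filtration_le s) => //.
exact: (mp_adapted HX s0 (borel_euclid_ball z r)).
Qed.

(** Adaptedness speaks of one time only. The distance is below r exactly when some point of a
    countable dense set has distances below q and r - q from the two positions, for a rational q. *)
Lemma filtration_dist_lt (s s' t : R) (r : R) : 0 <= s -> s <= t ->
  0 <= s' -> s' <= t -> F t [set w | dist (X s w) (X s' w) < r].
Proof.
move=> s0 st s'0 s't; have [c hc] := @euclid_dense R d.
have [_ dC dT] := @euclid_dist_is_dist R d.
have sF := filtration_sigma (le_trans s0 st).
rewrite (_ : [set w | _] = [set w | exists p : nat * rat,
  ([set w | dist (X s w) (c p.1) < ratr p.2] `&`
   [set w | dist (X s' w) (c p.1) < r - ratr p.2]) w]).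
  apply: (sigma_algebra_exists sF) => p.
  by apply: (sigma_algebra_setI sF); exact: filtration_ball.
apply/seteqP; split => w /=; last first.
  by move=> [[n q]] /= [h1 h2]; have := dT (X s w) (c n) (X s' w);
    rewrite (dC (c n)); lra.
move=> h; have [n hn] := hc (X s w) ((r - dist (X s w) (X s' w)) / 2)
  (ltac:(by rewrite divr_gt0 // subr_gt0)).
have hi : dist (X s w) (c n) < r - dist (X s' w) (c n).
  by have := dT (X s' w) (X s w) (c n); rewrite (dC (X s' w) (X s w)); lra.
have [q] := rat_in_itvoo hi; rewrite in_itv /= => hq.
by exists (n, q) => /=; lra.
Qed.

Lemma filtration_dist_ge (s s' t : R) (r : R) : 0 <= s -> s <= t ->
  0 <= s' -> s' <= t -> F t [set w | r <= dist (X s w) (X s' w)].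
Proof.
move=> s0 st s'0 s't; rewrite (_ : [set w | _] =
  ~` [set w | dist (X s w) (X s' w) < r]).
  apply: sigma_algebra_setC; first exact: filtration_sigma (le_trans s0 st).
  exact: filtration_dist_lt.
by apply/seteqP; split => y /=; rewrite leNgt => /negP.
Qed.

Lemma transition_measurable (s t : R) B : 0 <= s -> 0 <= t -> borel B ->
  measurable_fun setT (fun w => transition X P t (X s w) B).
Proof.
move=> s0 t0 bB; have mt := mp_measurable HX t0 bB.
have mX : measurable_fun setT (X s : Omega -> borelRd R d).
  move=> _ Y mY; rewrite setTI; apply: (filtration_measurable s0).
  exact: (mp_adapted HX s0).
exact: (measurableT_comp mt mX).
Qed.

Section Law.
Variable x : 'rV[R]_d.
Local Notation prx := (pr (P x)).

Lemma markov_pr_le (s t c : R) A B : 0 <= s -> 0 <= t -> F s A -> borel B ->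
  0 <= c -> (forall w, A w -> (transition X P t (X s w) B <= c%:E)%E) ->
  prx (A `&` X (s + t) @^-1` B) <= c * prx A.
Proof.
move=> s0 t0 FA bB c0 h.
have mA := filtration_measurable s0 FA.
have mXB : measurable (X (s + t) @^-1` B).
  apply: (filtration_measurable (addr_ge0 s0 t0)).
  by apply: (mp_adapted HX _ bB); exact: addr_ge0.
rewrite -lee_fin EFinM -!prE //; last exact: measurableI.
rewrite (mp_markov HX) // -integral_cst //.
apply: ge0_le_integral => //.
by apply: measurable_funTS; exact: transition_measurable.
Qed.

Lemma markov_pr_ge (s t c : R) A B : 0 <= s -> 0 <= t -> F s A -> borel B ->
  0 <= c -> (forall w, A w -> (c%:E <= transition X P t (X s w) B)%E) ->
  c * prx A <= prx (A `&` X (s + t) @^-1` B).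
Proof.
move=> s0 t0 FA bB c0 h.
have mA := filtration_measurable s0 FA.
have mXB : measurable (X (s + t) @^-1` B).
  apply: (filtration_measurable (addr_ge0 s0 t0)).
  by apply: (mp_adapted HX _ bB); exact: addr_ge0.
rewrite -lee_fin EFinM -!prE //; last exact: measurableI.
rewrite (mp_markov HX) // -integral_cst //.
apply: ge0_le_integral => //.
by apply: measurable_funTS; exact: transition_measurable.
Qed.

(** The content of (A1) at single times; maxima over times are recovered by Ottaviani's
    inequality. *)
Definition slow_moves (delta r q : R) : Prop :=
  forall y (t : R), 0 < t -> t <= delta ->
    (transition X P t y [set z | (r <= dist z y)%R] <= q%:E)%E.

(** The Markov property needs a fixed target set, whereas here it moves with [X s]. So A is cut
    according to the first point [c i] within r / 2 of [X s]: a displacement by 2 r leads at least 3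
    r / 2 away from [c i], and that in turn is a displacement by at least r from [X s]. *)
Lemma displacement (delta r q s t : R) A : 0 < r -> 0 <= q ->
  slow_moves delta r q -> 0 <= s -> 0 <= t -> t <= delta -> F s A ->
  prx (A `&` [set w | 2 * r <= dist (X (s + t) w) (X s w)]) <= q * prx A.
Proof.
move=> r0 q0 hq s0 t0 td FA; have [d0 dC dT] := @euclid_dist_is_dist R d.
have mA := filtration_measurable s0 FA.
have st0 : 0 <= s + t by exact: addr_ge0.
have sst : s <= s + t by rewrite lerDl.
have [t00|t_neq0] := eqVneq t 0.
  rewrite (_ : _ `&` _ = set0); first by rewrite /pr measure0 mulr_ge0 ?fine_ge0.
  apply/seteqP; split => // w [_] /=; rewrite t00 addr0 d0; lra.
have t_gt0 : 0 < t by rewrite lt_def t_neq0.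
have sF := filtration_sigma s0.
have [c hc] := @euclid_dense R d.
set E := [set w | 2 * r <= _].
have mE : measurable E.
  by apply: (@filtration_measurable (s + t)) => //; exact: filtration_dist_ge.
pose D i := [set w | dist (X s w) (c i) < r / 2].
have FD i : F s (D i) by exact: filtration_ball.
pose D' i := D i `&` [set w | forall j : nat, (j < i)%N -> (~` D j) w].
have FD' i : F s (D' i).
  apply: sigma_algebra_setI => //; apply: sigma_algebra_forall => // j.
  by apply: sigma_algebra_imply => // _; exact: sigma_algebra_setC.
have FAD' i : F s (A `&` D' i) by exact: sigma_algebra_setI.
have mAD' i : measurable (A `&` D' i) by exact: filtration_measurable (FAD' i).
(* Only the first n cells are used, so that sums are finite; n then grows. *)
pose B n := A `&` E `&` [set w | exists i : nat, (i < n)%N /\ D i w].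
have mB n : measurable (B n).
  apply: measurableI; first exact: measurableI.
  apply: (filtration_measurable s0); apply: sigma_algebra_exists => // i.
  by apply: sigma_algebra_prop.
rewrite (_ : A `&` E = [set w | exists n, B n w]); last first.
  apply/seteqP; split => [w AE|w [n [AE _]]//].
  have [|i hi] := hc (X s w) (r / 2); first by rewrite divr_gt0.
  by exists i.+1; split => //; exists i.
apply: pr_limit => // [n w [AE [i [ilt Di]]]|n].
  by split => //; exists i; split => //; exact: ltnW.
apply: le_trans (_ : \sum_(i <- iota 0 n) prx (A `&` D' i `&` E) <= _).
  apply: pr_cover => // [i _|w [[Aw Ew] [i [ilt Di]]]].
    exact: measurableI.
  have ex : exists i, `[< D i w >] by exists i; apply/asboolP.
  case: (ex_minnP ex) => m /asboolP Dm hm.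
  have mi : (m <= i)%N by apply: hm; apply/asboolP.
  exists m; first by rewrite mem_iota add0n (leq_ltn_trans mi).
  split => //; split => //; split => // j jm Dj.
  by have := hm j; rewrite leqNgt jm => /(_ (introT (asboolP _) Dj)).
apply: le_trans (_ : \sum_(i <- iota 0 n) q * prx (A `&` D' i) <= _).
  apply: ler_sum => i _.
  apply: le_trans (_ : prx (A `&` D' i `&`
      X (s + t) @^-1` [set z | 3 / 2 * r <= dist z (c i)]) <= _).
    apply: pr_le; [exact: measurableI| |].
      apply: measurableI => //; apply: (filtration_measurable st0).
      exact: (mp_adapted HX st0 (borel_euclid_ballC _ _)).
    move=> w [[Aw [Dw Dw']] Ew]; split => //=.
    have := dT (X (s + t) w) (c i) (X s w); rewrite (dC (c i)).
    by move: Dw Ew; rewrite /D /E /=; lra.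
  apply: markov_pr_le => //; first exact: borel_euclid_ballC.
  move=> w [_ [Dw _]].
  apply: le_trans (hq (X s w) t t_gt0 td); rewrite /transition.
  have tt0 := ltW t_gt0.
  apply: le_measure; rewrite ?inE.
  - apply: (filtration_measurable tt0).
    exact: (mp_adapted HX tt0 (borel_euclid_ballC _ _)).
  - apply: (filtration_measurable tt0).
    exact: (mp_adapted HX tt0 (borel_euclid_ballC _ _)).
  move=> v /=; have := dT (X t v) (X s w) (c i).
  by move: Dw; rewrite /D /=; lra.
rewrite -mulr_sumr ler_wpM2l //; apply: pr_disjoint => //.
- exact: iota_uniq.
- move=> i j w _ _ [_ [Di hi]] [_ [Dj hj]].
  by case: (ltngtP i j) => // [/hj|/hi].
Qed.

(** * Successive exits from balls along a finite grid of times *)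

Section Exits.
Variables (u : nat -> R) (M : nat) (delta r q : R).
Hypotheses (u0 : 0 <= u 0%N) (umono : forall i j, (i < j)%N -> u i < u j)
  (uM : u M - u 0%N <= delta) (r0 : 0 < r) (q0 : 0 <= q) (q2 : q <= 2^-1)
  (hq : slow_moves delta r q).

Lemma times_le i j : (i <= j)%N -> u i <= u j.
Proof. by rewrite leq_eqVlt => /predU1P[->//|/umono/ltW]. Qed.

Lemma times_ge0 i : 0 <= u i.
Proof. by apply: le_trans u0 (times_le _). Qed.

Definition first_exit i k : set Omega :=
  [set w | (i < k)%N /\ 4 * r <= dist (X (u k) w) (X (u i) w)] `&`
  [set w | forall l : nat, (i < l < k)%N ->
    dist (X (u l) w) (X (u i) w) < 4 * r].

Lemma filtration_first_exit i k : (i <= k)%N -> F (u k) (first_exit i k).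
Proof.
move=> ik; have sF := filtration_sigma (times_ge0 k).
apply: sigma_algebra_setI => //.
  apply: sigma_algebra_prop => // _.
  apply: filtration_dist_ge; rewrite ?times_ge0 //; exact: times_le.
apply: sigma_algebra_forall => // l; apply: sigma_algebra_imply => // /andP[il lk].
apply: filtration_dist_lt; rewrite ?times_ge0 //; apply: times_le => //.
exact: ltnW.
Qed.

(* Ottaviani's inequality: an exit that is not undone before the end of the
   time span is a large displacement between its two ends. *)
Lemma first_exit_sum i A : (i <= M)%N -> F (u i) A ->
  \sum_(k <- iota 0 M.+1) prx (A `&` first_exit i k) <= 2 * q * prx A.
Proof.
move=> iM FA; have [d0 dC dT] := @euclid_dist_is_dist R d.
have t0 := times_ge0.
pose E := [set w | 2 * r <= dist (X (u M) w) (X (u i) w)].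
have mE : measurable E.
  apply: (@filtration_measurable (u M)) => //.
  by apply: filtration_dist_ge => //; exact: times_le.
have mA := filtration_measurable (t0 i) FA.
have FG k : F (u k) (A `&` first_exit i k).
  case: (leqP i k) => [ik|ki].
    apply: sigma_algebra_setI; first exact: filtration_sigma.
      by apply: filtration_le FA => //; exact: times_le.
    exact: filtration_first_exit.
  rewrite (_ : _ `&` _ = set0); first by have [] := filtration_sigma (t0 k).
  by apply/seteqP; split => // w [_ [[]]]; rewrite ltnNge (ltnW ki).
have mG k : measurable (A `&` first_exit i k).
  exact: filtration_measurable (FG k).
have FAE : prx (A `&` E) <= q * prx A.
  have := @displacement delta r q (u i) (u M - u i) A r0 q0 hq (t0 i).
  rewrite subrKC; apply => //; first by rewrite subr_ge0 times_le.
  by apply: le_trans uM; rewrite lerD2l lerN2 times_le.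
(* An exit reaches distance 4 r. Either the end of the span is still 2 r away from the starting
   position, which is E, or the path moves by 2 r after the exit, which takes at most the share
   q. *)
have step k : k \in iota 0 M.+1 ->
    (1 - q) * prx (A `&` first_exit i k) <=
    prx (A `&` first_exit i k `&` E).
  rewrite mem_iota /= add0n ltnS => kM.
  rewrite mulrBl mul1r lerBlDr.
  pose E' := [set w | 2 * r <= dist (X (u M) w) (X (u k) w)].
  have mE' : measurable E'.
    apply: (@filtration_measurable (u M)) => //.
    by apply: filtration_dist_ge => //; exact: times_le.
  have h : prx (A `&` first_exit i k `&` E') <= q * prx (A `&` first_exit i k).
    have := @displacement delta r q (u k) (u M - u k) _ r0 q0 hq (t0 k) _ _ (FG k).
    rewrite subrKC; apply => //; first by rewrite subr_ge0 times_le.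
    by apply: le_trans uM; rewrite lerD2l lerN2 times_le.
  apply: le_trans (lerD (lexx _) h).
  have := @pr_cover _ _ _ (P x) _ [:: true; false]
    (fun b => A `&` first_exit i k `&` (if b then E else E'))
    (A `&` first_exit i k) (mG k).
  rewrite !big_cons big_nil addr0; apply.
    by case=> _; exact: measurableI.
  move=> w Gw; have [Ew|nE] := pselect (E w); first by exists true.
  exists false; rewrite ?inE //; split => //.
  have [_ [[_ h4] _]] := Gw.
  have := dT (X (u k) w) (X (u M) w) (X (u i) w).
  rewrite (dC (X (u k) w) (X (u M) w)) /E' /=.
  by move/negP: nE; rewrite -ltNge; lra.
have : (1 - q) * \sum_(k <- iota 0 M.+1) prx (A `&` first_exit i k) <= q * prx A.
  rewrite mulr_sumr; apply: le_trans FAE.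
  apply: le_trans (_ : \sum_(k <- iota 0 M.+1) prx (A `&` first_exit i k `&` E) <= _).
    by rewrite big_seq [leRHS]big_seq; apply: ler_sum.
  apply: pr_disjoint => //; [exact: iota_uniq|exact: measurableI| | |].
  - by move=> k _; exact: measurableI.
  - by move=> k _ w [[]].
  - move=> k l w _ _ [[_ [[ik hk] hk']] _] [[_ [[il hl] hl']] _].
    case: (ltngtP k l) => // kl.
      by exfalso; have := hl' k; rewrite ik kl => /(_ isT); lra.
    by exfalso; have := hk' l; rewrite il kl => /(_ isT); lra.
set S := \sum_(k <- _) _; have S0 : 0 <= S by apply: sumr_ge0 => k _; exact: pr_ge0.
(* With q at most 1/2, the factor 1 / (1 - q) becomes 2. *)
have : 0 <= (2^-1 - q) * S by rewrite mulr_ge0 // subr_ge0.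
by rewrite !mulrBl -mulrA; lra.
Qed.

(** There are j successive exits starting at index 0, the last one at index k; each leaves the ball
    around the position reached by the previous one. *)
Fixpoint exit_chain (j k : nat) : set Omega :=
  if j is j'.+1 then
    [set w | exists i : nat, (i < k)%N /\ (exit_chain j' i `&` first_exit i k) w]
  else [set w | k = 0%N].

Lemma filtration_exit_chain j k : F (u k) (exit_chain j k).
Proof.
have sF k' := filtration_sigma (times_ge0 k').
elim: j k => [|j IH] k /=.
  rewrite (_ : [set _ | _] = [set w | k = 0%N /\ setT w]).
    by apply: sigma_algebra_prop => // _; exact: sigma_algebra_setT.
  by apply/seteqP; split => [w|w []].
apply: sigma_algebra_exists => // i; apply: sigma_algebra_prop => // ik.
apply: sigma_algebra_setI => //; last exact: filtration_first_exit (ltnW ik).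
by apply: filtration_le (IH i); rewrite ?times_ge0 // times_le // ltnW.
Qed.

Lemma exit_chain_sum j :
  \sum_(k <- iota 0 M.+1) prx (exit_chain j k) <= (2 * q) ^+ j.
Proof.
have mR j' k : measurable (exit_chain j' k).
  exact: filtration_measurable (times_ge0 k) (filtration_exit_chain j' k).
elim: j => [|j IH].
  rewrite expr0 /= big_cons big1_seq ?addr0 ?pr_le1 //.
    exact: (mR 0%N 0%N).
  move=> k; rewrite mem_iota => /andP[_ /andP[k1 _]].
  rewrite (_ : [set _ | _] = set0) ?/pr ?measure0 //.
  by apply/seteqP; split => // w /= k0; rewrite k0 in k1.
have mFE i k : measurable (exit_chain j i `&` first_exit i k).
  case: (ltnP i k) => ik.
    apply: measurableI => //.
    exact: filtration_measurable (times_ge0 k) (filtration_first_exit (ltnW ik)).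
  rewrite (_ : _ `&` _ = set0) //.
  by apply/seteqP; split => // w [_ [[]]]; rewrite ltnNge ik.
apply: le_trans (_ : \sum_(k <- iota 0 M.+1) \sum_(i <- iota 0 M.+1)
    prx (exit_chain j i `&` first_exit i k) <= _).
  rewrite big_seq [leRHS]big_seq; apply: ler_sum => k.
  rewrite mem_iota /= add0n ltnS => kM.
  apply: (@pr_cover _ _ _ (P x) _ (iota 0 M.+1)) => //; first exact: (mR j.+1 k).
  move=> w [i [ik hi]]; exists i => //.
  by rewrite mem_iota add0n ltnS (leq_trans (ltnW ik)).
rewrite exchange_big exprS.
apply: le_trans (_ : \sum_(i <- iota 0 M.+1) 2 * q * prx (exit_chain j i) <= _).
  rewrite big_seq [leRHS]big_seq; apply: ler_sum => i.
  rewrite mem_iota /= add0n ltnS => iM.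
  by apply: first_exit_sum => //; exact: filtration_exit_chain.
by rewrite -mulr_sumr ler_wpM2l // mulr_ge0.
Qed.

Definition separated_times (N : nat) : set Omega :=
  [set w | exists s : seq nat, [/\ size s = N.+1, sorted ltn s,
     all (fun i => (i <= M)%N) s &
     pairwise (fun i j => `[< 8 * r <= dist (X (u i) w) (X (u j) w) >]) s]].

(** By induction the j-th exit happens no later than the separated time with index j, counted from
    0: two positions 8 r apart cannot both be within 4 r of the last exit position. Hence N + 1
    times give N exits. *)
Lemma separated_times_exit N :
  separated_times N `<=` [set w | exists2 k, k \in iota 0 M.+1 & exit_chain N k w].
Proof.
have [d0 dC dT] := @euclid_dist_is_dist R d.
move=> w [s [sz srt /allP sM sep]].
have nlt i j : (i < j)%N -> (j <= N)%N -> (nth 0%N s i < nth 0%N s j)%N.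
  move=> ij jN; apply: (sorted_ltn_nth ltn_trans) => //.
    by rewrite inE sz ltnS ?(leq_trans (ltnW ij)).
  by rewrite inE sz ltnS.
suff : forall j, (j <= N)%N -> exists2 k, (k <= nth 0%N s j)%N & exit_chain j k w.
  move=> /(_ N (leqnn N))[k kN hk]; exists k => //.
  by rewrite mem_iota add0n ltnS (leq_trans kN) // sM // mem_nth // sz.
elim=> [|j IH] jN; first by exists 0%N.
have [k ks hk] := IH (ltnW jN).
set a := nth 0%N s j in ks *; set b := nth 0%N s j.+1.
have ab : (a < b)%N by exact: nlt.
have far : 8 * r <= dist (X (u a) w) (X (u b) w).
  have /(pairwiseP 0%N) h := sep; apply/asboolP.
  by apply: h => //; rewrite inE sz ltnS // ltnW.
have ex : exists l, [&& (k < l)%N, (l <= b)%N &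
    `[< 4 * r <= dist (X (u l) w) (X (u k) w) >]].
  have hab : 4 * r <= dist (X (u a) w) (X (u k) w) \/
      4 * r <= dist (X (u b) w) (X (u k) w).
    have := dT (X (u a) w) (X (u k) w) (X (u b) w).
    rewrite (dC (X (u k) w) (X (u b) w)) => h.
    by case: (leP (4 * r) (dist (X (u a) w) (X (u k) w))) => h1; [left|right; lra].
  case: hab => h; last first.
    by exists b; rewrite (leq_ltn_trans ks ab) leqnn; apply/asboolP.
  (* Here k < a, since [X (u a)] is at positive distance from [X (u k)]. *)
  exists a; rewrite (ltnW ab); apply/and3P; split => //; last by apply/asboolP.
  rewrite ltn_neqAle ks andbT; apply: contraTneq h => ->.
  by rewrite d0 -ltNge mulr_gt0.
case: (ex_minnP ex) => m /and3P[km mb /asboolP hm] mmin.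
exists m => //; exists k; split => //; split => //; split => // l /andP[kl lm].
rewrite ltNge; apply/negP => hl.
have := mmin l; rewrite kl (leq_trans (ltnW lm) mb) leqNgt lm /=.
by move=> /(_ (introT (asboolP _) hl)).
Qed.

Lemma filtration_separated_times N : F (u M) (separated_times N).
Proof.
have sF := filtration_sigma (times_ge0 M).
apply: sigma_algebra_exists => // s.
rewrite (_ : (fun w : Omega => _) = [set w |
  [/\ size s = N.+1, sorted ltn s & all (fun i => (i <= M)%N) s] /\
  [set w | forall p : nat * nat, (p.1 < size s)%N /\ (p.2 < size s)%N /\
    (p.1 < p.2)%N -> [set w | 8 * r <=
      dist (X (u (nth 0%N s p.1)) w) (X (u (nth 0%N s p.2)) w)] w] w]).
  apply: sigma_algebra_prop => // -[_ _ /allP sM].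
  apply: sigma_algebra_forall => // p; apply: sigma_algebra_imply => // -[p1 [p2 _]].
  by apply: filtration_dist_ge; rewrite ?times_ge0 //; apply: times_le;
    apply: sM; exact: mem_nth.
apply/seteqP; split => w /=.
  move=> [h1 h2 h3 /(pairwiseP 0%N) h]; split => // -[i j] /= [il [jl ij]].
  by apply/asboolP; exact: h.
move=> [[h1 h2 h3] h]; split => //; apply/(pairwiseP 0%N) => i j il jl ij.
by apply/asboolP; exact: (h (i, j)).
Qed.

Lemma pr_separated_times N : prx (separated_times N) <= (2 * q) ^+ N.
Proof.
apply: le_trans (exit_chain_sum N); apply: pr_cover.
- exact: filtration_measurable (times_ge0 M) (filtration_separated_times N).
- move=> k _.
  exact: filtration_measurable (times_ge0 k) (filtration_exit_chain N k).
- by move=> w /separated_times_exit.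
Qed.
End Exits.

(** * Dyadic times *)

(** Separation is symmetric and, as r > 0, forces distinct indices, so the list may be sorted and
    cut to length N + 1. *)
Lemma separated_timesP u M (r : R) N w : 0 < r ->
  (exists s : seq nat, [/\ (N < size s)%N, all (fun i => (i <= M)%N) s &
     pairwise (fun i j => `[< 8 * r <= dist (X (u i) w) (X (u j) w) >]) s]) ->
  separated_times u M r N w.
Proof.
have [d0 dC dT] := @euclid_dist_is_dist R d.
move=> r0 [s [sz sM sep]].
pose e i j := `[< 8 * r <= dist (X (u i) w) (X (u j) w) >].
have eC i j : e i j = e j i by rewrite /e dC.
have eir i : e i i = false by apply/asboolF; rewrite d0; apply/negP; rewrite -ltNge mulr_gt0.
have us : uniq s.
  apply/(uniqP 0%N) => i j il jl ij.
  have /(pairwiseP 0%N) h := sep.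
  case: (ltngtP i j) => // lij.
    by have := h i j il jl lij; rewrite -/(e _ _) ij eir.
  by have := h j i jl il lij; rewrite -/(e _ _) ij eir.
have es i j : i \in s -> j \in s -> i != j -> e i j.
  move=> /(nthP 0%N)[p pl <-] /(nthP 0%N)[p' pl' <-] ne.
  have /(pairwiseP 0%N) h := sep.
  case: (ltngtP p p') => lpp; last by rewrite lpp eqxx in ne.
    exact: h.
  by rewrite eC; exact: h.
have ss : sorted ltn (sort leq s).
  by rewrite ltn_sorted_uniq_leq sort_uniq us (sort_sorted leq_total).
exists (take N.+1 (sort leq s)); split.
- by rewrite size_takel // size_sort.
- exact: take_sorted.
- by apply/allP => i /mem_take; rewrite mem_sort => /(allP sM).
- move: ss; rewrite (sorted_pairwise ltn_trans) => /(pairwiseP 0%N) h.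
  apply/(pairwiseP 0%N) => i j; rewrite !inE size_takel ?size_sort // => il jl ij.
  rewrite !nth_take //.
  set i' := nth _ _ i; set j' := nth _ _ j; suff /asboolP : e i' j' by [].
  have is_ : (i < size s)%N by exact: leq_trans il sz.
  have js : (j < size s)%N by exact: leq_trans jl sz.
  apply: es.
  - by rewrite -(mem_sort leq) mem_nth // size_sort.
  - by rewrite -(mem_sort leq) mem_nth // size_sort.
  - by rewrite neq_ltn; apply/orP; left; apply: h => //; rewrite inE size_sort.
Qed.

Definition dyadic_time (a delta : R) (m i : nat) : R :=
  a + delta * i%:R / 2 ^+ m.

Lemma dyadic_time_lt a delta m i j : 0 < delta -> (i < j)%N ->
  dyadic_time a delta m i < dyadic_time a delta m j.
Proof.
by move=> d0 ij; rewrite ltrD2l ltr_pM2r ?invr_gt0 ?exprn_gt0 // ltr_pM2l // ltr_nat.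
Qed.

Lemma dyadic_time0 a delta m : dyadic_time a delta m 0 = a.
Proof. by rewrite /dyadic_time mulr0 mul0r addr0. Qed.

Lemma dyadic_time_end a delta m : dyadic_time a delta m (2 ^ m) = a + delta.
Proof. by rewrite /dyadic_time natrX mulfK // expf_neq0. Qed.

Lemma dyadic_time_refine a delta m p i :
  dyadic_time a delta (m + p) (i * 2 ^ p) = dyadic_time a delta m i.
Proof.
rewrite /dyadic_time natrM natrX exprD; congr (a + _).
have h2 k : (2 : R) ^+ k != 0 by rewrite expf_neq0.
by field; rewrite !h2.
Qed.

Lemma dyadic_time_ge a delta m i : 0 < delta -> a <= dyadic_time a delta m i.
Proof.
by move=> d0; rewrite lerDl divr_ge0 ?exprn_ge0 // mulr_ge0 // ltW.
Qed.

Lemma dyadic_time_le_end a delta m i : 0 < delta -> (i <= 2 ^ m)%N ->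
  dyadic_time a delta m i <= a + delta.
Proof.
move=> d0; rewrite -(dyadic_time_end _ _ m) leq_eqVlt => /predU1P[->//|im].
exact/ltW/dyadic_time_lt.
Qed.

Lemma dyadic_time_dense (a delta t h : R) : 0 < delta -> a <= t < a + delta ->
  0 < h -> exists m i, (i < 2 ^ m)%N /\ t < dyadic_time a delta m i < t + h.
Proof.
move=> d0 /andP[at_ ta] h0; pose h' := Num.min h (a + delta - t).
(* The second bound in h' keeps the dyadic time strictly before a + delta, hence i < 2^m. *)
have h'0 : 0 < h' by rewrite lt_min h0 subr_gt0.
have [m hm] : exists m, 2^-1 ^+ m <= h' / 2 / delta.
  apply: expr_small; last by rewrite !divr_gt0.
  by rewrite invr_ge0 ler0n invf_lt1 ?ltr1n.
have p2 : 0 < 2 ^+ m :> R by rewrite exprn_gt0.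
have hm' : delta / 2 ^+ m < h'.
  by move: hm; rewrite exprVn ler_pdivlMr // mulrC; lra.
pose y := (t - a) * 2 ^+ m / delta.
have y0 : 0 <= y by rewrite divr_ge0 ?(ltW d0) // mulr_ge0 ?(ltW p2) // subr_ge0.
have /andP[t1 t2] := truncn_itv y0.
have ty : t = a + delta * y / 2 ^+ m.
  by rewrite /y; field; rewrite !gt_eqF.
have lt1 : t < dyadic_time a delta m (Num.truncn y).+1.
  by rewrite ty ltrD2l ltr_pM2r ?invr_gt0 // ltr_pM2l.
have lt2 : dyadic_time a delta m (Num.truncn y).+1 < t + h'.
  apply: le_lt_trans (_ : t + delta / 2 ^+ m < _); last by rewrite ltrD2l.
  rewrite [in leRHS]ty /dyadic_time -addrA lerD2l -mulrDl ler_pM2r ?invr_gt0 //.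
  by rewrite -natr1 mulrDr mulr1 lerD2r ler_pM2l.
exists m, (Num.truncn y).+1; split.
  rewrite ltnNge; apply/negP => hn.
  have : a + delta <= dyadic_time a delta m (Num.truncn y).+1.
    rewrite -(dyadic_time_end _ _ m); move: hn; rewrite leq_eqVlt.
    by move=> /predU1P[->//|hn]; exact/ltW/dyadic_time_lt.
  have : h' <= a + delta - t by rewrite ge_min lexx orbT.
  by lra.
rewrite lt1 /=; have : h' <= h by rewrite ge_min lexx.
lra.
Qed.

Definition dyadic_separated (a delta r : R) (N : nat) : set Omega :=
  [set w | exists m, separated_times (dyadic_time a delta m) (2 ^ m) r N w].

Section Dyadic_separated.
Variables (a delta r q : R) (N : nat).
Hypotheses (a0 : 0 <= a) (d0 : 0 < delta) (r0 : 0 < r).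

Let u0 m : 0 <= dyadic_time a delta m 0.
Proof. by rewrite dyadic_time0. Qed.

Lemma measurable_separated_level m :
  measurable (separated_times (dyadic_time a delta m) (2 ^ m) r N).
Proof.
apply: (@filtration_measurable (dyadic_time a delta m (2 ^ m))).
  by rewrite dyadic_time_end addr_ge0 // ltW.
by apply: filtration_separated_times => // i j; exact: dyadic_time_lt.
Qed.

Lemma measurable_dyadic_separated : measurable (dyadic_separated a delta r N).
Proof.
rewrite (_ : dyadic_separated _ _ _ _ =
  \bigcup_m separated_times (dyadic_time a delta m) (2 ^ m) r N).
  by apply: bigcup_measurable => m _; exact: measurable_separated_level.
by apply/seteqP; split => [w [m h]|w [m _ h]]; exists m.
Qed.

Lemma pr_dyadic_separated : 0 <= q -> q <= 2^-1 -> slow_moves delta r q ->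
  prx (dyadic_separated a delta r N) <= (2 * q) ^+ N.
Proof.
move=> q0 q2 hq; apply: pr_limit => [m|m w|m].
- exact: measurable_separated_level.
- move=> [s [sz _ sM sep]]; apply: separated_timesP => //.
  exists (map (fun i => (i * 2 ^ 1)%N) s); split.
  + by rewrite size_map sz.
  + rewrite all_map; apply: sub_all sM => i /= iM.
    by rewrite -[m.+1]addn1 expnD leq_mul2r iM orbT.
  + rewrite pairwise_map; apply: sub_pairwise sep => i j /=.
    by rewrite -[m.+1]addn1 !dyadic_time_refine.
- apply: (@pr_separated_times _ _ delta) => //.
    by move=> i j; exact: dyadic_time_lt.
  by rewrite dyadic_time_end dyadic_time0 addrAC subrr add0r.
Qed.

(** A maximal family of positions at dyadic times with mutual distances at least 8 r has at most N
    members. Every position at a dyadic time is within 8 r of one of them, and right continuity adds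
    r for the other times. *)
Lemma cover_of_not_separated w : (forall t, 0 <= t -> X^~ w @ t^'+ --> X t w) ->
  ~ dyadic_separated a delta r N w ->
  exists c : 'I_N -> 'rV[R]_d, forall t, a <= t < a + delta ->
    exists j, dist (X t w) (c j) <= 9 * r.
Proof.
have [dd0 dC dT] := @euclid_dist_is_dist R d.
move=> rc nsep.
pose A := [set y | exists m i, (i <= 2 ^ m)%N /\ y = X (dyadic_time a delta m i) w].
(* Finitely many dyadic times have a common level. *)
have common l : all (fun y => `[< A y >]) l -> exists m s,
    all (fun i => (i <= 2 ^ m)%N) s /\
    l = map (fun i => X (dyadic_time a delta m i) w) s.
  elim: l => [|y l IH] /=; first by exists 0%N, [::].
  move=> /andP[/asboolP[m1 [i1 [i1m ->]]] /IH[m2 [s [sm ->]]]].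
  exists (m1 + m2)%N, ((i1 * 2 ^ m2)%N :: map (fun i => (i * 2 ^ m1)%N) s).
  split => /=.
    rewrite expnD leq_mul2r i1m orbT /= all_map.
    by apply: sub_all sm => i /= im; rewrite mulnC leq_mul2l im orbT.
  rewrite dyadic_time_refine -map_comp; congr (_ :: _); apply: eq_map => i /=.
  by rewrite addnC dyadic_time_refine.
have [|l [lA lf lmax]] := @max_far _ A (fun y z => 8 * r <= dist y z) N.
  move=> l /common[m [s [sm ->]]]; rewrite size_map pairwise_map => sf.
  rewrite leqNgt; apply/negP => sN; apply: nsep; exists m.
  by apply: separated_timesP => //; exists s.
have lN : (size l <= N)%N.
  have [m [s [sm ls]]] := common _ lA.
  rewrite ls size_map leqNgt; apply/negP => sN; apply: nsep; exists m.
  by apply: separated_timesP => //; exists s; split => //; rewrite ls pairwise_map in lf.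
(* If the family has fewer than N points, the remaining centres are 0. *)
exists (fun j => nth 0 l j) => t tad.
have [h h0 hh] := right_continuous_dist (rc t (le_trans a0 (proj1 (andP tad)))) r0.
have [m [i [im thi]]] := dyadic_time_dense d0 tad h0.
have [|j] := lmax (X (dyadic_time a delta m i) w).
  by exists m, i; split => //; exact: ltnW.
move=> /negP; rewrite -ltNge => hj.
exists (widen_ord lN j) => /=.
have -> : nth 0 l j = nth (X (dyadic_time a delta m i) w) l j.
  by apply: set_nth_default.
have := dT (X t w) (X (dyadic_time a delta m i) w)
  (nth (X (dyadic_time a delta m i) w) l j).
by have := hh _ thi; rewrite (dC (X t w) (X (dyadic_time a delta m i) w)); lra.
Qed.
End Dyadic_separated.

(** * Hits of a ball during intervals of length delta *)

Section Hits.
Variables (delta r q : R) (z : 'rV[R]_d).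
Hypotheses (d0 : 0 < delta) (q2 : q <= 2^-1) (hq : slow_moves delta r q).

Let tm (m k i : nat) : R := dyadic_time (k%:R * delta) delta m i.

Let tm_ge0 m k i : 0 <= tm m k i.
Proof.
apply: le_trans (dyadic_time_ge _ _ _ d0); rewrite mulr_ge0 //; exact: ltW.
Qed.

Let tm_le m k i : (i <= 2 ^ m)%N -> tm m k i <= k.+1%:R * delta.
Proof.
by move=> im; apply: le_trans (dyadic_time_le_end _ d0 im) _; rewrite -natr1 mulrDl mul1r.
Qed.

Let tm_lt m k i j : (i < j)%N -> tm m k i < tm m k j.
Proof. exact: dyadic_time_lt. Qed.

(** The radius is 2 r because z will be a grid point within r of the centre of a ball of radius
    r. *)
Definition hit_level (m k : nat) : set Omega :=
  [set w | exists i, (i < 2 ^ m)%N /\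
    dist (X (dyadic_time (k%:R * delta) delta m i) w) z < 2 * r].

Definition hit (k : nat) : set Omega := [set w | exists m, hit_level m k w].

Lemma filtration_hit_level m k t : k.+1%:R * delta <= t ->
  F t (hit_level m k).
Proof.
move=> kt; have t0 : 0 <= t by apply: le_trans kt; rewrite mulr_ge0 // ltW.
apply: sigma_algebra_exists; first exact: filtration_sigma.
move=> i; apply: sigma_algebra_prop; first exact: filtration_sigma.
move=> im; apply: filtration_ball; first exact: tm_ge0.
by apply: le_trans kt; exact: tm_le (ltnW im).
Qed.

Let first_hit m k i : set Omega :=
  [set w | (i < 2 ^ m)%N /\ dist (X (tm m k i) w) z < 2 * r] `&`
  [set w | forall j : nat, (j < i)%N -> (~` [set w | dist (X (tm m k j) w) z < 2 * r]) w].

Let filtration_first_hit m k i : F (tm m k i) (first_hit m k i).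
Proof.
have sF := filtration_sigma (tm_ge0 m k i).
apply: sigma_algebra_setI => //.
  by apply: sigma_algebra_prop => // _; exact: filtration_ball.
apply: sigma_algebra_forall => // j; apply: sigma_algebra_imply => // ji.
apply: sigma_algebra_setC => //; apply: filtration_ball => //.
exact/ltW/tm_lt.
Qed.

Let hit_first m k w : hit_level m k w ->
  exists2 i, i \in iota 0 (2 ^ m) & first_hit m k i w.
Proof.
move=> [i [im hi]].
have ex : exists i, `[< dist (X (tm m k i) w) z < 2 * r >].
  by exists i; apply/asboolP.
case: (ex_minnP ex) => j /asboolP hj jmin.
have ji : (j <= i)%N by apply: jmin; apply/asboolP.
have jm := leq_ltn_trans ji im.
exists j; first by rewrite mem_iota.
split; first by split.
move=> l lj hl; have := jmin l (introT (asboolP _) hl).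
by rewrite leqNgt lj.
Qed.

Let first_hit_inj m k i j w : first_hit m k i w -> first_hit m k j w -> i = j.
Proof.
move=> [[_ hi] hi'] [[_ hj] hj'].
by case: (ltngtP i j) => // [/hj'|/hi'].
Qed.

(** Leaving the ball of radius 3 r from within 2 r of z takes a move by r, of probability at most q
    <= 1/2. *)
Lemma stay_near y t : 0 < t -> t <= delta -> dist y z < 2 * r ->
  (2^-1%:E <= transition X P t y [set z' | (dist z' z < 3 * r)%R])%E.
Proof.
move=> t0 td yz; have [_ _ dT] := @euclid_dist_is_dist R d.
have t0' := ltW t0.
have m1 B : borel B -> measurable (X t @^-1` B).
  by move=> bB; apply: (filtration_measurable t0'); exact: (mp_adapted HX t0').
have mB := m1 _ (borel_euclid_ball z (3 * r)).
have mC := m1 _ (borel_euclid_ballC y r).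
rewrite /transition prE // lee_fin.
have hC : pr (P y) (X t @^-1` [set z' | r <= dist z' y]) <= q.
  by rewrite -lee_fin -prE //; exact: hq.
have h1 : pr (P y) setT = 1 by rewrite /pr probability_setT.
have := @pr_cover _ _ _ (P y) _ [:: true; false]
  (fun b => if b then X t @^-1` [set z' | dist z' z < 3 * r] else
    X t @^-1` [set z' | r <= dist z' y]) setT measurableT.
rewrite !big_cons big_nil addr0 h1 => H.
have : 1 <= pr (P y) (X t @^-1` [set z' | dist z' z < 3 * r]) +
    pr (P y) (X t @^-1` [set z' | r <= dist z' y]).
  apply: H; first by case.
  move=> w _; case: (ltP (dist (X t w) y) r) => h; [exists true|exists false] => //.
  by rewrite /=; have := dT (X t w) y z; lra.
rewrite -lerBlDr; apply: le_trans; rewrite lerBrDr -lerBrDl.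
by apply: le_trans hC (le_trans q2 _); lra.
Qed.

(** By the Markov property at the first hit on the grid, the path is within 3 r of z at the end of
    the interval with probability at least 1/2. This replaces an event about a whole interval by one
    about a single time. *)
Lemma hit_end m k s A : 0 <= s -> s <= k%:R * delta -> F s A ->
  prx (A `&` hit_level m k) <=
  2 * prx (A `&` X (k.+1%:R * delta) @^-1` [set y | dist y z < 3 * r]).
Proof.
move=> s0 sk FA.
have e0 : 0 <= k.+1%:R * delta by rewrite mulr_ge0 // ltW.
have mA := filtration_measurable s0 FA.
have mh : measurable (hit_level m k).
  by apply: (filtration_measurable e0); exact: filtration_hit_level.
have mE : measurable (X (k.+1%:R * delta) @^-1` [set y | dist y z < 3 * r]).
  by apply: (filtration_measurable e0); exact: (mp_adapted HX e0 (borel_euclid_ball _ _)).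
have st i : s <= tm m k i.
  by apply: le_trans sk _; exact: dyadic_time_ge.
have FAh i : F (tm m k i) (A `&` first_hit m k i).
  apply: sigma_algebra_setI; first exact: filtration_sigma.
    by apply: filtration_le FA.
  exact: filtration_first_hit.
have mAh i : measurable (A `&` first_hit m k i).
  exact: filtration_measurable (FAh i).
apply: le_trans (_ : \sum_(i <- iota 0 (2 ^ m)) prx (A `&` first_hit m k i) <= _).
  apply: pr_cover => //; first exact: measurableI.
  by move=> w [Aw /hit_first[i im hi]]; exists i.
apply: le_trans (_ : \sum_(i <- iota 0 (2 ^ m)) 2 * prx (A `&` first_hit m k i `&`
    X (k.+1%:R * delta) @^-1` [set y | dist y z < 3 * r]) <= _).
  rewrite big_seq [leRHS]big_seq; apply: ler_sum => i.
  rewrite mem_iota add0n /= => im.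
  have tlt : tm m k i < k.+1%:R * delta.
    by apply: lt_le_trans (tm_lt _ _ im) _; exact: tm_le.
  have := @markov_pr_ge (tm m k i) (k.+1%:R * delta - tm m k i) 2^-1
    _ _ (tm_ge0 m k i) _ (FAh i) (borel_euclid_ball z (3 * r)) _ _.
  rewrite subrKC subr_ge0 (ltW tlt) => H.
  suff : 2^-1 * prx (A `&` first_hit m k i) <= prx (A `&` first_hit m k i `&`
    X (k.+1%:R * delta) @^-1` [set y | dist y z < 3 * r]) by lra.
  apply: H => // w [_ [[_ hw] _]].
  apply: stay_near => //; first by rewrite subr_gt0.
  have h : k%:R * delta <= tm m k i by exact: dyadic_time_ge.
  by rewrite -natr1 mulrDl mul1r lerBlDr addrC lerD2l.
rewrite -mulr_sumr ler_wpM2l //; apply: pr_disjoint => //.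
- exact: iota_uniq.
- exact: measurableI.
- by move=> i _; exact: measurableI.
- by move=> i _ w [[]].
- by move=> i j w _ _ [[_ hi] _] [[_ hj] _]; exact: first_hit_inj hi hj.
Qed.

(** The past is stopped at the first hit in interval k, and [hit_end] is applied to interval k'.
    From a position within 2 r of z to one within 3 r the path stays within 5 r of its start, and
    the elapsed time is between k' - k and k' - k + 1 steps. *)
Lemma hit_again m k k' A (v : R) : F (k%:R * delta) A -> (k < k')%N -> 0 <= v ->
  (forall y t, (k' - k)%:R * delta <= t -> t <= (k' - k).+1%:R * delta ->
    (transition X P t y [set z' | (dist z' y < 5 * r)%R] <= v%:E)%E) ->
  prx (A `&` hit_level m k `&` hit_level m k') <=
  2 * v * prx (A `&` hit_level m k).
Proof.
move=> FA kk' v0 hv; have [_ dC dT] := @euclid_dist_is_dist R d.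
have k0 : 0 <= k%:R * delta by rewrite mulr_ge0 // ltW.
have e0 : 0 <= k.+1%:R * delta by rewrite mulr_ge0 // ltW.
have e0' : 0 <= k'.+1%:R * delta by rewrite mulr_ge0 // ltW.
have mA := filtration_measurable k0 FA.
have mh : measurable (hit_level m k).
  by apply: (filtration_measurable e0); exact: filtration_hit_level.
have mh' : measurable (hit_level m k').
  by apply: (filtration_measurable e0'); exact: filtration_hit_level.
have FAh i : F (tm m k i) (A `&` first_hit m k i).
  apply: sigma_algebra_setI; first exact: filtration_sigma.
    by apply: filtration_le FA => //; exact: dyadic_time_ge.
  exact: filtration_first_hit.
have mAh i : measurable (A `&` first_hit m k i).
  exact: filtration_measurable (FAh i).
apply: le_trans (_ : \sum_(i <- iota 0 (2 ^ m))
    prx (A `&` first_hit m k i `&` hit_level m k') <= _).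
  apply: pr_cover => //.
  - by apply: measurableI => //; exact: measurableI.
  - by move=> i _; exact: measurableI.
  - by move=> w [[Aw /hit_first[i im hi]] h']; exists i.
apply: le_trans (_ : \sum_(i <- iota 0 (2 ^ m)) 2 * v * prx (A `&` first_hit m k i) <= _).
  rewrite big_seq [leRHS]big_seq; apply: ler_sum => i.
  rewrite mem_iota add0n /= => im.
  have tk : tm m k i <= k.+1%:R * delta by apply: tm_le; exact: ltnW.
  have kk1 : k.+1%:R * delta <= k'%:R * delta.
    by rewrite ler_pM2r // ler_nat.
  apply: le_trans (hit_end m (tm_ge0 m k i) (le_trans tk kk1) (FAh i)) _.
  rewrite -mulrA ler_wpM2l //.
  have tlt : tm m k i <= k'.+1%:R * delta.
    by apply: le_trans (le_trans tk kk1) _; rewrite ler_pM2r // ler_nat.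
  have := @markov_pr_le (tm m k i) (k'.+1%:R * delta - tm m k i) v
    _ _ (tm_ge0 m k i) _ (FAh i) (borel_euclid_ball z (3 * r)) v0 _.
  rewrite subrKC subr_ge0 tlt => H.
  apply: H => // w [_ [[_ hw] _]].
  set t := _ - _.
  have kt : k%:R * delta <= tm m k i by exact: dyadic_time_ge.
  have t0 : 0 <= t by rewrite subr_ge0.
  have nk : (k' - k)%:R = k'%:R - k%:R :> R by rewrite natrB // ltnW.
  have := hv (X (tm m k i) w) t; rewrite -natr1 nk => hvt.
  apply: le_trans (hvt _ _).
  - rewrite /transition; apply: le_measure; rewrite ?inE.
    + by apply: (filtration_measurable t0); exact: (mp_adapted HX t0 (borel_euclid_ball _ _)).
    + by apply: (filtration_measurable t0); exact: (mp_adapted HX t0 (borel_euclid_ball _ _)).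
    + move=> w' /= h3; have := dT (X t w') z (X (tm m k i) w).
      by rewrite (dC z); lra.
  - by rewrite /t -natr1; move: tk; rewrite -natr1 !mulrDl mul1r mulNr; lra.
  - by rewrite /t -natr1 !mulrDl mul1r mulNr; lra.
rewrite -mulr_sumr ler_wpM2l ?mulr_ge0 //; apply: pr_disjoint => //.
- exact: iota_uniq.
- exact: measurableI.
- move=> i; rewrite mem_iota add0n => im w [Aw [[_ hi] _]]; split => //.
  by exists i.
- by move=> i j w _ _ [_ hi] [_ hj]; exact: first_hit_inj hi hj.
Qed.

Lemma hit_level_refine m k w : hit_level m k w -> hit_level m.+1 k w.
Proof.
move=> [i [im hi]]; exists (i * 2 ^ 1)%N; rewrite -[m.+1]addn1.
by rewrite dyadic_time_refine expnD ltn_pmul2r.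
Qed.

Lemma measurable_hit k : measurable (hit k).
Proof.
rewrite (_ : hit k = \bigcup_m hit_level m k).
  apply: bigcup_measurable => m _.
  apply: (@filtration_measurable (k.+1%:R * delta)); first by rewrite mulr_ge0 // ltW.
  exact: filtration_hit_level.
by apply/seteqP; split => [w [m h]|w [m _ h]]; exists m.
Qed.

Lemma hit_count_mono (h h' : nat -> set Omega) s w :
  (forall k, k \in s -> h k w -> h' k w) ->
  (hit_count h s w <= hit_count h' s w)%N.
Proof.
elim: s => // a s IH hh; rewrite /hit_count /= leq_add //; last first.
  by apply: IH => k ks; apply: hh; rewrite inE ks orbT.
case: asboolP => //= ha; rewrite asboolT //.
by apply: hh => //; rewrite inE eqxx.
Qed.

Lemma hit_count_level n w : exists m,
  (hit_count hit (iota 0 n) w <= hit_count (hit_level m) (iota 0 n) w)%N.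
Proof.
have mono m p k : hit_level m k w -> hit_level (m + p) k w.
  elim: p => [|p IH]; first by rewrite addn0.
  by move=> /IH /hit_level_refine; rewrite addnS.
suff [m hm] : exists m, forall k, (k < n)%N -> hit k w -> hit_level m k w.
  by exists m; apply: hit_count_mono => k; rewrite mem_iota; exact: hm.
elim: n => [|n [m IH]]; first by exists 0%N.
have [[p hp]|nh] := pselect (hit n w).
  exists (m + p)%N => k; rewrite ltnS leq_eqVlt => /predU1P[-> _|kn /(IH k kn)].
    by rewrite addnC; exact: mono.
  exact: mono.
exists m => k; rewrite ltnS leq_eqVlt => /predU1P[-> //|kn]; exact: IH.
Qed.

(** On a fixed level the hits before interval k are known at its start, so [hit_again] supplies the
    hypothesis of [hit_count_tail]; the bound is uniform in the level, and levels increase to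
    [hit]. *)
Lemma pr_many_hits (n L : nat) (v : nat -> R) (Mv : R) : (0 < L)%N ->
  (forall l, 0 <= v l) -> \sum_(l <- iota 1 n) 2 * v l <= Mv ->
  (forall l y t, (0 < l)%N -> (l < n)%N -> l%:R * delta <= t ->
    t <= l.+1%:R * delta ->
    (transition X P t y [set z' | (dist z' y < 5 * r)%R] <= (v l)%:E)%E) ->
  forall i, prx [set w | (i * L < hit_count hit (iota 0 n) w)%N] <=
    (Mv / L%:R) ^+ i.
Proof.
move=> L0 v0 hMv hv i.
have mh m k : measurable (hit_level m k).
  apply: (@filtration_measurable (k.+1%:R * delta)); first by rewrite mulr_ge0 // ltW.
  exact: filtration_hit_level.
have -> : [set w | (i * L < hit_count hit (iota 0 n) w)%N] = [set w | exists m,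
    [set w | (i * L < hit_count (hit_level m) (iota 0 n) w)%N] w].
  apply/seteqP; split => [w /= hw|w [m /= hw]].
    by have [m hm] := hit_count_level n w; exists m; exact: leq_trans hw hm.
  apply: leq_trans hw _; apply: hit_count_mono => k _ hk; by exists m.
apply: pr_limit => [m|m w /= hw|m].
- exact: (measurable_hit_count (mh m) _ (fun c => i * L < c)%N).
- apply: leq_trans hw _; apply: hit_count_mono => k _; exact: hit_level_refine.
- apply: (@hit_count_tail _ _ _ _ (hit_level m) (mh m) n L (fun l => 2 * v l)) => //.
    by move=> l; rewrite mulr_ge0.
  move=> k k' a kk' k'n; apply: hit_again => //; last first.
    move=> y t; apply: hv; first by rewrite subn_gt0.
    exact: leq_ltn_trans (leq_subr _ _) k'n.
  have k0 : 0 <= k%:R * delta by rewrite mulr_ge0 // ltW.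
  apply: (@sigma_algebra_hit_count _ _ (filtration_sigma k0) _ _ (fun c => c = a)).
  move=> l; rewrite mem_iota add0n => /andP[_ lk].
  by apply: filtration_hit_level; rewrite ler_pM2r // ler_nat.
Qed.
End Hits.

(** * Almost sure bounds at all small scales *)

(** Each block of indices from 2^m + 1 to 2^(m+1) contributes at most 1. *)
Lemma harmonic_sum_le (m : nat) :
  \sum_(l <- iota 1 (2 ^ m)) l%:R^-1 <= m.+1%:R :> R.
Proof.
elim: m => [|m IH]; first by rewrite big_seq1 invr1.
rewrite expnS mul2n -addnn iotaD big_cat /= -[in leRHS]natr1 lerD //.
apply: le_trans (_ : \sum_(l <- iota (1 + 2 ^ m) (2 ^ m)) (2 ^ m)%:R^-1 <= _).
  rewrite big_seq [leRHS]big_seq; apply: ler_sum => l.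
  rewrite mem_iota add1n => /andP[ml _].
  have p2 : 0 < (2 ^ m)%:R :> R by rewrite ltr0n expn_gt0.
  rewrite lef_pV2 ?posrE //; first by rewrite ler_nat ltnW.
  by rewrite ltr0n (leq_ltn_trans _ ml).
rewrite big_const_seq count_predT size_iota iter_addr_0 -[leLHS]mulr_natr.
by rewrite mulVf // pnatr_eq0 expn_eq0.
Qed.

(* Here [t^-((H + zeta) e)] is split as [t^-1 * t^(H eps) * t^-b] with b >= 0. *)
Lemma kernel_bound (H gamma zeta eps tau T D delta t l : R) :
  0 < delta -> delta <= 1 -> delta <= t -> t <= T -> 0 < l -> delta * l <= t ->
  0 <= eps -> eps < D -> 0 <= zeta -> 0 < H -> gamma <= H -> 1 <= H * D ->
  (H - gamma) * D <= tau / 6 -> zeta * D <= tau / 6 -> H * eps <= tau / 6 ->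
  (5 * delta `^ gamma / t `^ (H + zeta)) `^ (D - eps) <=
  5 `^ (D - eps) * T `^ (H * eps) * delta `^ (- (tau / 2)) / l.
Proof.
move=> d0 d1 dt tT l0 dl e0 eD z0 H0 gH HD c1 c2 c3.
have t0 : 0 < t by exact: lt_le_trans dt.
have T0 : 0 < T by exact: lt_le_trans tT.
set e := D - eps; have ep : 0 < e by rewrite subr_gt0.
pose b := H * D - 1 + zeta * e.
have b0 : 0 <= b by rewrite addr_ge0 ?mulr_ge0 ?subr_ge0 // ltW.
have -> : (5 * delta `^ gamma / t `^ (H + zeta)) `^ e =
    5 `^ e * (delta `^ (gamma * e) * (t `^ (H * eps) * t `^ (- b) * t^-1)).
  rewrite -powRN -mulrA powRM ?mulr_ge0 ?powR_ge0 // powRM ?powR_ge0 //.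
  rewrite -!powRrM -(powR_inv1 (ltW t0)) -!powRDp //; congr (_ * (_ * _ `^ _)).
  by rewrite /b /e; ring.
rewrite -!mulrA ler_wpM2l ?powR_ge0 //.
(* The three factors are bounded through t <= T, t >= delta and t >= delta l respectively. *)
apply: le_trans (_ : delta `^ (gamma * e) *
    (T `^ (H * eps) * (delta `^ (- b) * (delta^-1 * l^-1))) <= _).
  apply: ler_wpM2l; first exact: powR_ge0.
  apply: ler_pM; rewrite ?powR_ge0 ?mulr_ge0 ?powR_ge0 ?invr_ge0 ?(ltW t0) //.
    by apply: ge0_ler_powR; rewrite ?nnegrE ?mulr_ge0 // ltW.
  apply: ler_pM; rewrite ?powR_ge0 ?invr_ge0 ?(ltW t0) //.
    rewrite !powRN lef_pV2 ?posrE ?powR_gt0 //.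
    by apply: ge0_ler_powR; rewrite ?nnegrE // ltW.
  by rewrite -invfM lef_pV2 ?posrE ?mulr_gt0.
rewrite mulrCA ler_wpM2l ?powR_ge0 // !mulrA ler_wpM2r ?invr_ge0 ?(ltW l0) //.
rewrite -(powR_inv1 (ltW d0)) -!powRDp //.
apply: ger_powR; first by rewrite d0.
(* The resulting exponent of delta is minus the sum of (H - gamma) e, zeta e and H eps, each at most
   tau / 6. *)
have h1 : (H - gamma) * e <= tau / 6.
  apply: le_trans c1; rewrite ler_wpM2l ?subr_ge0 //.
  by rewrite /e gerBl.
have h2 : zeta * e <= tau / 6.
  by apply: le_trans c2; rewrite ler_wpM2l // /e gerBl.
have : H * D = H * e + H * eps by rewrite /e; ring.
by rewrite /b; move: h1 h2 c3; rewrite !mulrBl; lra.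
Qed.

(** (A1) is used at time delta for every t up to delta: the supremum over [0, delta] dominates each
    single displacement. *)
Lemma slow_moves_of_conditionA1 (H gamma : R) : conditionA1 X P H ->
  0 < gamma -> gamma < H -> exists C eta t0 : R,
  [/\ 0 < C, 0 < eta, 0 < t0 < 1 & forall delta, 0 < delta -> delta <= t0 ->
    slow_moves delta (delta `^ gamma) (C * delta `^ eta)].
Proof.
move=> [_ hA1] g0 gH; have [C [eta [t0 [C0 e0 t01 h]]]] := hA1 gamma g0 gH.
exists C, eta, t0; split => // delta d0 dt y t tp td.
have tp' := ltW tp.
apply: le_trans (h y delta d0 dt).
rewrite /transition -measurable_mu_extE; last first.
  apply: (filtration_measurable tp').
  exact: (mp_adapted HX tp' (borel_euclid_ballC _ _)).
apply: le_mu_ext => w /= hw; apply: le_trans (_ : (euclid_norm (X t w - y))%:E <= _)%E.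
  by rewrite lee_fin.
by apply: ereal_sup_ubound; exists t => //=; rewrite in_itv /= tp'.
Qed.

Lemma half_pow_eventually (c eta e : R) : 0 < eta -> 0 < e ->
  exists n0, forall n, (n0 <= n)%N -> c * (2^-1 ^+ n) `^ eta <= e.
Proof.
move=> eta0 e0.
have [c0|c0] := ltP 0 c; last first.
  by exists 0%N => n _; rewrite (le_trans _ (ltW e0)) // mulr_le0_ge0 ?powR_ge0.
have [t [t0 _ tc]] := powR_small eta0 e0 (divr_gt0 e0 c0).
have [n0 hn0] : exists n, 2^-1 ^+ n <= t :> R.
  by apply: expr_small => //; rewrite invr_ge0 ler0n invf_lt1 ?ltr1n.
exists n0 => n n0n; rewrite mulrC -ler_pdivlMr //; apply: le_trans tc.
apply: ge0_ler_powR; rewrite ?nnegrE ?exprn_ge0 ?invr_ge0 ?(ltW eta0) ?(ltW t0) //.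
by apply: le_trans hn0; rewrite ler_wiXn2l // ?invr_ge0 ?ler0n // invf_le1 ?ler1n.
Qed.

Local Notation step n := (2^-1 ^+ n : R).

Lemma step_gt0 n : 0 < step n.
Proof. by rewrite exprn_gt0 // invr_gt0. Qed.

Lemma step_le1 n : step n <= 1.
Proof. by rewrite exprn_ile1 ?invr_ge0 // invf_le1 ?ler1n. Qed.

Lemma step_natr n m : step n * (2 ^ (m + n))%:R = (2 ^ m)%:R.
Proof. by rewrite expnD natrM mulrCA (natrX _ 2 n) -exprMn mulVf // expr1n mulr1. Qed.

Lemma ae_cover (H gamma : R) : conditionA1 X P H -> 0 < gamma -> gamma < H ->
  exists N, forall kappa : nat, {ae P x, forall w, exists n0, forall n,
    (n0 <= n)%N -> forall k, (k < 2 ^ (kappa + n))%N ->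
    ~ dyadic_separated (k%:R * step n) (step n) (step n `^ gamma) N w}.
Proof.
move=> hA1 g0 gH.
have [C [eta [t0 [C0 e0 /andP[t00 t01] hslow]]]] := slow_moves_of_conditionA1 hA1 g0 gH.
(* Then eta N >= 2: one power of the step cancels the number of intervals, the other makes the
   series converge. *)
pose N := (Num.truncn (2 / eta)).+1.
have N2 : 2 <= eta * N%:R.
  by rewrite mulrC -ler_pdivrMr // ltW // truncnS_gt.
exists N => kappa.
pose B n := [set w | exists k : nat, (k < 2 ^ (kappa + n))%N /\
  dyadic_separated (k%:R * step n) (step n) (step n `^ gamma) N w].
have k0 n (k : nat) : 0 <= k%:R * step n by rewrite mulr_ge0 // ltW ?step_gt0.
have rn0 n : 0 < step n `^ gamma by rewrite powR_gt0 ?step_gt0.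
have mD n k : measurable (dyadic_separated (k%:R * step n) (step n) (step n `^ gamma) N).
  by apply: measurable_dyadic_separated => //; exact: step_gt0.
have mB n : measurable (B n).
  rewrite (_ : B n = \bigcup_(k in `I_(2 ^ (kappa + n)))
      dyadic_separated (k%:R * step n) (step n) (step n `^ gamma) N).
    by apply: bigcup_measurable => k _.
  by apply/seteqP; split => [w [k [kn h]]|w [k kn h]]; exists k.
(* From n1 on q is at most 1/2, and from n2 on the step is at most t0. *)
have [n1 hn1] := half_pow_eventually C e0 (ltac:(by rewrite invr_gt0) : 0 < 2^-1 :> R).
have [n2 hn2] := half_pow_eventually 1 (@ltr01 R) t00.
have := @pr_borel_cantelli _ _ _ (P x) B ((2 ^ kappa)%:R * (2 * C) ^+ N) 2^-1
  (maxn n1 n2) _ _ mB _.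
have -> : (0 <= (2 ^ kappa)%:R * (2 * C) ^+ N :> R).
  by rewrite mulr_ge0 // exprn_ge0 // mulr_ge0 // ltW.
rewrite invr_ge0 ler0n invf_lt1 ?ltr1n // => /(_ isT isT) bc.
apply: filterS (bc _).
  move=> w [m hm]; exists m => n mn k kn hw; apply: (hm n mn); by exists k.
move=> n; rewrite geq_max => /andP[n1n n2n].
have sn0 := step_gt0 n.
have q0 : 0 <= C * step n `^ eta by rewrite mulr_ge0 ?powR_ge0 // ltW.
apply: le_trans (_ : \sum_(k <- iota 0 (2 ^ (kappa + n)))
   prx (dyadic_separated (k%:R * step n) (step n) (step n `^ gamma) N) <= _).
  by apply: pr_cover => // w [k [kn hw]]; exists k => //; rewrite mem_iota.
apply: le_trans (_ : \sum_(k <- iota 0 (2 ^ (kappa + n)))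
   (2 * (C * step n `^ eta)) ^+ N <= _).
  apply: ler_sum => k _; apply: pr_dyadic_separated => //.
    exact: hn1.
  apply: hslow => //; have := hn2 n n2n.
  by rewrite mul1r powRr1 // ltW.
rewrite big_const_seq count_predT size_iota iter_addr_0 -[leLHS]mulr_natl.
have -> : (2 * (C * step n `^ eta)) ^+ N = (2 * C) ^+ N * step n `^ (eta * N%:R).
  by rewrite mulrA exprMn powRrM powR_mulrn ?powR_ge0.
apply: le_trans (_ : (2 ^ (kappa + n))%:R * ((2 * C) ^+ N * step n ^+ 2) <= _).
  rewrite !ler_wpM2l // ?exprn_ge0 ?mulr_ge0 ?(ltW C0) //.
  rewrite -powR_mulrn ?(ltW sn0) //; apply: ger_powR => //.
  by rewrite sn0 step_le1.
rewrite -(step_natr n kappa) expr2 le_eqVlt; apply/orP; left; apply/eqP.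
by move: (2 ^ (kappa + n))%:R ((2 * C) ^+ N) (step n) => y c s; ring.
Qed.

Lemma bernoulli_le (h : R) n : 0 <= h -> 1 + n%:R * h <= (1 + h) ^+ n.
Proof.
move=> h0; elim: n => [|n IH]; first by rewrite mul0r addr0 expr0.
rewrite exprS; apply: le_trans (_ : (1 + h) * (1 + n%:R * h) <= _).
  rewrite -natr1; have : 0 <= n%:R * h * h by rewrite !mulr_ge0.
  by move: n%:R => y; nra.
by rewrite ler_wpM2l // addr_ge0.
Qed.

(** With a = 2^tau, Bernoulli's inequality gives n (a - 1) <= a^n. *)
Lemma linear_le_step_pow (tau : R) m : 0 < tau -> exists2 K : R, 0 < K &
  forall n, (m + n).+1%:R <= K * step n `^ (- tau).
Proof.
move=> tau0; pose a : R := 2^-1 `^ (- tau).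
have a1 : 1 < a.
  by rewrite /a powRN invf_gt1 ?powR_gt0 ?invr_gt0 // powR_lt1 // invr_ge0 invf_lt1 ?ltr1n ?ler0n.
have h0 : 0 < a - 1 by rewrite subr_gt0.
exists (m.+1%:R + (a - 1)^-1); first by rewrite ltr_wpDl // invr_gt0.
move=> n; have -> : step n `^ (- tau) = a ^+ n.
  by rewrite -powR_mulrn ?powR_ge0 // /a -powRrM mulrC powRrM powR_mulrn.
have := bernoulli_le n (ltW h0); rewrite subrKC => hb.
have an1 : 1 <= a ^+ n by rewrite exprn_ege1 // ltW.
rewrite -addSn natrD mulrDl; apply: lerD; first by rewrite ler_peMr.
by rewrite ler_pdivlMl // mulrC; lra.
Qed.

(** A common consequence of (A2) and (A3); together with 1 <= H d it lets both cases of the theorem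
    share one proof. *)
Definition upper_A2 (H : R) : Prop :=
  exists eps zeta : R^nat, vanishing_pairs eps zeta /\ forall n (T : R), 0 < T ->
    exists C2 r0 : R, [/\ 0 < C2, 0 < r0 &
      upper_bound X P H (eps n) (zeta n) C2 r0 `]0, T]].

Definition visit (delta r : R) (z : 'rV[R]_d) (k : nat) : set Omega :=
  [set w | exists t, k%:R * delta <= t < k.+1%:R * delta /\ dist (X t w) z < r].

Lemma visit_hit delta r z z' k w : 0 < delta ->
  (forall t, 0 <= t -> X^~ w @ t^'+ --> X t w) -> dist z z' < r ->
  visit delta r z k w -> hit delta r z' k w.
Proof.
have [dd0 dC dT] := @euclid_dist_is_dist R d.
move=> d0 rc zz [t [tk tz]]; have /andP[kt _] := tk.
have t0 : 0 <= t by apply: le_trans kt; rewrite mulr_ge0 // ltW.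
have tz' : dist (X t w) z' < 2 * r by have := dT (X t w) z z'; lra.
have [h h0 hh] := right_continuous_dist (rc t t0) (ltac:(by rewrite subr_gt0) :
  0 < 2 * r - dist (X t w) z').
have tk' : k%:R * delta <= t < k%:R * delta + delta.
  by move: tk; rewrite -natr1 mulrDl mul1r.
have [m [i [im thi]]] := dyadic_time_dense d0 tk' h0.
exists m, i; split => //.
by have := dT (X (dyadic_time (k%:R * delta) delta m i) w) (X t w) z';
  have := hh _ thi; lra.
Qed.

(** * Few intervals visit any given ball *)

Section Few_visits.
Variables (H gamma tau : R).
Hypotheses (hA1 : conditionA1 X P H) (hA2 : upper_A2 H) (Hd : 1 <= H * d%:R)
  (tau0 : 0 < tau) (g0 : 0 < gamma) (gH : gamma < H)
  (Hg : (H - gamma) * d%:R <= tau / 6).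

Let H0 : 0 < H. Proof. exact: lt_trans gH. Qed.

Let D0 : 0 < d%:R :> R.
Proof.
by rewrite lt0r ler0n andbT; apply: contraTneq Hd => ->; rewrite mulr0 -ltNge.
Qed.

Let D1 : 1 <= d%:R :> R.
Proof. by move: D0; rewrite ltr0n ler1n. Qed.

Lemma kernel_step_bound kappa : exists2 K : R, 0 < K & exists n0, forall n,
  (n0 <= n)%N -> forall l y t, (0 < l)%N -> (l < 2 ^ (kappa + n))%N ->
  l%:R * step n <= t -> t <= l.+1%:R * step n ->
  (transition X P t y [set z | (dist z y < 5 * step n `^ gamma)%R] <=
   (K * step n `^ (- (tau / 2)) / l%:R)%:E)%E.
Proof.
have [eps [zeta [[ez0 ecvg zcvg] hub]]] := hA2.
(* Such a pair satisfies zeta d <= tau / 6, H eps <= tau / 6 and eps < 1 <= d, as [kernel_bound]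
   asks. *)
pose e1 := Num.min (Num.min (tau / 6 / d%:R) (tau / 6 / H)) 1.
have t60 : 0 < tau / 6 by rewrite divr_gt0.
have e10 : 0 < e1 by rewrite !lt_min ltr01 !divr_gt0 //; lra.
have /cvgr0_norm_lt /(_ _ e10) [N1 _ hN1] := ecvg.
have /cvgr0_norm_lt /(_ _ e10) [N2 _ hN2] := zcvg.
pose j := maxn N1 N2.
have [ej0 zj0] := ez0 j.
have ej : eps j < e1.
  by have := hN1 j (leq_maxl _ _); rewrite /= ger0_norm.
have zj : zeta j < e1.
  by have := hN2 j (leq_maxr _ _); rewrite /= ger0_norm.
move: ej zj; rewrite !lt_min => /andP[/andP[_ ejH] ej1] /andP[/andP[zjd _] _].
set e := eps j in ej0 ejH ej1 *; set zt := zeta j in zj0 zjd *.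
pose T : R := (2 ^ kappa)%:R.
have T0 : 0 < T by rewrite ltr0n expn_gt0.
have [C2 [r0 [C20 r00 hC2]]] := hub j T T0.
exists (C2 * (5 `^ (d%:R - e) * T `^ (H * e))).
  by rewrite !mulr_gt0 ?powR_gt0.
have [n0 hn0] := half_pow_eventually 5 g0 r00.
exists n0 => n n0n l y t l0 ln lt tl.
have s0 := step_gt0 n.
have l0' : 1 <= l%:R :> R by rewrite ler1n.
have st : step n <= t by apply: le_trans lt; rewrite ler_peMl // ltW.
have tT : t <= T.
  apply: le_trans tl _; rewrite /T -(step_natr n kappa) mulrC ler_pM2l //.
  by rewrite ler_nat.
have t0 : 0 < t by exact: lt_le_trans st.
have r50 : 0 < 5 * step n `^ gamma by rewrite mulr_gt0 // powR_gt0.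
have tI : `]0, T]%classic t by rewrite /= in_itv /= t0.
apply: le_trans (hC2 (5 * step n `^ gamma) y t r50 (hn0 n n0n) tI) _.
rewrite lee_fin -!mulrA ler_wpM2l //; first exact: ltW.
apply: le_trans (_ : (5 * step n `^ gamma / t `^ (H + zt)) `^ (d%:R - e) <= _).
  by rewrite ge_min mulrA lexx orbT.
rewrite !mulrA; apply: kernel_bound => //.
- exact: step_le1.
- exact: lt_le_trans l0'.
- by rewrite mulrC.
- exact: lt_le_trans ej1 D1.
- exact: ltW.
- by rewrite -ler_pdivlMr // ltW.
- by rewrite mulrC -ler_pdivlMr // ltW.
Qed.

Lemma ae_few_visits kappa : exists2 C0 : R, 0 < C0 &
  {ae P x, forall w, (forall t, 0 <= t -> X^~ w @ t^'+ --> X t w) ->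
    exists n0, forall n, (n0 <= n)%N -> forall z : 'rV[R]_d,
    (forall i, `|z ord0 i| <= (2 ^ kappa)%:R) ->
    (hit_count (visit (step n) (step n `^ gamma) z)
      (iota 0 (2 ^ (kappa + n))) w)%:R <= C0 * step n `^ (- tau)}.
Proof.
have [C [eta [t0 [CC0 e0 /andP[t00 t01] hslow]]]] := slow_moves_of_conditionA1 hA1 g0 gH.
have [K1 K10 [n3 hn3]] := kernel_step_bound kappa.
have [K2 K20 hK2] := linear_le_step_pow kappa (divr_gt0 tau0 (ltac:(lra) : 0 < 4 :> R)).
have [n1 hn1] := half_pow_eventually C e0 (ltac:(by rewrite invr_gt0) : 0 < 2^-1 :> R).
have [n2 hn2] := half_pow_eventually 1 (@ltr01 R) t00.
(* An integer above gamma, so that the mesh of the grid can be a power of 2 up to a constant and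
   still be finer than the radius. *)
pose g := (Num.truncn gamma).+1.
have gle : gamma <= g%:R by rewrite ltW // truncnS_gt.
(* The tail is of order [step n] to the power tau i / 4: this beats the 2^(g d n) grid points and
   leaves one power of the step for Borel-Cantelli. *)
pose i := (Num.truncn ((g * d).+1%:R / (tau / 4))).+1.
have hi : (g * d).+1%:R <= tau / 4 * i%:R.
  by rewrite mulrC -ler_pdivrMr ?divr_gt0 // ltW // truncnS_gt.
(* With this mesh, d / M n is strictly below 2^-(g n), for every d. *)
pose M n := (2 * d.+1 * 2 ^ (g * n))%N.
have M0 n : (0 < M n)%N by rewrite !muln_gt0 expn_gt0.
have /dependent_choice[gr hgr] := fun n => @euclid_grid R d (2 ^ kappa) (M n) (M0 n).
pose L n := (Num.truncn (step n `^ (- tau))).+1.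
have sr0 n : 0 < step n `^ (- tau) by rewrite powR_gt0 // step_gt0.
have Lge n : step n `^ (- tau) <= (L n)%:R by rewrite ltW // truncnS_gt.
have Lle n : (L n)%:R <= 2 * step n `^ (- tau).
  have h1 : 1 <= step n `^ (- tau).
    rewrite powRN invf_ge1 ?powR_gt0 ?step_gt0 //.
    rewrite -[leRHS](powRr0 (step n)); apply: ger_powR; last exact: ltW.
    by rewrite step_gt0 step_le1.
  have h2 : (Num.truncn (step n `^ (- tau)))%:R <= step n `^ (- tau).
    by rewrite truncn_le ltW.
  by rewrite /L -natr1 mulrDl mul1r addrC lerD.
pose B n := [set w | exists a, (i * L n < hit_count
  (hit (step n) (step n `^ gamma) (gr n a)) (iota 0 (2 ^ (kappa + n))) w)%N].
have mBa n a : measurable [set w | (i * L n < hit_count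
    (hit (step n) (step n `^ gamma) (gr n a)) (iota 0 (2 ^ (kappa + n))) w)%N].
  apply: (measurable_hit_count _ _ (fun c => i * L n < c)%N) => k.
  exact: measurable_hit (step_gt0 n) _.
have mB n : measurable (B n).
  apply: (@sigma_algebra_exists _ measurable _ _ _ (mBa n)).
  split; [exact: measurable0 | by move=> A; exact: measurableD |].
  by move=> A mA; exact: bigcup_measurable.
(* A coordinate of the grid takes at most G 2^(g n) values. *)
pose G := (2 * 2 ^ kappa * (2 * d.+1)).+1.
pose K3 : R := 2 * K1 * K2.
have K30 : 0 < K3 by rewrite !mulr_gt0.
have C0 : 0 <= (G ^ d)%:R * K3 ^+ i by rewrite mulr_ge0 // exprn_ge0 // ltW.
exists (2 * i%:R); first by rewrite mulr_gt0 // ltr0n.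
have half01 : 0 <= (2^-1 : R) < 1 by rewrite invr_ge0 ler0n invf_lt1 ?ltr1n.
have : {ae P x, forall w, exists m, forall n, (m <= n)%N -> ~ B n w}.
  apply: (@pr_borel_cantelli _ _ _ (P x) B _ _ (maxn n3 (maxn n1 n2)) C0 half01 mB) => n.
  rewrite !geq_max => /and3P[n3n n1n n2n].
  have s0 := step_gt0 n; have r0 : 0 < step n `^ gamma by rewrite powR_gt0.
  have hs : slow_moves (step n) (step n `^ gamma) (C * step n `^ eta).
    apply: hslow => //; have := hn2 n n2n.
    by rewrite mul1r powRr1 // ltW.
  apply: le_trans (_ : \sum_(a <- enum {ffun 'I_d -> 'I_(2 * 2 ^ kappa * M n).+1})
    (K3 ^+ i * step n ^+ (g * d).+1) <= _).
    apply: le_trans (@pr_cover _ _ _ (P x) _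
      (enum {ffun 'I_d -> 'I_(2 * 2 ^ kappa * M n).+1}) (fun a => [set w |
        (i * L n < hit_count (hit (step n) (step n `^ gamma) (gr n a))
          (iota 0 (2 ^ (kappa + n))) w)%N]) (B n) (mB n) (fun a _ => mBa n a) _) _.
      by move=> w [a ha]; exists a => //; rewrite mem_enum.
    apply: ler_sum => a _.
    pose v l : R := K1 * step n `^ (- (tau / 2)) / l%:R.
    pose Mv : R := 2 * (K1 * step n `^ (- (tau / 2))) * (kappa + n).+1%:R.
    have v0 l : 0 <= v l by rewrite divr_ge0 // mulr_ge0 ?powR_ge0 // ltW.
    have vM : \sum_(l <- iota 1 (2 ^ (kappa + n))) 2 * v l <= Mv.
      under eq_bigr do rewrite /v mulrA.
      rewrite -mulr_sumr ler_wpM2l ?harmonic_sum_le //.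
      by rewrite !mulr_ge0 ?powR_ge0 // ltW.
    have L0 : (0 < L n)%N by [].
    have hmany := pr_many_hits (gr n a) s0 (hn1 n n1n) hs L0 v0 vM
      (fun l y t => hn3 n n3n l y t).
    apply: le_trans (hmany i) _.
    (* In exponents of the step, Mv has -tau/2 from the kernel and -tau/4 from the harmonic sum,
       while 1 / L n gives tau. *)
    apply: le_trans (_ : (K3 * step n `^ (tau / 4)) ^+ i <= _).
      rewrite lerXn2r ?nnegrE ?divr_ge0 ?mulr_ge0 ?powR_ge0 ?(ltW K10) ?(ltW K20) //.
      rewrite ler_pdivrMr ?ltr0n //.
      apply: le_trans (_ : K3 * step n `^ (tau / 4) * step n `^ (- tau) <= _); last first.
        by rewrite ler_wpM2l // mulr_ge0 ?powR_ge0 // ltW.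
      rewrite -mulrA -powRDp // (_ : tau / 4 - tau = - (tau / 2) + - (tau / 4)); last by field.
      rewrite powRDp // /Mv /K3.
      have := hK2 n; have : 0 <= 2 * (K1 * step n `^ (- (tau / 2))).
        by rewrite !mulr_ge0 ?powR_ge0 // ltW.
      move=> c0 /(ler_wpM2l c0) /le_trans; apply; rewrite le_eqVlt; apply/orP; left.
      apply/eqP; ring.
    rewrite exprMn ler_wpM2l ?exprn_ge0 ?(ltW K30) //.
    rewrite -[leLHS]powR_mulrn ?powR_ge0 // -powRrM.
    rewrite -[leRHS]powR_mulrn ?(ltW s0) //.
    by apply: ger_powR; rewrite ?s0 ?step_le1.
  rewrite big_const_seq count_predT iter_addr_0 -[leLHS]mulr_natl -cardE card_ffun !card_ord.
  apply: le_trans (_ : ((G * 2 ^ (g * n)) ^ d)%:R * (K3 ^+ i * step n ^+ (g * d).+1) <= _).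
    rewrite ler_wpM2r ?mulr_ge0 ?exprn_ge0 ?(ltW K30) ?(ltW s0) // ler_nat.
    have [->//|dn0] := posnP d; rewrite leq_exp2r // /G mulSn /M !mulnA.
    by rewrite -[X in (X <= _)%N]add1n leq_add2r expn_gt0.
  rewrite expnMn natrM exprS.
  have -> : ((2 ^ (g * n)) ^ d)%:R = (step n ^+ (g * d))^-1 :> R.
    by rewrite -!exprM exprVn invrK -natrX -expnM mulnAC [(_ * n)%N]mulnC.
  rewrite le_eqVlt; apply/orP; left; apply/eqP.
  have : step n ^+ (g * d) != 0 by rewrite expf_neq0 // gt_eqF.
  move: (G ^ d)%:R (K3 ^+ i) (step n ^+ (g * d)) (step n) => u1 u2 u3 u4 u30.
  by field.
apply: filterS => w [m hm] rc; exists m => n mn z hz.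
have [a ha] := hgr n z hz.
have s0 := step_gt0 n.
have zr : dist z (gr n a) < step n `^ gamma.
  apply: le_lt_trans ha (lt_le_trans (_ : _ < step n ^+ g) _); last first.
    by rewrite -powR_mulrn ?(ltW s0) //; apply: ger_powR; rewrite ?s0 ?step_le1.
  rewrite -exprM exprVn mulnC -natrX ltr_pdivrMr ?ltr0n //.
  rewrite /M natrM mulrCA mulVf ?mulr1 ?ltr_nat; last first.
    by rewrite pnatr_eq0 -lt0n expn_gt0.
  exact: leq_pmull.
apply: le_trans (_ : (i * L n)%:R <= _); last first.
  by rewrite natrM -mulrA mulrCA ler_wpM2l.
rewrite ler_nat; apply: leq_trans (_ : (hit_count
    (hit (step n) (step n `^ gamma) (gr n a)) (iota 0 (2 ^ (kappa + n))) w <= _)%N).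
  by apply: hit_count_mono => k _; exact: visit_hit.
by rewrite leqNgt; apply/negP => h; apply: (hm n mn); exists a.
Qed.
End Few_visits.

(** * Dimensions along almost every path *)

Lemma step_index n (t : R) : 0 <= t -> exists k : nat,
  k%:R * step n <= t < k.+1%:R * step n.
Proof.
move=> t0; have s0 := step_gt0 n; exists (Num.truncn (t / step n)).
rewrite -ler_pdivlMr // -ltr_pdivrMr //; apply: truncn_itv.
by rewrite divr_ge0 // ltW.
Qed.

Lemma step_index_lt kappa n (t : R) k : t < (2 ^ kappa)%:R ->
  k%:R * step n <= t -> (k < 2 ^ (kappa + n))%N.
Proof.
move=> tk kt; rewrite -(ltr_nat R) -(ltr_pM2r (step_gt0 n)) [ltRHS]mulrC.
by rewrite step_natr; exact: le_lt_trans kt tk.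
Qed.

Lemma expr_scale_from (b rho : R) n0 : 0 < b < 1 -> 0 < rho -> rho <= b ^+ n0.+1 ->
  exists n, (n0 <= n)%N /\ b ^+ n.+1 <= rho < b ^+ n.
Proof.
move=> /andP[b0 b1] r0 rle.
have bn0 : b ^+ n0.+1 < 1 by rewrite exprn_ilt1 // ltW.
have [||n /andP[h1 h2]] := @expr_scale _ b rho; first by rewrite b0.
  by rewrite r0 (le_lt_trans rle).
exists n; split; last by rewrite h1.
rewrite leqNgt; apply/negP => nn0.
have : b ^+ n0 <= b ^+ n.+1 by rewrite ler_wiXn2l // ltW.
have : b ^+ n0.+1 < b ^+ n0 by rewrite exprS gtr_pMl ?exprn_gt0.
lra.
Qed.

(** Times are bounded, and for the inverse relation below positions too, because the almost sure
    bounds are uniform on such ranges only; as kappa grows the pieces exhaust the graph. *)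
Definition path_relation (kappa : nat) w (t : R) (y : 'rV[R]_d) : Prop :=
  0 <= t < (2 ^ kappa)%:R /\ y = X t w.

Definition preimage_relation (kappa : nat) w (y : 'rV[R]_d) (t : R) : Prop :=
  [/\ 0 <= t < (2 ^ kappa)%:R, forall i, `|y ord0 i| <= (2 ^ kappa)%:R &
      X t w = y].

Section Spreading.
Variables (w : Omega) (gamma : R).
Hypotheses (rc : forall t, 0 <= t -> X^~ w @ t^'+ --> X t w) (g0 : 0 < gamma).

(** Choose n with 2^-(n+1) <= rho < 2^-n. The relevant times of U lie in one interval of length 2^-n
    and its two neighbours, whence 3 N balls; their diameter 18 2^(-n gamma) is at most 18 (2
    rho)^gamma. *)
Lemma path_spreads N kappa : (exists n0, forall n, (n0 <= n)%N ->
    forall k, (k < 2 ^ (kappa + n))%N ->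
    ~ dyadic_separated (k%:R * step n) (step n) (step n `^ gamma) N w) ->
  spreads (@real_dist R) dist (path_relation kappa w) gamma 0.
Proof.
have [dd0 dC dT] := @euclid_dist_is_dist R d.
move=> [n0 hn0]; have p2 : 0 < 2 `^ gamma :> R by rewrite powR_gt0.
exists ((3 * N)%:R + 18 * 2 `^ gamma), (step n0.+1); split.
- by rewrite ltr_wpDl // mulr_gt0.
- exact: step_gt0.
move=> rho U rho0 rle Us.
have [|n [n0n /andP[r1 r2]]] := expr_scale_from _ rho0 rle.
  by rewrite invr_gt0 ltr0n invf_lt1 ?ltr1n.
have s0 := step_gt0 n.
have [[t0 [Ut0 /andP[t00 t0k]]]|none] :=
  pselect (exists t, U t /\ 0 <= t < (2 ^ kappa)%:R); last first.
  exists 'I_0, (fun=> set0); split.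
  - by rewrite card_ord !(mulr_ge0, addr_ge0) ?powR_ge0.
  - by move=> _ y y' [].
  - by move=> t y Ut [tk _]; case: none; exists t.
have [k0 /andP[k0t tk0]] := step_index n t00.
have /choice[c hc] k : exists c : 'I_N -> 'rV[R]_d, (k < 2 ^ (kappa + n))%N ->
    forall t, k%:R * step n <= t < k%:R * step n + step n ->
    exists j, dist (X t w) (c j) <= 9 * step n `^ gamma.
  case: (ltnP k (2 ^ (kappa + n))) => [kn|_]; last by exists (fun=> 0).
  have [|||c hc] := cover_of_not_separated _ _ _ rc (hn0 n n0n k kn).
  - by rewrite mulr_ge0 // ltW.
  - exact: s0.
  - by rewrite powR_gt0.
  by exists c.
(* The index [(k0 + p.1).-1] runs through k0 - 1, k0 and k0 + 1; for k0 = 0 the predecessor merely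
   repeats 0. *)
exists ('I_3 * 'I_N)%type,
  (fun p : 'I_3 * 'I_N => [set y | dist y (c (k0 + p.1).-1 p.2) <= 9 * step n `^ gamma]); split.
- by rewrite card_prod !card_ord oppr0 powRr0 mulr1 lerDl mulr_ge0 // ltW.
- move=> p y y' /= hy hy'.
  apply: le_trans (_ : 18 * step n `^ gamma <= _).
    by have := dT y (c (k0 + p.1).-1 p.2) y'; rewrite (dC (c _ _) y'); lra.
  apply: le_trans (_ : 18 * 2 `^ gamma * rho `^ gamma <= _); last first.
    by rewrite ler_wpM2r ?powR_ge0 // lerDr.
  rewrite -mulrA -powRM ?(ltW rho0) // ler_wpM2l //.
  apply: ge0_ler_powR; rewrite ?nnegrE ?mulr_ge0 ?(ltW g0) ?(ltW s0) ?(ltW rho0) //.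
  by rewrite exprS in r1; lra.
- move=> t y Ut [/andP[tt0 tk] ->].
  have [k /andP[kt tk1]] := step_index n tt0.
  have kn := step_index_lt tk kt.
  have := Us t t0 Ut Ut0; rewrite /real_dist ler_norml => /andP[d1 d2].
  have kk0 : (k <= k0.+1)%N.
    rewrite leqNgt; apply/negP => lt.
    have : k0.+1%:R * step n + step n <= k%:R * step n.
      by rewrite -[X in _ + X <= _]mul1r -mulrDl natr1 ler_pM2r // ler_nat.
    lra.
  have k0k : (k0 <= k.+1)%N.
    rewrite leqNgt; apply/negP => lt.
    have : k.+1%:R * step n + step n <= k0%:R * step n.
      by rewrite -[X in _ + X <= _]mul1r -mulrDl natr1 ler_pM2r // ler_nat.
    lra.
  have i3 : (k.+1 - k0 < 3)%N by rewrite ltn_subLR // addnC !addSn add0n !ltnS.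
  have [|j hj] := hc k kn t; first by rewrite kt -{2}[step n]mul1r -mulrDl natr1.
  by exists (Ordinal i3, j) => /=; rewrite subnKC.
Qed.

(** Scales are powers of b = 2^-gamma, so that rho is comparable to the radius [step n] to the power
    gamma. U lies in the ball of that radius around any of its points, and only intervals visiting
    this ball contain related times: their number is at most C0 rho^(-tau/gamma), their length at
    most 2 rho^(1/gamma). *)
Lemma preimage_spreads tau C0 kappa : 0 < tau -> 0 < C0 ->
  (exists n0, forall n, (n0 <= n)%N -> forall z : 'rV[R]_d,
    (forall i, `|z ord0 i| <= (2 ^ kappa)%:R) ->
    (hit_count (visit (step n) (step n `^ gamma) z)
      (iota 0 (2 ^ (kappa + n))) w)%:R <= C0 * step n `^ (- tau)) ->
  spreads dist (@real_dist R) (preimage_relation kappa w) gamma^-1 (tau / gamma).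
Proof.
have [dd0 dC dT] := @euclid_dist_is_dist R d.
move=> tau0 C00 [n0 hn0]; pose b : R := 2^-1 `^ gamma.
have b0 : 0 < b by rewrite powR_gt0 // invr_gt0.
have b1 : b < 1 by rewrite powR_lt1 // invr_ge0 ler0n invf_lt1 ?ltr1n.
have bE n : b ^+ n = step n `^ gamma.
  by rewrite -powR_mulrn ?powR_ge0 // /b -powRrM mulrC powRrM powR_mulrn.
have root n : (step n `^ gamma) `^ gamma^-1 = step n.
  by rewrite -powRrM mulfV ?gt_eqF // powRr1 // ltW // step_gt0.
have gi0 : 0 <= gamma^-1 by rewrite invr_ge0 ltW.
exists (C0 + 2), (b ^+ n0.+1); split.
- by rewrite addr_gt0.
- exact: exprn_gt0.
move=> rho U rho0 rle Us.
have [|n [n0n]] := expr_scale_from _ rho0 rle; first by rewrite b0.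
rewrite !bE => /andP[r1 r2]; have s0 := step_gt0 n.
have [[z [Uz zbox]]|none] := pselect (exists y, U y /\
    forall i, `|y ord0 i| <= (2 ^ kappa)%:R); last first.
  exists 'I_0, (fun=> set0); split.
  - by rewrite card_ord mulr_ge0 ?powR_ge0 // addr_ge0 // ltW.
  - by move=> _ y y' [].
  - by move=> y t Uy [_ ybox _]; case: none; exists y.
pose S := [seq k <- iota 0 (2 ^ (kappa + n)) |
  `[< visit (step n) (step n `^ gamma) z k w >]].
exists 'I_(size S), (fun j : 'I_(size S) => [set t | (nth 0%N S j)%:R * step n <= t <
  (nth 0%N S j).+1%:R * step n]); split.
- rewrite card_ord size_filter; apply: le_trans (hn0 n n0n z zbox) _.
  apply: le_trans (_ : C0 * rho `^ (- (tau / gamma)) <= _); last first.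
    by rewrite ler_wpM2r ?powR_ge0 // lerDl.
  rewrite ler_wpM2l ?(ltW C00) // !powRN lef_pV2 ?posrE ?powR_gt0 //.
  rewrite mulrC powRrM; apply: ge0_ler_powR; rewrite ?nnegrE ?powR_ge0 ?(ltW s0) ?(ltW tau0) //.
  rewrite -[leRHS]root; apply: ge0_ler_powR; rewrite ?nnegrE ?powR_ge0 //; exact: ltW.
- move=> j t t' /= /andP[h1 h2] /andP[h3 h4].
  apply: le_trans (_ : step n <= _).
    rewrite /real_dist ler_norml; move: h2 h4; rewrite -natr1 mulrDl mul1r.
    by move=> h2 h4; lra.
  apply: le_trans (_ : 2 * rho `^ gamma^-1 <= _); last first.
    by rewrite ler_wpM2r ?powR_ge0 // lerDr ltW.
  have : step n.+1 <= rho `^ gamma^-1.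
    rewrite -[leLHS]root; apply: ge0_ler_powR; rewrite ?nnegrE ?powR_ge0 ?(ltW rho0) //.
  by rewrite exprS; lra.
- move=> y t Uy [/andP[t0 tk] ybox Xty].
  have [k /andP[kt tk1]] := step_index n t0.
  have kS : k \in S.
    rewrite mem_filter mem_iota add0n (step_index_lt tk kt) leq0n !andbT.
    apply/asboolP; exists t; split; first by rewrite kt.
    by rewrite Xty; apply: le_lt_trans r2; exact: Us.
  have kS' : (index k S < size S)%N by rewrite index_mem.
  by exists (Ordinal kS') => /=; rewrite nth_index // kt.
Qed.
End Spreading.

(** The tolerance runs through the sequence 1 / (i + 1) and kappa through the integers, so countably
    many null sets are discarded before E is chosen. *)
Lemma ae_dimensions (H : R) : conditionA1 X P H -> upper_A2 H -> 1 <= H * d%:R ->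
  {ae P x, forall w, forall E : set R, E `<=` `[0, +oo[ ->
     hausdorff_dim dist (X^~ w @` E) =
       ((H^-1)%:E * hausdorff_dim (@real_dist R) E)%E /\
     packing_dim dist (X^~ w @` E) =
       ((H^-1)%:E * packing_dim (@real_dist R) E)%E}.
Proof.
move=> hA1 hA2 Hd; have H0 : 0 < H by case: hA1.
have D0 : 0 < d%:R :> R.
  by rewrite lt0r ler0n andbT; apply: contraTneq Hd => ->; rewrite mulr0 -ltNge.
pose tau (i : nat) : R := i.+1%:R^-1.
have tau0 i : 0 < tau i by rewrite invr_gt0.
(* The three bounds make gamma = H - m positive, place it within tau of H and give (H - gamma) d <=
   tau / 6. *)
pose m i := Num.min (Num.min (H / 2) (tau i / 2)) (tau i / 6 / d%:R).
have m0 i : 0 < m i by rewrite !lt_min !divr_gt0.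
have m1 i : m i <= H / 2 by rewrite !ge_min lexx.
have m2 i : m i <= tau i / 2 by rewrite !ge_min lexx orbT.
have m3 i : m i * d%:R <= tau i / 6.
  by rewrite -ler_pdivlMr // !ge_min lexx orbT.
pose gamma i := H - m i.
have g0 i : 0 < gamma i by rewrite /gamma; have := m1 i; lra.
have gH i : gamma i < H by rewrite /gamma gtrBl.
have Hg i : (H - gamma i) * d%:R <= tau i / 6 by rewrite /gamma subKr.
have /choice[N hN] := fun i => ae_cover hA1 (g0 i) (gH i).
have /ae_foralln hcov := fun i => ae_foralln (hN i).
have hvis' i : {ae P x, forall w, forall kappa, (forall t, 0 <= t -> X^~ w @ t^'+ --> X t w) ->
    exists2 C0 : R, 0 < C0 & exists n0, forall n, (n0 <= n)%N -> forall z : 'rV[R]_d,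
    (forall i, `|z ord0 i| <= (2 ^ kappa)%:R) ->
    (hit_count (visit (step n) (step n `^ gamma i) z)
      (iota 0 (2 ^ (kappa + n))) w)%:R <= C0 * step n `^ (- tau i)}.
  apply: ae_foralln => kappa.
  have [C0 C00 h] := ae_few_visits hA1 hA2 Hd (tau0 i) (g0 i) (gH i) (Hg i) kappa.
  by apply: filterS h => w hw rc; exists C0 => //; exact: hw.
have /ae_foralln hvis := hvis'.
have hcad := mp_cadlag HX x.
apply: filterS3 hcov hvis hcad => w wcov wvis [rc _] E E0.
have Hsp : forall tau', 0 < tau' -> exists gamma' theta : R,
  [/\ 0 < gamma', H - tau' < gamma' < H, theta <= tau',
      forall k, spreads (@real_dist R) dist (path_relation k w) gamma' 0 &
      forall k, spreads dist (@real_dist R) (preimage_relation k w)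
        gamma'^-1 (theta / gamma')].
  move=> tau' tau'0; pose i := Num.truncn tau'^-1.
  have ti : tau i <= tau'.
    by rewrite /tau -[leRHS]invrK lef_pV2 ?posrE ?invr_gt0 // ltW // truncnS_gt.
  exists (gamma i), (tau i); split => //.
  - by rewrite gH andbT /gamma; have := m2 i; have := tau0 i; lra.
  - by move=> k; apply: path_spreads (wcov i k).
  - move=> k; have [C0 C00 hC0] := wvis i k rc.
    exact: preimage_spreads hC0.
have r1 t : 0 <= t -> exists k, path_relation k w t (X t w).
  move=> t0; exists (Num.truncn t).+1; split => //; rewrite t0 /=.
  apply: lt_le_trans (truncnS_gt t) _.
  by rewrite ler_nat ltnW // ltn_expl.
have r2 t : 0 <= t -> exists k, preimage_relation k w (X t w) t.
  move=> t0; pose y := t + \sum_i `|X t w ord0 i|.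
  have s0 : 0 <= \sum_i `|X t w ord0 i| by apply: sumr_ge0.
  have ylt : y < (2 ^ (Num.truncn y).+1)%:R.
    apply: lt_le_trans (truncnS_gt y) _.
    by rewrite ler_nat ltnW // ltn_expl.
  exists (Num.truncn y).+1; split => //.
    by rewrite t0 /=; apply: le_lt_trans ylt; rewrite lerDl.
  move=> i; apply: le_trans (ltW ylt); rewrite /y (bigD1 i) //= addrCA lerDl.
  by rewrite addr_ge0 // sumr_ge0.
have ed := @euclid_dist_is_dist R d.
split; first exact: (hausdorff_dim_image ed H0 r1 r2 Hsp).
exact: (packing_dim_image 0 ed H0 r1 r2 Hsp).
Qed.
End Law.
End Markov_estimates.

Theorem theorem3p3 (R : realType) (d : nat) (disp : measure_display)
  (Omega : measurableType disp) (F : R -> set_system Omega)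
  (X : R -> Omega -> 'rV[R]_d) (P : 'rV[R]_d -> probability Omega R) (H : R)
  (HX : markov_process F X P)
  (HA1 : conditionA1 X P H)
  (HA : (1 < H * d%:R /\ conditionA2 X P H) \/
        (1 = H * d%:R /\ conditionA3 X P H)) :
  forall x : 'rV[R]_d,
    {ae P x, forall w, forall E : set R, measurable E -> E `<=` `[0, +oo[ ->
       hausdorff_dim euclid_dist (X^~ w @` E) =
         ((H^-1)%:E * hausdorff_dim real_dist E)%E} /\
    {ae P x, forall w, forall E : set R, measurable E -> E `<=` `[0, +oo[ ->
       packing_dim euclid_dist (X^~ w @` E) =
         ((H^-1)%:E * packing_dim real_dist E)%E}.
Proof.
move=> x.
have [Hd hA2] : 1 <= H * d%:R /\ upper_A2 (X := X) (P := P) H.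
  case: HA => [[/ltW Hd [eps [zeta [ez h]]]]|[Hd [eps [zeta [ez h]]]]].
    split => //; exists eps, zeta; split => // n T T0.
    have [C1 [C2 [r0 [_ C20 /andP[r00 _] _ ub]]]] := h n T T0.
    by exists C2, r0.
  split; first by rewrite -Hd.
  exists eps, zeta; split => // n T T0.
  have [C1 [C2 [r0 [_ C20 /andP[r00 _] _ ub]]]] := h n T T0.
  exists C2, r0; split => // r y t rp rr0; rewrite /= in_itv /= => /andP[t0 _].
  by apply: ub => //; rewrite /= in_itv /= t0.
have h := ae_dimensions HX x HA1 hA2 Hd.
by split; apply: filterS h => w hw E _ /hw[].
Qed.
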